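(* The canonical (Liouville) $1$-form $\theta:=p\,\mathrm{d}q$ is preserved along the solution $(\tilde q,\tilde p)$, with $\tilde q_{t_0}=a$, $\tilde p_{t_1}=b$, of the rough adjoint system $$q_t-q_{t_0}=\int_{t_0}^tf(q_r)\,dr+\sigma(q_r)\,d\mathbf{Z}_r,\qquad p_{t_1}-p_t=-\int_t^{t_1}\bigg[\Big(\frac{\partial f}{\partial q}(q_r)\Big)^*p_r\,dr+\Big(\frac{\partial\sigma}{\partial q}(q_r)\Big)^*p_r\,d\mathbf{Z}_r\bigg]$$ at the boundary points $t=t_0,t_1$. That is, $$\tilde p_{t_0}\,\mathrm{d}\tilde q_{t_0}=\tilde p_{t_1}\,\mathrm{d}\tilde q_{t_1}.$$
   Context: Let $\alpha\in(\frac13,\frac12]$ and let $\mathbf{Z}=(Z,\mathbb{Z})$ be a fixed geometric $\alpha$-Hölder rough path on $[t_0,t_1]$ with values in $\mathbb{R}^K$ (Chen's relation and $\mathbb{Z}_{s,t}+\mathbb{Z}_{s,t}^*=Z_{s,t}\otimes Z_{s,t}$). Integrals against $\mathbf{Z}$ are rough integrals and solutions are paths controlled by $Z$ whose Gubinelli derivatives are the coefficients of $d\mathbf{Z}$. $f\in C^\infty(\mathbb{R}^N,\mathbb{R}^N)$, $\sigma\in C^\infty(\mathbb{R}^N,\mathcal{L}(\mathbb{R}^K,\mathbb{R}^N))$; $(\partial\sigma/\partial q)^*p\,d\mathbf{Z}$ has $i$-th component $\sum_{l,j}p_l\,\partial_{q_i}\sigma_{lj}(q)\,d\mathbf{Z}^j$.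 (This is the rough Hamiltonian system with Hamiltonians $H=\langle p,f(q)\rangle$, $\mathcal{H}=\langle p,\sigma(q)\rangle$.) Standing assumption: the forward RDE $dq_t=f(q_t)\,dt+\sigma(q_t)\,d\mathbf{Z}_t$ has a unique solution on $[t_0,t_1]$ for initial values in the open set of initial data $a$ considered, so that for every terminal value $b\in\mathbb{R}^N$ there is a unique solution $(\tilde q,\tilde p)$ on $[t_0,t_1]$ with $\tilde q_{t_0}=a$, $\tilde p_{t_1}=b$, depending smoothly on $(a,b)$. $\mathrm{d}$ is the exterior derivative with respect to the boundary data $(a,b)$, $\tilde q_{t_i},\tilde p_{t_i}$ being viewed as functions of $(a,b)$, and $p\,\mathrm{d}q=\sum_ip_i\,\mathrm{d}q^i$. *)

(* Defs.v *)
From HB Require Import structures.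
From mathcomp Require Import all_boot all_order all_algebra.
From mathcomp Require Import all_classical all_reals all_analysis.
Set Implicit Arguments.
Unset Strict Implicit.
Unset Printing Implicit Defensive.
Import Order.TTheory GRing.Theory Num.Theory numFieldNormedType.Exports.
Local Open Scope classical_set_scope.
Local Open Scope ring_scope.

Fixpoint Ck_on (R : realType) (V W : normedModType R) (k : nat) (U : set V)
    (g : V -> W) : Prop :=
  if k is k'.+1 then
    (forall x, U x -> differentiable g x) /\
    (forall v : V, Ck_on k' U (fun x => 'D_v g x))
  else forall x, U x -> {for x, continuous g}.

(* Meant for open U: the derivatives are those of g on the ambient space. *)
Definition smooth_on (R : realType) (V W : normedModType R) (U : set V)
    (g : V -> W) : Prop := forall k, Ck_on k U g.

(* The Jacobian matrix (d g_l / d q_i)_(l, i). *)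
Definition jac (R : realType) (n m : nat) (g : 'cV[R]_n -> 'cV[R]_m)
    (x : 'cV[R]_n) : 'M[R]_(m, n) :=
  \matrix_(l, i) 'D_(delta_mx i 0) (fun y => g y l 0 : R^o) x.

Definition holder2 (R : realType) (V : normedModType R) (t0 t1 beta : R)
    (X : R -> R -> V) : Prop :=
  exists C : R, forall s t, t0 <= s -> s <= t -> t <= t1 ->
    `|X s t| <= C * (t - s) `^ beta.

(* ZZ s t k j stands for the iterated integral
   \int_s^t (Z_r - Z_s)^k dZ_r^j.  Only the values at t0 <= s <= t <= t1
   matter. *)
Definition geometric_rough_path (R : realType) (K : nat) (alpha t0 t1 : R)
    (Z : R -> 'cV[R]_K) (ZZ : R -> R -> 'M[R]_K) : Prop :=
  [/\ holder2 t0 t1 alpha (fun s t => Z t - Z s),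
      holder2 t0 t1 (2 * alpha) ZZ,
      (forall s u t, t0 <= s -> s <= u -> u <= t -> t <= t1 ->
         ZZ s t = ZZ s u + ZZ u t + (Z u - Z s) *m (Z t - Z u)^T) &
      (forall s t, t0 <= s -> s <= t -> t <= t1 ->
         ZZ s t + (ZZ s t)^T = (Z t - Z s) *m (Z t - Z s)^T)].

(* An L(R^K, V)-valued path is given by its values on the standard basis of
   R^K, i.e. as a family 'I_K -> R -> V.  In particular the Gubinelli
   derivative x' of x : R -> V is a family with
   x t - x s = \sum_k (Z t - Z s)^k x' k s + O(|t - s|^(2 alpha)). *)
Definition controlled (R : realType) (K : nat) (V : normedModType R)
    (alpha t0 t1 : R) (Z : R -> 'cV[R]_K)
    (x : R -> V) (x' : 'I_K -> R -> V) : Prop :=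
  (forall k, holder2 t0 t1 alpha (fun s t => x' k t - x' k s)) /\
  holder2 t0 t1 (2 * alpha)
    (fun s t => x t - x s - \sum_k (Z t - Z s) k 0 *: x' k s).

(* The Gubinelli derivative of phi(x), x having Gubinelli derivative x'. *)
Definition gubinelli_comp (R : realType) (K : nat) (V W : normedModType R)
    (phi : V -> W) (x : R -> V) (x' : 'I_K -> R -> V) : 'I_K -> R -> W :=
  fun k t => 'd phi (x t) (x' k t).

(* I = \int_a^b y dZ for an integrand y with values in L(R^K, V), y' j being
   the Gubinelli derivative of the component y j: I is the limit of the
   compensated Riemann sums as the mesh of the partition a :: s of [a, b]
   tends to 0. *)
Definition is_rough_integral (R : realType) (K : nat) (V : normedModType R)
    (Z : R -> 'cV[R]_K) (ZZ : R -> R -> 'M[R]_K) (a b : R)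
    (y : 'I_K -> R -> V) (y' : 'I_K -> 'I_K -> R -> V) (I : V) : Prop :=
  let local u v : V :=
    \sum_j (Z v - Z u) j 0 *: y j u +
    \sum_k \sum_j ZZ u v k j *: y' j k u in
  forall e : R, 0 < e -> exists2 d : R, 0 < d &
    forall s : seq R, itv_partition a b s ->
      (forall i, (i < size s)%N ->
         nth a (a :: s) i.+1 - nth a (a :: s) i < d) ->
      `|I - \sum_(i < size s)
              local (nth a (a :: s) i) (nth a (a :: s) i.+1)| < e.

Definition vec_integral (R : realType) (n : nat) (a b : R)
    (g : R -> 'cV[R]_n) : 'cV[R]_n :=
  \col_i (\int[lebesgue_measure]_(r in `[a, b]) g r i 0).

Definition sigma_col (R : realType) (N K : nat)
    (sigma : 'cV[R]_N -> 'M[R]_(N, K)) (j : 'I_K) (x : 'cV[R]_N) : 'cV[R]_N :=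
  col j (sigma x).

(* (dg/dq)^* p at the phase space point (q, p). *)
Definition jac_adj (R : realType) (N : nat) (g : 'cV[R]_N -> 'cV[R]_N)
    (x : 'cV[R]_N * 'cV[R]_N) : 'cV[R]_N :=
  (jac g x.1)^T *m x.2.

Definition forward_solution (R : realType) (N K : nat) (alpha t0 t1 : R)
    (Z : R -> 'cV[R]_K) (ZZ : R -> R -> 'M[R]_K)
    (f : 'cV[R]_N -> 'cV[R]_N) (sigma : 'cV[R]_N -> 'M[R]_(N, K))
    (a : 'cV[R]_N) (q : R -> 'cV[R]_N) : Prop :=
  let q' (k : 'I_K) (t : R) := sigma_col sigma k (q t) in
  [/\ q t0 = a,
      controlled alpha t0 t1 Z q q' &
      forall t, t0 <= t -> t <= t1 ->
        exists2 J : 'cV[R]_N,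
          is_rough_integral Z ZZ t0 t
            (fun j r => sigma_col sigma j (q r))
            (fun j => gubinelli_comp (sigma_col sigma j) q q') J &
          q t - q t0 = vec_integral t0 t (fun r => f (q r)) + J].

Definition adjoint_solution (R : realType) (N K : nat) (alpha t0 t1 : R)
    (Z : R -> 'cV[R]_K) (ZZ : R -> R -> 'M[R]_K)
    (f : 'cV[R]_N -> 'cV[R]_N) (sigma : 'cV[R]_N -> 'M[R]_(N, K))
    (a b : 'cV[R]_N) (x : R -> 'cV[R]_N * 'cV[R]_N) : Prop :=
  let q t := (x t).1 in
  let p t := (x t).2 in
  let q' (k : 'I_K) (t : R) := sigma_col sigma k (q t) in
  let p' (k : 'I_K) (t : R) := - jac_adj (sigma_col sigma k) (x t) in
  [/\ forward_solution alpha t0 t1 Z ZZ f sigma a q,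
      p t1 = b,
      controlled alpha t0 t1 Z p p' &
      forall t, t0 <= t -> t <= t1 ->
        exists2 J : 'cV[R]_N,
          is_rough_integral Z ZZ t t1
            (fun j r => jac_adj (sigma_col sigma j) (x r))
            (fun j => gubinelli_comp (jac_adj (sigma_col sigma j)) x
                        (fun k r => (q' k r, p' k r))) J &
          p t1 - p t = - (vec_integral t t1 (fun r => jac_adj f (x r)) + J)].

Definition unique_on (R : realType) (T : Type) (t0 t1 : R)
    (P : (R -> T) -> Prop) (x : R -> T) : Prop :=
  P x /\ forall y, P y -> forall t, t0 <= t -> t <= t1 -> y t = x t.

(* The 1-form \sum_i p_i d q^i, as a function of the base point and of the
   tangent vector; q and p are maps from a normed space V to R^N. *)
Definition pdq (R : realType) (V : normedModType R) (N : nat)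
    (p q : V -> 'cV[R]_N) (x v : V) : R :=
  \sum_i p x i 0 * 'd (fun y => q y i 0 : R^o) x v.

(* Main.v *)
Require Import Defs.
From HB Require Import structures.
From mathcomp Require Import all_boot all_order all_algebra.
From mathcomp Require Import all_classical all_reals all_analysis.
From mathcomp Require Import ring lra.
Set Implicit Arguments.
Unset Strict Implicit.
Unset Printing Implicit Defensive.
Import Order.TTheory GRing.Theory Num.Theory numFieldNormedType.Exports.
Local Open Scope classical_set_scope.
Local Open Scope ring_scope.

(** The adjoint equation is the transpose of the equation obtained by
    differentiating the state equation in its initial datum.  Hence the pairing
    of the adjoint path p with a variation Q_t := d q_t (v) of the state path is
    constant in t, and at either end of the time interval this pairing is the
    form p dq evaluated at v.

    All equations are used through local expansions.  Write theta := 3 alpha,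
    which exceeds 1.  The sewing argument ([sewing_left], [sewing_right], over
    dyadic partitions) turns the rough integrals into
      q_t - q_s = [state_step] s t q_s + O(|t - s|^theta),
      p_t - p_s = [adjoint_step] s t q_s p_s + O(|t - s|^theta)
    ([state_expansion], [adjoint_expansion]), where the steps are the explicit
    second order Taylor polynomials in the increments of time, Z and ZZ.

    Smooth dependence on the data is known at each fixed time only, so the first
    expansion may be differentiated in the data only if its error term has
    difference quotients that are O(|t - s|^theta) uniformly in s and t.  This is
    the Lipschitz stability of rough differential equations
    ([solution_stability]): for two solutions x and y, cutting [s, t] in the
    middle bounds the difference of their remainders by a factor smaller than 1
    times the bound one started from, plus a multiple of the distance of x and y
    ([remainder_split], [step_defect_difference], [local_stability]).  A rough
    bound, which each solution satisfies with its own constant, thereby improves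
    to a bound by the initial distance alone.

    Passing to the limit in the difference quotients gives
      Q_t - Q_s = [variation] s t q_s *m Q_s + O(|t - s|^theta)
    ([linearised_expansion]).  In the increment of p^T Q the terms of order alpha
    cancel by transposition.  The terms in ZZ cancel for two more reasons:
    second derivatives of sigma commute ([jac_jac_mul]), and what is left over,
    the products of first derivatives, equals the product of the two first order
    terms because the rough path is geometric ([iterated_sym]).  The increments
    of p^T Q are thus O(|t - s|^theta) with theta > 1, so p^T Q is constant
    ([pairing_const]). *)

(** * Uniform constants and matrix norms *)

(** Constants obtained one component at a time combine into one, because all
    estimates below are monotone in their constant. *)
Lemma uniform_bound (R : realType) (I : finType) (P : I -> R -> Prop) :
  (forall i c d, c <= d -> P i c -> P i d) ->
  (forall i, exists c, P i c) -> exists2 c, 0 <= c & forall i, P i c.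
Proof.
move=> mono /choice[c Pc]; exists (\sum_i `|c i|); first exact: sumr_ge0.
move=> i; apply: mono (Pc i); rewrite (bigD1 i)//=.
by rewrite (le_trans (ler_norm _))// lerDl sumr_ge0.
Qed.

Lemma entry_le_norm (R : realType) m n (A : 'M[R]_(m, n)) i j :
  `|A i j| <= `|A|.
Proof.
rewrite [leRHS]/Num.Def.normr/= mx_normrE.
by apply: le_trans (le_bigmax _ _ (i, j)).
Qed.

Lemma norm_le_entries (R : realType) m n (A : 'M[R]_(m, n)) c :
  0 <= c -> (forall i j, `|A i j| <= c) -> `|A| <= c.
Proof.
move=> c0 Ac; rewrite [leLHS]/Num.Def.normr/= mx_normrE.
by rewrite bigmax_le// => -[i j] _; exact: Ac.
Qed.

Lemma norm_col_le (R : realType) n (v : 'cV[R]_n) c :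
  0 <= c -> (forall i, `|v i 0| <= c) -> `|v| <= c.
Proof. by move=> c0 H; apply: norm_le_entries => // i j; rewrite ord1. Qed.

Lemma norm_mulmx (R : realType) m n p (A : 'M[R]_(m, n)) (B : 'M[R]_(n, p)) :
  `|A *m B| <= n%:R * `|A| * `|B|.
Proof.
apply: norm_le_entries => [|i j]; first by rewrite !mulr_ge0.
rewrite mxE (le_trans (ler_norm_sum _ _ _))//.
rewrite (@le_trans _ _ (\sum_(k < n) `|A| * `|B|))//.
  by apply: ler_sum => k _; rewrite normrM ler_pM// entry_le_norm.
by rewrite sumr_const card_ord -mulrA mulr_natl.
Qed.

Lemma norm_sum_le (R : realType) (W : normedModType R) m (F : 'I_m -> W) C :
  (forall i, `|F i| <= C) -> `|\sum_i F i| <= m%:R * C.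
Proof.
move=> FC; rewrite (le_trans (ler_norm_sum _ _ _))//.
rewrite (@le_trans _ _ (\sum_(i < m) C))//; first exact: ler_sum.
by rewrite sumr_const card_ord mulr_natl.
Qed.

Lemma cball_compact (R : realType) n (r : R) :
  compact [set x : 'cV[R]_n | `|x| <= r].
Proof.
have -> : [set x : 'cV[R]_n | `|x| <= r] =
          trmx @` [set x : 'rV[R]_n | `|x| <= r].
  have nT p q (A : 'M[R]_(p, q)) : `|A^T| <= `|A|.
    by apply: norm_le_entries => // k l; rewrite mxE entry_le_norm.
  apply/seteqP; split=> [x /= xr|_ [x /= xr <-]]; last exact: le_trans xr.
  by exists x^T; rewrite ?trmxK//; exact: le_trans xr.
apply: continuous_compact.
  apply: continuous_subspaceT => x.
  refine ((cvgrPdist_le (F := nbhs x) _ _).2 _) => e e0.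
  have := nbhsx_ballx x e e0; rewrite -ball_normE /= /ball_ /= => near_x.
  move: near_x; apply: filterS => y /= /ltW xye; apply: norm_le_entries => [|i j]; first exact: ltW.
  by rewrite !mxE; apply: le_trans xye; have := entry_le_norm (x - y) j i; rewrite !mxE.
apply: bounded_closed_compact.
  by exists r; split; [exact: num_real|move=> M rM x /= /le_trans; apply; exact: ltW].
have -> : [set x : 'rV[R]_n | `|x| <= r] = Num.norm @^-1` [set y | y <= r] by [].
by apply: closed_comp (@closed_le _ r) => x _; exact: norm_continuous.
Qed.

(** * Algebra of smooth functions *)

Definition smoothr (R : realType) (V : normedModType R) (g : V -> R) : Prop :=
  smooth_on setT (g : V -> R^o).

Section Smooth.
Context (R : realType) (V : normedModType R).
Implicit Types g h : V -> R.

Let Ck (k : nat) (g : V -> R) := Ck_on k setT (g : V -> R^o).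

Lemma Ck_le k l g : (l <= k)%N -> Ck k g -> Ck l g.
Proof.
elim: k l g => [[]//|k IH [|l] g lk [dg Dg]].
  by move=> x _; exact/differentiable_continuous/dg.
by split=> // v; exact: IH (Dg v).
Qed.

Lemma Ck_cst k (c : R) : Ck k (cst c).
Proof.
elim: k c => [c x _|k IH c]; first exact: cvg_cst.
split=> [x _|v]; first exact: differentiable_cst.
rewrite (_ : (fun x => _) = cst 0); first exact: IH.
by apply/funext => x; rewrite derive_cst.
Qed.

Lemma CkD k g h : Ck k g -> Ck k h -> Ck k (fun x => g x + h x).
Proof.
elim: k g h => [g h cg ch x _|k IH g h [dg Dg] [dh Dh]].
  by apply: cvgD; [exact: cg|exact: ch].
split=> [x _|v]; first by apply: differentiableD; [exact: dg|exact: dh].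
rewrite (_ : (fun x => _) = fun x => 'D_v (g : V -> R^o) x + 'D_v (h : V -> R^o) x).
  by apply: IH; [exact: Dg|exact: Dh].
by apply/funext => x; rewrite deriveD//; apply: diff_derivable; [exact: dg|exact: dh].
Qed.

Lemma CkM k g h : Ck k g -> Ck k h -> Ck k (fun x => g x * h x).
Proof.
elim: k g h => [g h cg ch x _|k IH g h [dg Dg] [dh Dh]].
  by apply: cvgM; [exact: cg|exact: ch].
split=> [x _|v]; first by apply: differentiableM; [exact: dg|exact: dh].
rewrite (_ : (fun x => _) = fun x => g x * 'D_v (h : V -> R^o) x + h x * 'D_v (g : V -> R^o) x).
  by apply: CkD; apply: IH; try exact: Dg; try exact: Dh; apply: (@Ck_le k.+1) => //; split.
by apply/funext => x; rewrite deriveM//; apply: diff_derivable; [exact: dg|exact: dh].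
Qed.

Lemma smooth_cst (c : R) : smoothr (fun _ : V => c).
Proof. by move=> k; exact: Ck_cst. Qed.

Lemma smoothD g h : smoothr g -> smoothr h -> smoothr (fun x => g x + h x).
Proof. by move=> sg sh k; apply: CkD; [exact: sg|exact: sh]. Qed.

Lemma smoothM g h : smoothr g -> smoothr h -> smoothr (fun x => g x * h x).
Proof. by move=> sg sh k; apply: CkM; [exact: sg|exact: sh]. Qed.

Lemma smooth_sum (I : Type) (r : seq I) (g : I -> V -> R) :
  (forall i, smoothr (g i)) -> smoothr (fun x => \sum_(i <- r) g i x).
Proof.
move=> sg; elim: r => [|i r IH].
  by rewrite (_ : (fun x => _) = fun=> 0); [exact: smooth_cst|apply/funext => x; rewrite big_nil].
rewrite (_ : (fun x => _) = fun x => g i x + \sum_(j <- r) g j x); first exact: smoothD.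
by apply/funext => x; rewrite big_cons.
Qed.

Lemma smooth_derive g v : smoothr g -> smoothr (fun x => 'D_v (g : V -> R^o) x).
Proof. by move=> sg k; have [_ Dg] := sg k.+1; exact: Dg. Qed.

Lemma smooth_diff g x : smoothr g -> differentiable (g : V -> R^o) x.
Proof. by move=> sg; have [dg _] := sg 1%N; exact: dg. Qed.

End Smooth.

Lemma Ck_on_entry (R : realType) (V : normedModType R) m p k (g : V -> 'M[R]_(m, p)) i j :
  Ck_on k setT g -> Ck_on k setT (fun x => g x i j : R^o).
Proof.
elim: k g => [g cg x _|k IH g [dg Dg]].
  apply: (@continuous_comp _ _ _ g (fun A : 'M[R]_(m, p) => A i j : R^o)); first exact: cg.
  exact: differentiable_continuous (differentiable_coord _ _ _).
split=> [x _|v].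
  by apply: (@differentiable_comp _ _ _ _ g (fun A : 'M[R]_(m, p) => A i j : R^o)); [exact: dg|exact: differentiable_coord].
rewrite (_ : (fun x => _) = fun x => 'D_v g x i j); first exact: (IH _ (Dg v)).
apply/funext => x; rewrite derive_mx ?mxE//.
by apply: diff_derivable; exact: dg.
Qed.

Lemma smooth_entry (R : realType) (V : normedModType R) m p (g : V -> 'M[R]_(m, p)) i j :
  smooth_on setT g -> smoothr (fun x => g x i j).
Proof. by move=> sg k; exact/Ck_on_entry/sg. Qed.

(** * Mean value estimates on balls and symmetry of second derivatives *)

Section MeanValue.
Context (R : realType) (n : nat).
Implicit Types (g : 'cV[R]_n -> R) (a b c d v w : 'cV[R]_n).

Definition partial g (i : 'I_n) (x : 'cV[R]_n) : R :=
  'D_(delta_mx i 0) (g : _ -> R^o) x.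

Lemma smooth_partial g i : smoothr g -> smoothr (partial g i).
Proof. exact: smooth_derive. Qed.

Lemma derive_partial g v x : smoothr g ->
  'D_v (g : _ -> R^o) x = \sum_i v i 0 * partial g i x.
Proof.
move=> sg; have dg := smooth_diff x sg.
rewrite deriveE// {1}(matrix_sum_delta v) linear_sum; apply: eq_bigr => i _.
by rewrite big_ord1 linearZ /partial deriveE.
Qed.

Lemma smooth_bounded g r : smoothr g ->
  exists2 C, 0 <= C & forall x, `|x| <= r -> `|g x| <= C.
Proof.
move=> sg.
have cg : {within [set x | `|x| <= r], continuous (g : _ -> R^o)}.
  apply: continuous_subspaceT => x.
  exact/differentiable_continuous/smooth_diff.
have := continuous_compact cg (@cball_compact R n r).
move=> /compact_bounded[M [_ /(_ (Num.max 0 M + 1)) HM]].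
exists (Num.max 0 M + 1); first by rewrite addr_ge0// le_max lexx.
move=> x xr; apply: HM; last by exists x.
by rewrite ltr_pwDr// le_max lexx orbT.
Qed.

Lemma partial_bounded g r : smoothr g ->
  exists2 C, 0 <= C & forall i x, `|x| <= r -> `|partial g i x| <= C.
Proof.
move=> sg; apply: uniform_bound => [i C D CD H x /H/le_trans|i]; first exact.
by have [C _ HC] := smooth_bounded r (smooth_partial i sg); exists C.
Qed.

Lemma is_derive_line g b w (t : R) : smoothr g ->
  is_derive t 1 (fun u : R => g (b + u *: w) : R^o) ('D_w (g : _ -> R^o) (b + t *: w)).
Proof.
move=> sg.
have dl : is_diff t (fun u : R^o => b + u *: w) ( *:%R^~ w).
  have := is_diffD (is_diff_cst b t) (is_diff_scalel t w).
  by rewrite add0r.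
have dg := smooth_diff (b + t *: w) sg.
have dgl : differentiable ((g : _ -> R^o) \o (fun u : R^o => b + u *: w)) t.
  by apply: differentiable_comp.
apply: DeriveDef; first exact: diff_derivable.
rewrite (@deriveE _ _ _ ((g : _ -> R^o) \o (fun u : R^o => b + u *: w)))//.
by rewrite diff_comp//= (@diff_val _ _ _ _ _ _ _ dl) scale1r deriveE.
Qed.

(** One intermediate point serves both increments, because the mean value theorem
    is applied to their difference as a function of one variable. *)
Lemma mean_value2 g a b c d : smoothr g ->
  exists2 t : R, 0 <= t <= 1 & (g a - g b) - (g c - g d) =
    'D_(a - b) (g : _ -> R^o) (b + t *: (a - b)) -
    'D_(c - d) (g : _ -> R^o) (d + t *: (c - d)).
Proof.
move=> sg.
have dd (t : R) : is_derive t 1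
    ((fun u : R => g (b + u *: (a - b)) : R^o) - (fun u : R => g (d + u *: (c - d)) : R^o))
    ('D_(a - b) (g : _ -> R^o) (b + t *: (a - b)) -
    'D_(c - d) (g : _ -> R^o) (d + t *: (c - d))).
  by apply: is_deriveB; exact: is_derive_line.
have [|t t01] := @MVT_segment R _ _ 0 1 ler01 (fun t _ => dd t).
  apply: derivable_within_continuous => t _; by case: (dd t).
rewrite subr0 mulr1 !fctE !scale1r !scale0r !addr0 => H.
exists t; first by move: t01; rewrite in_itv.
by rewrite -H !subrKC; ring.
Qed.

Lemma segment_ball a b r (t : R) : 0 <= t <= 1 -> `|a| <= r -> `|b| <= r ->
  `|b + t *: (a - b)| <= r.
Proof.
move=> /andP[t0 t1] ar br.
have -> : b + t *: (a - b) = (1 - t) *: b + t *: a.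
  by rewrite scalerBr scalerBl scale1r addrA addrAC.
rewrite (le_trans (ler_normD _ _))// !normrZ (ger0_norm t0) ger0_norm ?subr_ge0//.
by nra.
Qed.

Lemma smooth_lipschitz g r : smoothr g -> exists2 C, 0 <= C &
  forall a b, `|a| <= r -> `|b| <= r -> `|g a - g b| <= C * `|a - b|.
Proof.
move=> sg; have [C C0 HC] := partial_bounded r sg.
exists (n%:R * C) => [|a b ar br]; first by rewrite mulr_ge0.
have [t t01] := mean_value2 a b b b sg.
rewrite !subrr derive0 !subr0 => ->.
rewrite derive_partial// -mulrA; apply: norm_sum_le => i.
by rewrite normrM mulrC ler_pM// ?entry_le_norm// HC// segment_ball.
Qed.

(** Four point estimate: the segments from b to a and from d to c are compared
    through one mean value point, so that the bound is linear in their
    difference and involves the length of the first segment only.  The second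
    segment will belong to a path whose own bounds are not under control. *)
Lemma smooth_lipschitz2 g r : smoothr g -> exists2 C, 0 <= C &
  forall a b c d, `|a| <= r -> `|b| <= r -> `|c| <= r -> `|d| <= r ->
  `|(g a - g b) - (g c - g d)| <=
    C * (`|(a - b) - (c - d)| + `|b - d| * `|a - b|).
Proof.
move=> sg; have [C1 C10 HC1] := partial_bounded r sg.
have [C2 C20 HC2] : exists2 C, 0 <= C & forall i a b, `|a| <= r -> `|b| <= r ->
    `|partial g i a - partial g i b| <= C * `|a - b|.
  apply: uniform_bound => [i C D CD H a b ar br|i].
    by apply: le_trans (H _ _ ar br) _; rewrite ler_wpM2r.
  by have [C _ HC] := smooth_lipschitz r (smooth_partial i sg); exists C.
have [r0|r0] := ltP r 0.
  by exists 0 => // a b c d /(le_trans (normr_ge0 a)); rewrite leNgt r0.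
exists (n%:R * (C1 + C2 * (1 + 2 * r))) => [|a b c d ar br cr dr].
  by rewrite mulr_ge0// addr_ge0// mulr_ge0// addr_ge0// mulr_ge0.
have [t t01 ->] := mean_value2 a b c d sg.
rewrite !derive_partial// -sumrB -mulrA; apply: norm_sum_le => i.
set bt := b + _; set dt := d + _.
have -> : (a - b) i 0 * partial g i bt - (c - d) i 0 * partial g i dt =
    ((a - b) - (c - d)) i 0 * partial g i dt +
    (a - b) i 0 * (partial g i bt - partial g i dt).
  by rewrite [((a - b) - _) i 0]mxE [(- (c - d)) i 0]mxE; ring.
have dtr : `|dt| <= r by exact: segment_ball.
have btr : `|bt| <= r by exact: segment_ball.
have bdt : `|bt - dt| <= `|b - d| + `|(a - b) - (c - d)|.
  have -> : bt - dt = (b - d) + t *: ((a - b) - (c - d)).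
    by rewrite /bt /dt opprD addrACA -scalerBr.
  rewrite (le_trans (ler_normD _ _))// lerD2l normrZ ger0_norm; last by case/andP: t01.
  by rewrite ler_piMl//; case/andP: t01.
have ab2 : `|a - b| <= 2 * r.
  by rewrite (le_trans (ler_normB _ _))// mulr2n mulrDl mul1r lerD.
have H1 := HC1 i dt dtr; have H2 := HC2 i bt dt btr dtr.
have e1 := entry_le_norm ((a - b) - (c - d)) i 0.
have e2 := entry_le_norm (a - b) i 0.
rewrite (le_trans (ler_normD _ _))// !normrM.
apply: (@le_trans _ _ (`|a - b - (c - d)| * C1 +
    `|a - b| * (C2 * (`|b - d| + `|a - b - (c - d)|)))).
  apply: lerD; apply: ler_pM => //.
  by apply: le_trans H2 _; rewrite ler_wpM2l.
move: ab2 (normr_ge0 (a - b)) (normr_ge0 (b - d)) (normr_ge0 (a - b - (c - d))).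
move: (`|a - b|) (`|b - d|) (`|a - b - (c - d)|) => D E F; clear -r0 C10 C20; move=> DE D0 E0 F0.
have h1 : 0 <= C2 * F * (2 * r - D) by rewrite !mulr_ge0// subr_ge0.
have h2 : 0 <= C1 * (E * D) by rewrite !mulr_ge0.
have h3 : 0 <= C2 * F by rewrite !mulr_ge0.
have h4 : 0 <= C2 * r * (E * D) by rewrite !mulr_ge0.
nra.
Qed.

Definition taylor1 g b a := g a - g b - 'D_(a - b) (g : _ -> R^o) b.

(** The same argument one order higher; it gives the second order Taylor bound
    (take c = d = b) and the symmetry of second derivatives as well. *)
Lemma smooth_taylor g r : smoothr g -> exists2 C, 0 <= C &
  forall a b c d, `|a| <= r -> `|b| <= r -> `|c| <= r -> `|d| <= r ->
  `|taylor1 g b a - taylor1 g d c| <=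
    C * (`|b - d| * `|a - b| ^+ 2 + `|(a - b) - (c - d)| * (`|a - b| + `|c - d|)).
Proof.
move=> sg.
have [C1 C10 HC1] : exists2 C, 0 <= C & forall i a b, `|a| <= r -> `|b| <= r ->
    `|partial g i a - partial g i b| <= C * `|a - b|.
  apply: uniform_bound => [i C D CD H a b ar br|i].
    by apply: le_trans (H _ _ ar br) _; rewrite ler_wpM2r.
  by have [C _ HC] := smooth_lipschitz r (smooth_partial i sg); exists C.
have [C2 C20 HC2] : exists2 C, 0 <= C & forall i a b c d, `|a| <= r -> `|b| <= r ->
    `|c| <= r -> `|d| <= r ->
    `|(partial g i a - partial g i b) - (partial g i c - partial g i d)| <=
    C * (`|(a - b) - (c - d)| + `|b - d| * `|a - b|).
  apply: uniform_bound => [i C D CD H a b c d ar br cr dr|i].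
    by apply: le_trans (H _ _ _ _ ar br cr dr) _; rewrite ler_wpM2r// addr_ge0// mulr_ge0.
  by have [C _ HC] := smooth_lipschitz2 r (smooth_partial i sg); exists C.
exists (n%:R * (C1 + C2)) => [|a b c d ar br cr dr].
  by rewrite mulr_ge0// addr_ge0.
have [t t01] := mean_value2 a b c d sg.
have -> : taylor1 g b a - taylor1 g d c = ((g a - g b) - (g c - g d)) -
   ('D_(a - b) (g : _ -> R^o) b - 'D_(c - d) (g : _ -> R^o) d).
  by rewrite /taylor1; ring.
move=> ->.
rewrite !derive_partial// -!sumrB -mulrA; apply: norm_sum_le => i.
set bt := b + _; set dt := d + _.
have dtr : `|dt| <= r by exact: segment_ball.
have btr : `|bt| <= r by exact: segment_ball.
have -> : (a - b) i 0 * partial g i bt - (c - d) i 0 * partial g i dt -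
    ((a - b) i 0 * partial g i b - (c - d) i 0 * partial g i d) =
    (a - b) i 0 * ((partial g i bt - partial g i b) - (partial g i dt - partial g i d)) +
    ((a - b) - (c - d)) i 0 * (partial g i dt - partial g i d).
  by rewrite [((a - b) - _) i 0]mxE [(- (c - d)) i 0]mxE; ring.
have tle (w : 'cV[R]_n) : `|t *: w| <= `|w|.
  case/andP: t01 => t0 t1; rewrite normrZ ger0_norm//.
  by rewrite ler_piMl//; case/andP: t01.
have btb : bt - b = t *: (a - b) by rewrite /bt addrC addKr.
have dtd : dt - d = t *: (c - d) by rewrite /dt addrC addKr.
have H1 : `|partial g i dt - partial g i d| <= C1 * `|c - d|.
  by apply: le_trans (HC1 _ _ _ dtr dr) _; rewrite ler_wpM2l// dtd.
have H2 : `|(partial g i bt - partial g i b) - (partial g i dt - partial g i d)| <=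
    C2 * (`|(a - b) - (c - d)| + `|b - d| * `|a - b|).
  apply: le_trans (HC2 _ _ _ _ _ btr br dtr dr) _; rewrite ler_wpM2l//.
  by rewrite btb dtd -scalerBr lerD// ler_wpM2l.
have e1 := entry_le_norm ((a - b) - (c - d)) i 0.
have e2 := entry_le_norm (a - b) i 0.
rewrite (le_trans (ler_normD _ _))// !normrM.
apply: (@le_trans _ _ (`|a - b| * (C2 * (`|(a - b) - (c - d)| + `|b - d| * `|a - b|)) +
    `|a - b - (c - d)| * (C1 * `|c - d|))).
  by apply: lerD; apply: ler_pM.
move: (normr_ge0 (c - d)) (normr_ge0 (a - b)) (normr_ge0 (b - d)) (normr_ge0 (a - b - (c - d))).
move: (`|c - d|) (`|a - b|) (`|b - d|) (`|a - b - (c - d)|) => D E F G; clear -C10 C20; move=> D0 E0 F0 G0.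
have h1 : 0 <= C1 * (F * E ^+ 2) by rewrite !mulr_ge0// sqr_ge0.
have h2 : 0 <= C1 * (G * E) by rewrite !mulr_ge0.
have h3 : 0 <= C2 * (G * D) by rewrite !mulr_ge0.
nra.
Qed.

(** A bound on difference quotients at positive increments, the form in which
    stability estimates come, passes to the derivative. *)
Lemma derive_le (V W : normedModType R) (g : V -> W) (x v : V) B e :
  derivable g x v -> 0 < e ->
  (forall h, 0 < h < e -> `|g (x + h *: v) - g x| <= B * h) -> `|'D_v g x| <= B.
Proof.
move=> dg e0 gB; rewrite leNgt; apply/negP => Bd.
have {}dg : h^-1 *: (g (h *: v + x) - g x) @[h --> 0^'] --> 'D_v g x by [].
have d0 : 0 < `|'D_v g x| - B by rewrite subr_gt0.
move/cvgrPdist_lt : dg => /(_ _ d0)[d /= dpos].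
pose h := Num.min d e / 2.
have m0 : 0 < Num.min d e by rewrite lt_min dpos.
have h0 : 0 < h by rewrite divr_gt0.
have hm : h < Num.min d e by rewrite /h ltr_pdivrMr// ltr_pMr// ltr1n.
move: (hm); rewrite lt_min => /andP[hd he].
move=> /(_ h); rewrite /ball_/= sub0r normrN gtr0_norm// gt_eqF// => /(_ hd isT) H.
have hB : `|h^-1 *: (g (h *: v + x) - g x)| <= B.
  rewrite normrZ gtr0_norm ?invr_gt0// mulrC ler_pdivrMr// [h *: v + x]addrC.
  by apply: gB; rewrite h0.
have := lerB_dist ('D_v g x) (h^-1 *: (g (h *: v + x) - g x)).
by move: H hB; lra.
Qed.

(** The mixed second difference of g over the parallelogram spanned by h u and
    h v is symmetric in u and v.  By the Taylor bound it agrees up to O(h^3) with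
    h times the increment of 'D_v g along h u, and likewise with u and v
    exchanged; hence the two increments differ by O(h^2). *)
Lemma smooth_derive_sym g u v x : smoothr g ->
  'D_u (fun y => 'D_v (g : _ -> R^o) y : R^o) x = 'D_v (fun y => 'D_u (g : _ -> R^o) y : R^o) x.
Proof.
move=> sg; pose r := `|x| + `|u| + `|v|.
have [C C0 HC] := smooth_taylor r sg.
have key (w z : 'cV[R]_n) (h : R) : `|x| + `|w| + `|z| <= r -> 0 < h < 1 ->
    `|(g (x + h *: w + h *: z) - g (x + h *: w) - (g (x + h *: z) - g x)) -
      h * ('D_z (g : _ -> R^o) (x + h *: w) - 'D_z (g : _ -> R^o) x)| <=
    C * h ^+ 3 * (`|w| * `|z| ^+ 2).
  move=> wzr /andP[h0 h1].
  have hle (y : 'cV[R]_n) : `|h *: y| <= `|y|.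
    by rewrite normrZ gtr0_norm// ler_piMl// ltW.
  have xr : `|x| <= r by rewrite /r -addrA lerDl addr_ge0.
  have r1 : `|x + h *: w| <= r.
    rewrite (le_trans (ler_normD _ _))//; have := hle w; have := normr_ge0 z; lra.
  have r2 : `|x + h *: z| <= r.
    rewrite (le_trans (ler_normD _ _))//; have := hle z; have := normr_ge0 w; lra.
  have r3 : `|x + h *: w + h *: z| <= r.
    rewrite (le_trans (ler_normD _ _))// (le_trans _ wzr)// lerD//.
    by rewrite (le_trans (ler_normD _ _))// lerD2l.
  have := HC _ _ _ _ r3 r1 r2 xr.
  have s1 y : y + h *: z - y = h *: z by rewrite addrC addKr.
  have s2 : x + h *: w - x = h *: w by rewrite addrC addKr.
  rewrite /taylor1 !s1 s2 subrr normr0 mul0r addr0.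
  have Dh y : 'D_(h *: z) (g : _ -> R^o) y = h * 'D_z (g : _ -> R^o) y.
    by rewrite !derive_partial// mulr_sumr; apply: eq_bigr => i _; rewrite mxE mulrA.
  rewrite !Dh !normrZ gtr0_norm// => H.
  rewrite [X in `|X|](_ : _ = g (x + h *: w + h *: z) - g (x + h *: w) -
     h * 'D_z (g : _ -> R^o) (x + h *: w) - (g (x + h *: z) - g x - h * 'D_z (g : _ -> R^o) x)); last by ring.
  by apply: le_trans H _; rewrite le_eqVlt; apply/orP; left; apply/eqP; ring.
pose phi (h : R) : R^o := 'D_v (g : _ -> R^o) (x + h *: u) - 'D_u (g : _ -> R^o) (x + h *: v).
have dphi : is_derive (0 : R) 1 phi
   ('D_u (fun y => 'D_v (g : _ -> R^o) y : R^o) x - 'D_v (fun y => 'D_u (g : _ -> R^o) y : R^o) x).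
  have := is_deriveB (is_derive_line x u 0 (smooth_derive v sg))
                     (is_derive_line x v 0 (smooth_derive u sg)).
  by rewrite !scale0r !addr0.
apply/eqP; rewrite -subr_eq0 -normr_le0; apply/ler_addgt0Pr => e e0; rewrite add0r.
pose K := C * (`|u| * `|v| ^+ 2 + `|v| * `|u| ^+ 2) + 1.
have K0 : 0 < K by rewrite ltr_wpDl// mulr_ge0// addr_ge0// mulr_ge0// sqr_ge0.
rewrite -(@derive_val _ _ _ _ _ _ _ dphi).
apply: (@derive_le _ _ phi 0 1 e (Num.min 1 (e / K))).
- by case: dphi.
- by rewrite lt_min ltr01 divr_gt0.
move=> h /andP[h0]; rewrite lt_min => /andP[h1 he].
rewrite add0r [h *: 1]mulr1 /phi !scale0r !addr0.
have k1 := key u v h (lexx _) (introT andP (conj h0 h1)).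
have k2 : `|x| + `|v| + `|u| <= r by rewrite addrAC.
have {k2} := key v u h k2 (introT andP (conj h0 h1)).
rewrite [x + h *: v + _]addrAC => k2.
rewrite -(@ler_pM2l _ h)// -[h in h * `|_|]gtr0_norm// -normrM.
set L := (X in `|X| <= _); have -> : L =
   ((g (x + h *: u + h *: v) - g (x + h *: v) - (g (x + h *: u) - g x)) -
      h * ('D_u (g : _ -> R^o) (x + h *: v) - 'D_u (g : _ -> R^o) x)) -
    ((g (x + h *: u + h *: v) - g (x + h *: u) - (g (x + h *: v) - g x)) -
      h * ('D_v (g : _ -> R^o) (x + h *: u) - 'D_v (g : _ -> R^o) x)).
  by rewrite /L; ring.
rewrite (le_trans (ler_normB _ _))// (le_trans (lerD k2 k1))//.
apply: (@le_trans _ _ (h ^+ 2 * (h * K))).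
  rewrite /K; set X := `|u| * _; set Y := `|v| * _.
  have : 0 <= h ^+ 3 by rewrite exprn_ge0// ltW.
  nra.
rewrite [leRHS](_ : _ = h ^+ 2 * e); last by ring.
by rewrite ler_wpM2l ?sqr_ge0// -ler_pdivlMr// ltW.
Qed.
End MeanValue.

(** * Sewing along dyadic partitions *)

Section Sewing.
Context (R : realType) (W : normedModType R).
Implicit Types (Xi : R -> R -> W) (a b s t u : R) (p : seq R).

(** The factor gained on a bound of order th when an interval is cut in two
    halves; it is smaller than 1 exactly because th > 1. *)
Definition halving (th : R) : R := 2 * 2^-1 `^ th.

Lemma halving_ge0 th : 0 <= halving th.
Proof. by rewrite mulr_ge0// powR_ge0. Qed.

Lemma halving_lt1 th : 1 < th -> halving th < 1.
Proof.
move=> th1; rewrite /halving mulrC -ltr_pdivlMr// mul1r.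
rewrite /powR gt_eqF ?invr_gt0// -[ltRHS]lnK ?posrE ?invr_gt0// ltr_expR.
rewrite lnV ?posrE// mulrN ltrN2 ltr_pMl// ln_gt0// ltr1n//.
Qed.

Lemma midpoint_powR th s t : s <= t ->
  ((s + t) / 2 - s) `^ th + (t - (s + t) / 2) `^ th = halving th * (t - s) `^ th.
Proof.
move=> st; have -> : (s + t) / 2 - s = 2^-1 * (t - s) by field.
have -> : t - (s + t) / 2 = 2^-1 * (t - s) by field.
by rewrite powRM ?subr_ge0// ?invr_ge0// /halving; ring.
Qed.

(** A property of bounds that is stable under an affine contraction holds,
    whatever bound it started from, arbitrarily close to the fixed point. *)
Lemma affine_iteration (P : R -> Prop) (r d w : R) : 0 <= r < 1 -> 0 <= d ->
  (forall x y, x <= y -> P x -> P y) ->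
  (forall x, 0 <= x -> P x -> P (d + r * x)) -> 0 <= w -> P w ->
  forall e, 0 < e -> P (d / (1 - r) + e).
Proof.
move=> /andP[r0 r1] d0 Pup Pit w0 Pw e e0.
have r1' : 0 < 1 - r by rewrite subr_gt0.
have H n : P (d / (1 - r) + r ^+ n * w).
  elim: n => [|n /Pit]; first by apply: Pup Pw; rewrite expr0 mul1r lerDr divr_ge0// ltW.
  rewrite addr_ge0 ?mulr_ge0 ?invr_ge0 ?exprn_ge0//; last exact: ltW.
  move=> /(_ isT); congr P; rewrite exprS; field.
  by rewrite gt_eqF.
have /cvgrPdist_lt : r ^+ n @[n --> \oo] --> (0 : R) by apply: cvg_expr; rewrite ger0_norm.
have ew : 0 < e / (w + 1) by rewrite divr_gt0// ltr_wpDl.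
move=> /(_ _ ew)[n _ /(_ n (leqnn n))]; rewrite sub0r normrN ger0_norm ?exprn_ge0//.
rewrite ltr_pdivlMr ?ltr_wpDl// => rn; apply: Pup (H n); rewrite lerD2l.
have := exprn_ge0 n r0; nra.
Qed.

Definition near_additive (a b th C : R) Xi : Prop :=
  forall s u t, a <= s -> s <= u -> u <= t -> t <= b ->
    `|Xi s t - Xi s u - Xi u t| <= C * (t - s) `^ th.

Fixpoint chain_sum Xi a p : W :=
  if p is x :: p' then Xi a x + chain_sum Xi x p' else 0.

Lemma chain_sumE Xi a p :
  \sum_(i < size p) Xi (nth a (a :: p) i) (nth a (a :: p) i.+1) = chain_sum Xi a p.
Proof.
suff H d : \sum_(i < size p) Xi (nth d (a :: p) i) (nth d (a :: p) i.+1) = chain_sum Xi a p by [].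
elim: p a => [|x p IH] a; first by rewrite big_ord0.
by rewrite big_ord_recl /= -IH; congr (_ + _); apply: eq_bigr.
Qed.

Lemma chain_sum_cat Xi a p q :
  chain_sum Xi a (p ++ q) = chain_sum Xi a p + chain_sum Xi (last a p) q.
Proof. by elim: p a => [|x p IH] a /=; rewrite ?add0r// IH addrA. Qed.

Fixpoint dyadic n s t : seq R :=
  if n is n'.+1 then dyadic n' s ((s + t) / 2) ++ dyadic n' ((s + t) / 2) t
  else [:: t].

Lemma last_dyadic n x s t : last x (dyadic n s t) = t.
Proof. by elim: n x s t => [//|n IH] x s t; rewrite /= last_cat IH. Qed.

Lemma path_dyadic (e : rel R) n s t :
  (forall u v, v - u = (t - s) / 2 ^+ n -> e u v) -> path e s (dyadic n s t).
Proof.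
elim: n s t => [|n IH] s t H /=; first by rewrite H// expr0 divr1.
rewrite cat_path last_dyadic; apply/andP; split; apply: IH => u v uv; apply: H;
  by rewrite uv exprS; field; rewrite expf_neq0.
Qed.

(** The constant is the fixed point of C' = C + halving th * C', the relation
    between the errors at two successive dyadic levels. *)
Lemma sewing_dyadic a b th C Xi n s t : 1 < th -> 0 <= C ->
  near_additive a b th C Xi -> a <= s -> s <= t -> t <= b ->
  `|Xi s t - chain_sum Xi s (dyadic n s t)| <= C / (1 - halving th) * (t - s) `^ th.
Proof.
move=> th1 C0 add; have r1 := halving_lt1 th1; have r0 := halving_ge0 th.
have K0 : 0 <= C / (1 - halving th) by rewrite divr_ge0// subr_ge0 ltW.
elim: n s t => [|n IH] s t as_ st tb /=.
  by rewrite addr0 subrr normr0 mulr_ge0// powR_ge0.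
set m := (s + t) / 2.
have sm : s <= m by rewrite /m; lra.
have mt : m <= t by rewrite /m; lra.
rewrite chain_sum_cat last_dyadic.
have h1 := IH s m as_ sm (le_trans mt tb).
have h2 := IH m t (le_trans as_ sm) mt tb.
have h3 := add s m t as_ sm mt tb.
have -> : Xi s t - (chain_sum Xi s (dyadic n s m) + chain_sum Xi m (dyadic n m t)) =
  (Xi s t - Xi s m - Xi m t) + ((Xi s m - chain_sum Xi s (dyadic n s m)) +
    (Xi m t - chain_sum Xi m (dyadic n m t))).
  by rewrite -[Xi s t - _ - _]addrA -opprD [X in _ = _ + X]addrACA -opprD subrKA.
rewrite (le_trans (ler_normD _ _))// (le_trans (lerD h3 (le_trans (ler_normD _ _) (lerD h1 h2))))//.
rewrite -mulrDr midpoint_powR// le_eqVlt; apply/orP; left; apply/eqP; field.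
by rewrite subr_eq0 gt_eqF.
Qed.

(** One family of partitions serves two purposes: it witnesses the limit of
    Riemann sums, and its sums stay close to the one-interval value. *)
Lemma fine_partition a b th C Xi s t d : 1 < th -> 0 <= C ->
  near_additive a b th C Xi -> a <= s -> s <= t -> t <= b -> 0 < d ->
  exists p, [/\ itv_partition s t p, path (fun u v => v - u < d) s p &
    `|Xi s t - chain_sum Xi s p| <= C / (1 - halving th) * (t - s) `^ th].
Proof.
move=> th1 C0 add as_ st tb d0; move: st; rewrite le_eqVlt => /predU1P[st|st].
  exists [::]; split => //; first by rewrite /itv_partition/= st.
  have := add s s t as_ (lexx s); rewrite -st lexx (le_trans _ tb) -?st//.
  move=> /(_ isT isT); rewrite !subrr powR0 ?gt_eqF ?mulr0 ?(lt_trans ltr01)//.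
  by rewrite sub0r normrN subr0.
have [n Hn] : exists n, (t - s) / 2 ^+ n < d.
  have /cvgrPdist_lt : (2^-1 : R) ^+ n @[n --> \oo] --> (0 : R).
    by apply: cvg_expr; rewrite ger0_norm ?invr_ge0// invf_lt1// ltr1n.
  have ts : 0 < t - s by rewrite subr_gt0.
  have ew : 0 < d / (t - s) by rewrite divr_gt0.
  move=> /(_ _ ew)[n _ /(_ n (leqnn n))]; rewrite sub0r normrN ger0_norm ?exprn_ge0 ?invr_ge0//.
  by rewrite ltr_pdivlMr// exprVn mulrC => H; exists n.
exists (dyadic n s t); split; last exact: sewing_dyadic th1 C0 add as_ (ltW st) tb.
  split; last by rewrite last_dyadic.
  by apply: path_dyadic => u v uv; rewrite -subr_gt0 uv divr_gt0 ?subr_gt0// exprn_gt0.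
by apply: path_dyadic => u v ->.
Qed.

(** The limit in [is_rough_integral], for an arbitrary two-parameter summand. *)
Definition riemann_lim Xi a b (I : W) : Prop :=
  forall e : R, 0 < e -> exists2 d : R, 0 < d &
    forall s : seq R, itv_partition a b s ->
      (forall i, (i < size s)%N ->
         nth a (a :: s) i.+1 - nth a (a :: s) i < d) ->
      `|I - \sum_(i < size s) Xi (nth a (a :: s) i) (nth a (a :: s) i.+1)| < e.

Lemma riemann_lim_chain Xi a b I : riemann_lim Xi a b I ->
  forall e : R, 0 < e -> exists2 d : R, 0 < d & forall p, itv_partition a b p ->
    path (fun u v => v - u < d) a p -> `|I - chain_sum Xi a p| < e.
Proof.
move=> H e e0; have [d d0 Hd] := H e e0; exists d => // p pab /(pathP a) mesh.
by rewrite -chain_sumE; apply: Hd.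
Qed.

Lemma path_mesh d d' a p : d <= d' ->
  path (fun u v => v - u < d) a p -> path (fun u v => v - u < d') a p.
Proof. by move=> dd; apply: sub_path => u v /lt_le_trans; exact. Qed.

(** The limits over [a, s] and [a, t] are compared on partitions of [a, t] that
    pass through s, so additivity of the rough integral and the local bound on
    its increment come out together, without constructing the integral over
    [s, t]. *)
Lemma sewing_left a b th C Xi s t I J : 1 < th -> 0 <= C ->
  near_additive a b th C Xi -> a <= s -> s <= t -> t <= b ->
  riemann_lim Xi a s I -> riemann_lim Xi a t J ->
  `|J - I - Xi s t| <= C / (1 - halving th) * (t - s) `^ th.
Proof.
move=> th1 C0 add as_ st tb /riemann_lim_chain limI /riemann_lim_chain limJ.
apply/ler_addgt0Pr => e e0; have e2 : 0 < e / 2 by rewrite divr_gt0.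
have [d1 d10 H1] := limI _ e2; have [d2 d20 H2] := limJ _ e2.
have d0 : 0 < Num.min d1 d2 by rewrite lt_min d10.
have min1 : Num.min d1 d2 <= d1 by rewrite ge_min lexx.
have min2 : Num.min d1 d2 <= d2 by rewrite ge_min lexx orbT.
have [p [pp mp _]] := fine_partition th1 C0 add (lexx a) as_ (le_trans st tb) d0.
have [q [pq mq Hq]] := fine_partition th1 C0 add as_ st tb d0.
have lp : last a p = s by case: pp => _ /eqP.
have {}H1 := H1 p pp (path_mesh min1 mp).
have {H2} : `|J - chain_sum Xi a (p ++ q)| < e / 2.
  apply: H2; first exact: itv_partition_cat pp pq.
  by rewrite cat_path lp; apply/andP; split; apply: path_mesh min2 _.
rewrite chain_sum_cat lp => H2.
have -> : J - I - Xi s t = (J - (chain_sum Xi a p + chain_sum Xi s q)) -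
    (I - chain_sum Xi a p) - (Xi s t - chain_sum Xi s q).
  by rewrite -[RHS]addrA -opprD (addrACA I) -opprD opprB subrKA opprD addrA.
rewrite (le_trans (ler_normB _ _))// (le_trans (lerD (ler_normB _ _) (lexx _)))//.
by rewrite addrC lerD// (splitr e) lerD// ltW.
Qed.

(** The mirror image, for integrals up to the terminal time, as in the adjoint
    equation. *)
Lemma sewing_right a b th C Xi s t I J : 1 < th -> 0 <= C ->
  near_additive a b th C Xi -> a <= s -> s <= t -> t <= b ->
  riemann_lim Xi s b I -> riemann_lim Xi t b J ->
  `|I - J - Xi s t| <= C / (1 - halving th) * (t - s) `^ th.
Proof.
move=> th1 C0 add as_ st tb /riemann_lim_chain limI /riemann_lim_chain limJ.
apply/ler_addgt0Pr => e e0; have e2 : 0 < e / 2 by rewrite divr_gt0.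
have [d1 d10 H1] := limI _ e2; have [d2 d20 H2] := limJ _ e2.
have d0 : 0 < Num.min d1 d2 by rewrite lt_min d10.
have min1 : Num.min d1 d2 <= d1 by rewrite ge_min lexx.
have min2 : Num.min d1 d2 <= d2 by rewrite ge_min lexx orbT.
have [p [pp mp _]] := fine_partition th1 C0 add (le_trans as_ st) tb (lexx b) d0.
have [q [pq mq Hq]] := fine_partition th1 C0 add as_ st tb d0.
have lq : last s q = t by case: pq => _ /eqP.
have {}H2 := H2 p pp (path_mesh min2 mp).
have {H1} : `|I - chain_sum Xi s (q ++ p)| < e / 2.
  apply: H1; first exact: itv_partition_cat pq pp.
  by rewrite cat_path lq; apply/andP; split; apply: path_mesh min1 _.
rewrite chain_sum_cat lq => H1.
have -> : I - J - Xi s t = (I - (chain_sum Xi s q + chain_sum Xi t p)) -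
    (J - chain_sum Xi t p) - (Xi s t - chain_sum Xi s q).
  by rewrite -[RHS]addrA -opprD (addrACA J) -opprD opprB [chain_sum Xi t p + _]addrC subrKA opprD addrA.
rewrite (le_trans (ler_normB _ _))// (le_trans (lerD (ler_normB _ _) (lexx _)))//.
by rewrite addrC lerD// (splitr e) lerD// ltW.
Qed.

End Sewing.

(** * Calculus of two-parameter Hoelder bounds *)

Section HolderCalculus.
Context (R : realType) (t0 t1 : R).
Hypothesis t01 : t0 <= t1.

Section OneSpace.
Context (V : normedModType R).
Implicit Types (X Y : R -> R -> V) (x y : R -> V) (be ga : R).

Lemma holder2_ge0 be X : holder2 t0 t1 be X -> exists2 C, 0 <= C &
  forall s t, t0 <= s -> s <= t -> t <= t1 -> `|X s t| <= C * (t - s) `^ be.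
Proof.
move=> [C HC]; exists `|C| => // s t h1 h2 h3; apply: le_trans (HC s t h1 h2 h3) _.
by rewrite ler_wpM2r ?powR_ge0// ler_norm.
Qed.

Lemma holder2_eq be X Y :
  (forall s t, t0 <= s -> s <= t -> t <= t1 -> Y s t = X s t) ->
  holder2 t0 t1 be X -> holder2 t0 t1 be Y.
Proof. by move=> XY [C HC]; exists C => s t h1 h2 h3; rewrite XY// HC. Qed.

Lemma holder2D be X Y : holder2 t0 t1 be X -> holder2 t0 t1 be Y ->
  holder2 t0 t1 be (fun s t => X s t + Y s t).
Proof.
move=> [C HC] [D HD]; exists (C + D) => s t h1 h2 h3; rewrite mulrDl.
by apply: le_trans (ler_normD _ _) _; rewrite lerD ?HC ?HD.
Qed.

Lemma holder2N be X : holder2 t0 t1 be X -> holder2 t0 t1 be (fun s t => - X s t).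
Proof. by move=> [C HC]; exists C => s t h1 h2 h3; rewrite normrN HC. Qed.

Lemma holder2B be X Y : holder2 t0 t1 be X -> holder2 t0 t1 be Y ->
  holder2 t0 t1 be (fun s t => X s t - Y s t).
Proof. by move=> HX HY; apply: holder2D => //; exact: holder2N. Qed.

Lemma holder2_sum be (I : Type) (r : seq I) (X : I -> R -> R -> V) :
  (forall i, holder2 t0 t1 be (X i)) ->
  holder2 t0 t1 be (fun s t => \sum_(i <- r) X i s t).
Proof.
move=> HX; elim: r => [|i r IH].
  by exists 0 => s t *; rewrite big_nil normr0 mul0r.
by apply: holder2_eq (holder2D (HX i) IH) => s t *; rewrite big_cons.
Qed.

Lemma holder2_le be ga X : 0 <= ga -> ga <= be ->
  holder2 t0 t1 be X -> holder2 t0 t1 ga X.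
Proof.
move=> ga0 gabe /holder2_ge0[C C0 HC]; exists (C * (t1 - t0) `^ (be - ga)) => s t h1 h2 h3.
apply: le_trans (HC s t h1 h2 h3) _; rewrite -mulrA ler_wpM2l//.
have ts : 0 <= t - s by rewrite subr_ge0.
have [ts0|ts0] := eqVneq (t - s) 0.
  have [be0|be0] := eqVneq be 0.
    have ga00 : ga = 0 by apply/eqP; rewrite eq_le ga0 -be0 gabe.
    by rewrite ga00 be0 subr0 !powRr0 mulr1.
  by rewrite ts0 powR0// mulr_ge0// powR_ge0.
have -> : (t - s) `^ be = (t - s) `^ (be - ga) * (t - s) `^ ga.
  by rewrite -powRD ?subrK// ts0 implybT.
rewrite ler_wpM2r ?powR_ge0// ge0_ler_powR ?subr_ge0// ?nnegrE ?subr_ge0//.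
by rewrite lerB.
Qed.

Definition holder_path be x := holder2 t0 t1 be (fun s t => x t - x s).
(** Boundedness is the exponent 0 case of [holder2], so that bounded coefficients
    enter the product rules of this calculus on the same footing. *)
Definition bounded_path x := holder2 t0 t1 0 (fun s _ => x s).

Lemma bounded_pathP x : bounded_path x ->
  exists2 C, 0 <= C & forall s, t0 <= s -> s <= t1 -> `|x s| <= C.
Proof.
move=> /holder2_ge0[C C0 HC]; exists C => // s h1 h2.
by have := HC s s h1 (lexx s) h2; rewrite powRr0 mulr1.
Qed.

Lemma bounded_pathI x C : (forall s, t0 <= s -> s <= t1 -> `|x s| <= C) -> bounded_path x.
Proof.
by move=> HC; exists C => s t h1 h2 h3; rewrite powRr0 mulr1 HC// (le_trans h2).
Qed.

Lemma holder_path_bounded be x : 0 <= be -> holder_path be x -> bounded_path x.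
Proof.
move=> be0 /holder2_ge0[C C0 HC].
apply: (@bounded_pathI _ (`|x t0| + C * (t1 - t0) `^ be)) => s h1 h2.
rewrite -[x s](subrK (x t0)) addrC (le_trans (ler_normD _ _))// lerD2l.
apply: le_trans (HC t0 s (lexx _) h1 h2) _; rewrite ler_wpM2l//.
by rewrite ge0_ler_powR ?nnegrE ?subr_ge0// lerB.
Qed.

End OneSpace.

(** Exponents add under products; the slack [de <= be + ga] also absorbs the
    comparison of exponents on a bounded interval. *)
Lemma holder2_bilinear (U V W : normedModType R) (op : U -> V -> W) c be ga de
    (X : R -> R -> U) (Y : R -> R -> V) :
  0 <= c -> (forall a b, `|op a b| <= c * `|a| * `|b|) ->
  0 <= be -> 0 <= ga -> 0 <= de <= be + ga ->
  holder2 t0 t1 be X -> holder2 t0 t1 ga Y ->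
  holder2 t0 t1 de (fun s t => op (X s t) (Y s t)).
Proof.
move=> c0 Hop be0 ga0 /andP[de0 debg] HX HY; apply: holder2_le de0 debg _.
move: HX HY => /holder2_ge0[C C0 HC] /holder2_ge0[D D0 HD].
exists (c * C * D) => s t h1 h2 h3.
apply: le_trans (Hop _ _) _.
apply: (@le_trans _ _ (c * (C * (t - s) `^ be) * (D * (t - s) `^ ga))).
  by rewrite ler_pM ?mulr_ge0// ?ler_wpM2l// ?HC// ?HD.
rewrite le_eqVlt; apply/orP; left; apply/eqP.
have -> : (t - s) `^ (be + ga) = (t - s) `^ be * (t - s) `^ ga; last by ring.
have [->|ga'] := eqVneq ga 0; first by rewrite addr0 powRr0 mulr1.
by rewrite powRD// implybE paddr_eq0// (negPf ga') andbF.
Qed.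

Lemma holder2M be ga de (X Y : R -> R -> R^o) : 0 <= be -> 0 <= ga ->
  0 <= de <= be + ga ->
  holder2 t0 t1 be X -> holder2 t0 t1 ga Y ->
  holder2 t0 t1 de (fun s t => X s t * Y s t : R^o).
Proof.
by apply: (@holder2_bilinear R^o R^o R^o *%R 1) => // a b; rewrite mul1r normrM.
Qed.

Lemma holder2Z (V : normedModType R) be ga de (X : R -> R -> R^o) (Y : R -> R -> V) :
  0 <= be -> 0 <= ga -> 0 <= de <= be + ga ->
  holder2 t0 t1 be X -> holder2 t0 t1 ga Y ->
  holder2 t0 t1 de (fun s t => X s t *: Y s t).
Proof.
by apply: (@holder2_bilinear R^o V V *:%R 1) => // a b; rewrite mul1r normrZ.
Qed.

Lemma holder2_mulmx m n p be ga de (X : R -> R -> 'M[R]_(m, n)) (Y : R -> R -> 'M[R]_(n, p)) :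
  0 <= be -> 0 <= ga -> 0 <= de <= be + ga ->
  holder2 t0 t1 be X -> holder2 t0 t1 ga Y ->
  holder2 t0 t1 de (fun s t => X s t *m Y s t).
Proof. by apply: (@holder2_bilinear _ _ _ mulmx n%:R) => // a b; exact: norm_mulmx. Qed.

Lemma holder2_entries m n be (X : R -> R -> 'M[R]_(m, n)) :
  (forall i j, holder2 t0 t1 be (fun s t => X s t i j : R^o)) -> holder2 t0 t1 be X.
Proof.
move=> HX.
have [C C0 HC] : exists2 C, 0 <= C & forall ij : 'I_m * 'I_n, forall s t, t0 <= s -> s <= t -> t <= t1 ->
    `|X s t ij.1 ij.2| <= C * (t - s) `^ be.
  apply: uniform_bound => [i C D CD H s t *|[i j]]; last by have [C HC] := HX i j; exists C.
  by apply: le_trans (H s t _ _ _) _ => //; rewrite ler_wpM2r// powR_ge0.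
exists C => s t h1 h2 h3; apply: norm_le_entries => [|i j].
  by rewrite mulr_ge0// powR_ge0.
exact: (HC (i, j)).
Qed.

Lemma holder2_entry m n be (X : R -> R -> 'M[R]_(m, n)) i j :
  holder2 t0 t1 be X -> holder2 t0 t1 be (fun s t => X s t i j : R^o).
Proof.
move=> [C HC]; exists C => s t h1 h2 h3.
exact: le_trans (entry_le_norm _ _ _) (HC s t h1 h2 h3).
Qed.

Lemma holder_pathD (V : normedModType R) be (x y : R -> V) :
  holder_path be x -> holder_path be y -> holder_path be (fun t => x t + y t).
Proof.
by move=> hx hy; apply: holder2_eq (holder2D hx hy) => s t *; rewrite opprD addrACA.
Qed.

Lemma holder_path_sum (V : normedModType R) be (I : Type) (r : seq I) (x : I -> R -> V) :
  (forall i, holder_path be (x i)) -> holder_path be (fun t => \sum_(i <- r) x i t).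
Proof.
by move=> hx; apply: holder2_eq (holder2_sum r hx) => s t *; rewrite sumrB.
Qed.

Lemma holder_pathM be (x y : R -> R^o) : 0 <= be ->
  holder_path be x -> holder_path be y -> holder_path be (fun t => x t * y t : R^o).
Proof.
move=> be0 hx hy.
have bx := holder_path_bounded be0 hx.
have /bounded_pathP[C _ HC] := holder_path_bounded be0 hy.
have by' : holder2 t0 t1 0 (fun s t => y t : R^o).
  by exists C => s t h1 h2 h3; rewrite powRr0 mulr1 HC// (le_trans h1).
have be1 : 0 <= be <= be + 0 by rewrite be0 addr0 lexx.
have be2 : 0 <= be <= 0 + be by rewrite be0 add0r lexx.
have := holder2D (holder2M be0 (lexx 0) be1 hx by') (holder2M (lexx 0) be0 be2 bx hy).
apply: holder2_eq => s t *.
by rewrite mulrBl mulrBr addrA subrK.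
Qed.

Lemma holder_path_entry m n be (x : R -> 'M[R]_(m, n)) i j :
  holder_path be x -> holder_path be (fun t => x t i j : R^o).
Proof.
by move=> hx; apply: holder2_eq (holder2_entry i j hx) => s t *; rewrite !mxE.
Qed.

Lemma bounded_path_comp n (g : 'cV[R]_n -> R) (x : R -> 'cV[R]_n) :
  smoothr g -> bounded_path x -> bounded_path (fun t => g (x t) : R^o).
Proof.
move=> sg /bounded_pathP[r _ xr]; have [C _ HC] := smooth_bounded r sg.
by apply: (@bounded_pathI _ _ C) => s h1 h2; apply: HC; exact: xr.
Qed.

Lemma holder_path_comp n be (g : 'cV[R]_n -> R) (x : R -> 'cV[R]_n) : 0 <= be ->
  smoothr g -> holder_path be x -> holder_path be (fun t => g (x t) : R^o).
Proof.
move=> be0 sg hx; have /bounded_pathP[r _ xr] := holder_path_bounded be0 hx.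
have [C C0 HC] := smooth_lipschitz r sg; have [D HD] := hx.
exists (C * D) => s t h1 h2 h3; apply: le_trans (HC _ _ _ _) _.
- by apply: xr => //; exact: le_trans h2.
- by apply: xr => //; exact: le_trans h3.
by rewrite -mulrA ler_wpM2l// HD.
Qed.

End HolderCalculus.

(** * Controlled paths and near-additivity of the rough sums *)

Section ControlledPaths.
Context (R : realType) (K : nat) (alpha t0 t1 : R).
Context (Z : R -> 'cV[R]_K) (ZZ : R -> R -> 'M[R]_K).
Hypothesis halpha : 3^-1 < alpha <= 2^-1.
Hypothesis ht : t0 <= t1.
Hypothesis hZ : geometric_rough_path alpha t0 t1 Z ZZ.

Let a0 : 0 <= alpha. Proof. by case/andP: halpha; lra. Qed.
Let a20 : 0 <= 2 * alpha. Proof. by move: a0; lra. Qed.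
Let a2 : alpha <= 2 * alpha. Proof. by move: a0; lra. Qed.
Let aa : 0 <= 2 * alpha <= alpha + alpha. Proof. by move: a0; lra. Qed.
Let a01 : 0 <= alpha <= alpha + 0. Proof. by move: a0; lra. Qed.
Let a02 : 0 <= 2 * alpha <= 2 * alpha + 0. Proof. by move: a0; lra. Qed.
Let a03 : 0 <= 2 * alpha <= 0 + 2 * alpha. Proof. by move: a0; lra. Qed.

Lemma rough_increment_holder k : holder2 t0 t1 alpha (fun s t => (Z t - Z s) k 0 : R^o).
Proof. by apply: holder2_entry; case: hZ. Qed.

Lemma rough_second_holder k j : holder2 t0 t1 (2 * alpha) (fun s t => ZZ s t k j : R^o).
Proof. by apply: holder2_entry; case: hZ. Qed.

Lemma controlled_holder (V : normedModType R) (x : R -> V) x' :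
  controlled alpha t0 t1 Z x x' -> holder_path t0 t1 alpha x.
Proof.
move=> [hx' hx].
have hs : holder2 t0 t1 alpha (fun s t => \sum_k (Z t - Z s) k 0 *: x' k s).
  apply: holder2_sum => k.
  have bx' := holder_path_bounded ht a0 (hx' k).
  exact: (holder2Z ht a0 (lexx 0) a01 (rough_increment_holder k) bx').
have := holder2D (holder2_le ht a0 a2 hx) hs.
by apply: holder2_eq => s t *; rewrite subrK.
Qed.

Definition rcontrolled (x : R -> R) (x' : 'I_K -> R -> R) : Prop :=
  controlled alpha t0 t1 Z (x : R -> R^o) (x' : 'I_K -> R -> R^o).

Lemma controlled_entry m (x : R -> 'cV[R]_m) x' i :
  controlled alpha t0 t1 Z x x' ->
  rcontrolled (fun t => x t i 0) (fun k t => x' k t i 0).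
Proof.
move=> [hx' hx]; split=> [k|]; first exact: holder_path_entry (hx' k).
apply: holder2_eq (holder2_entry i 0 hx) => s t *.
rewrite [RHS]mxE; congr (_ + _); first by rewrite !mxE.
rewrite [RHS]mxE summxE; congr (- _); apply: eq_bigr => k _; by rewrite [RHS]mxE.
Qed.

Lemma rcontrolled_eq x y x' y' : x = y -> (forall k, x' k = y' k) ->
  rcontrolled x x' -> rcontrolled y y'.
Proof. by move=> -> /funext->. Qed.

Lemma rcontrolled_sum (I : Type) (r : seq I) x x' :
  (forall i : I, rcontrolled (x i) (x' i)) ->
  rcontrolled (fun t => \sum_(i <- r) x i t) (fun k t => \sum_(i <- r) x' i k t).
Proof.
move=> hx; split=> [k|].
  by apply: (@holder_path_sum _ _ _ R^o) => i; case: (hx i) => /(_ k).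
apply: holder2_eq (holder2_sum r (fun i => proj2 (hx i))) => s t *.
rewrite !sumrB; congr (_ - _ - _).
rewrite exchange_big /=; apply: eq_bigr => k _; rewrite scaler_sumr//.
Qed.

(** Leibniz rule: the product of the two increments is of order 2 alpha and goes
    into the remainder. *)
Lemma rcontrolledM x x' y y' : rcontrolled x x' -> rcontrolled y y' ->
  rcontrolled (fun t => x t * y t) (fun k t => x' k t * y t + x t * y' k t).
Proof.
move=> cx cy; have hx := controlled_holder cx; have hy := controlled_holder cy.
have [hx' rx] := cx; have [hy' ry] := cy.
have bx := holder_path_bounded ht a0 hx; have by' := holder_path_bounded ht a0 hy.
split=> [k|].
  by apply: holder_pathD; apply: holder_pathM => //; [exact: hx'|exact: hy'].
have H1 := holder2M ht a0 a0 aa hx hy.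
have H2 := holder2M ht a20 (lexx 0) a02 rx by'.
have H3 := holder2M ht (lexx 0) a20 a03 bx ry.
apply: holder2_eq (holder2D (holder2D H1 H2) H3) => s t _ _ _.
set S := \sum_k _.
have -> : S = (\sum_k (Z t - Z s) k 0 *: (x' k s : R^o)) * y s +
      x s * (\sum_k (Z t - Z s) k 0 *: (y' k s : R^o)).
  rewrite mulr_suml mulr_sumr -big_split; apply: eq_bigr => k _ /=.
  by rewrite /GRing.scale /=; ring.
ring.
Qed.

(** Chain rule: the Taylor remainder is quadratic in an increment of order
    alpha. *)
Lemma rcontrolled_comp n (g : 'cV[R]_n -> R) q q' : smoothr g ->
  controlled alpha t0 t1 Z q q' ->
  rcontrolled (fun t => g (q t)) (fun k t => \sum_i q' k t i 0 * partial g i (q t)).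
Proof.
move=> sg cq; have hq := controlled_holder cq; have [hq' rq] := cq.
have /(bounded_pathP)[r _ qr] := holder_path_bounded ht a0 hq.
split=> [k|].
  apply: (@holder_path_sum _ _ _ R^o) => i; apply: holder_pathM => //.
    exact: holder_path_entry (hq' k).
  have hh := holder_path_comp ht a0 (smooth_partial i sg) hq.
  exact: hh.
have [C C0 HC] := smooth_taylor r sg.
have H1 : holder2 t0 t1 (2 * alpha) (fun s t => taylor1 g (q s) (q t) : R^o).
  have [D D0 HD] := holder2_ge0 hq.
  exists (C * D ^+ 2) => s t h1 h2 h3.
  have qs : `|q s| <= r by apply: qr => //; exact: le_trans h3.
  have qt : `|q t| <= r by apply: qr => //; exact: le_trans h2.
  have := HC _ _ _ _ qt qs qs qs.
  rewrite {2}/taylor1 !subrr derive0 !subr0 !normr0 mul0r add0r addr0 -expr2 => /le_trans; apply.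
  rewrite -mulrA ler_wpM2l//.
  have -> : (t - s) `^ (2 * alpha) = ((t - s) `^ alpha) ^+ 2.
    by rewrite -powR_mulrn ?powR_ge0// -powRrM mulrC.
  by rewrite -exprMn ler_pXn2r ?nnegrE ?mulr_ge0 ?powR_ge0 ?HD.
have H2 : holder2 t0 t1 (2 * alpha) (fun s t => \sum_i
    (q t - q s - \sum_k (Z t - Z s) k 0 *: q' k s) i 0 * partial g i (q s) : R^o).
  apply: holder2_sum => i.
  have bp := bounded_path_comp (smooth_partial i sg) (holder_path_bounded ht a0 hq).
  exact: (holder2M ht a20 (lexx 0) a02 (holder2_entry i 0 rq) bp).
apply: holder2_eq (holder2D H1 H2) => s t _ _ _.
rewrite /taylor1 derive_partial//.
rewrite [X in _ = _ + X](eq_bigr (fun i => (q t - q s) i 0 * partial g i (q s) -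
   \sum_k (Z t - Z s) k 0 * (q' k s i 0 * partial g i (q s)))); last first.
  move=> i _; transitivity (((q t - q s) i 0 - \sum_k (Z t - Z s) k 0 * q' k s i 0) * partial g i (q s)).
    congr (_ * _); rewrite [LHS]mxE; congr (_ + _); rewrite [LHS]mxE summxE; congr (- _).
    by apply: eq_bigr => k _; rewrite [LHS]mxE.
  by rewrite mulrBl mulr_suml; congr (_ - _); apply: eq_bigr => k _; rewrite mulrA.
rewrite [in RHS]sumrB [X in _ = _ + (_ - X)]exchange_big /= addrA subrK.
congr (_ - _); apply: eq_bigr => k _.
by rewrite /GRing.scale /= mulr_sumr.
Qed.

Definition rough_local (y : 'I_K -> R -> R) (y' : 'I_K -> 'I_K -> R -> R) (u v : R) : R^o :=
  \sum_j (Z v - Z u) j 0 * y j u + \sum_k \sum_j ZZ u v k j * y' j k u.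

Lemma is_rough_integral_entry n a b (y : 'I_K -> R -> 'cV[R]_n) y' I i :
  is_rough_integral Z ZZ a b y y' I ->
  riemann_lim (rough_local (fun j t => y j t i 0) (fun j k t => y' j k t i 0)) a b (I i 0).
Proof.
move=> H e e0; have [d d0 Hd] := H e e0; exists d => // p pab mesh.
have {Hd} := Hd p pab mesh; apply: le_lt_trans.
set S := (X in _ <= `|_ - X|).
suff -> : I i 0 - \sum_(j < size p) rough_local (fun j t => y j t i 0) (fun j k t => y' j k t i 0) (nth a (a :: p) j) (nth a (a :: p) j.+1) = (I - S) i 0.
  exact: entry_le_norm.
rewrite [RHS]mxE; congr (_ + _); rewrite [RHS]mxE summxE; congr (- _); apply: eq_bigr => j _.
rewrite [RHS]mxE !summxE; congr (_ + _); apply: eq_bigr => k _; first by rewrite [RHS]mxE.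
by rewrite summxE; apply: eq_bigr => l _; rewrite [RHS]mxE.
Qed.

(** By Chen's relation the defect of additivity pairs an increment of Z with the
    remainder of y, and ZZ with an increment of y'; both have order 3 alpha. *)
Lemma rough_local_near_additive (y : 'I_K -> R -> R) (y' : 'I_K -> 'I_K -> R -> R) :
  (forall j, rcontrolled (y j) (y' j)) ->
  exists2 C, 0 <= C & near_additive t0 t1 (3 * alpha) C (rough_local y y').
Proof.
move=> cy.
have [hZ1 hZ2 chen _] := hZ.
have [C1 C10 HC1] := holder2_ge0 hZ1.
have [C2 C20 HC2] := holder2_ge0 hZ2.
have [C3 C30 HC3] : exists2 C, 0 <= C & forall j s t, t0 <= s -> s <= t -> t <= t1 ->
    `|y j t - y j s - \sum_k (Z t - Z s) k 0 * y' j k s| <= C * (t - s) `^ (2 * alpha).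
  apply: uniform_bound => [i C D CD H s t *|j]; last by case: (cy j) => _ [C HC]; exists C.
  by apply: le_trans (H s t _ _ _) _ => //; rewrite ler_wpM2r// powR_ge0.
have [C4 C40 HC4] : exists2 C, 0 <= C & forall jk : 'I_K * 'I_K, forall s t, t0 <= s -> s <= t -> t <= t1 ->
    `|y' jk.1 jk.2 t - y' jk.1 jk.2 s| <= C * (t - s) `^ alpha.
  apply: uniform_bound => [i C D CD H s t *|[j k]]; last by case: (cy j) => /(_ k)[C HC] _; exists C.
  by apply: le_trans (H s t _ _ _) _ => //; rewrite ler_wpM2r// powR_ge0.
exists (K%:R * (C1 * C3) + K%:R * (K%:R * (C2 * C4))).
  by rewrite addr_ge0 ?mulr_ge0.
move=> s u t h1 h2 h3 h4.
have su0 : 0 <= u - s by rewrite subr_ge0.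
have ut0 : 0 <= t - u by rewrite subr_ge0.
have st0 : 0 <= t - s by lra.
have uu : u <= t1 by exact: le_trans h4.
have tu : t0 <= u by exact: le_trans h2.
have pw (b c : R) : 0 <= b -> 0 <= c -> b + c = 3 * alpha ->
    (t - u) `^ b * (u - s) `^ c <= (t - s) `^ (3 * alpha).
  move=> b0 c0 bc; rewrite -bc powRD; last first.
    by rewrite bc; apply/implyP => /eqP; have := halpha; lra.
  by apply: ler_pM; rewrite ?powR_ge0// ge0_ler_powR ?nnegrE//; lra.
have -> : rough_local y y' s t - rough_local y y' s u - rough_local y y' u t =
  - (\sum_j (Z t - Z u) j 0 * (y j u - y j s - \sum_k (Z u - Z s) k 0 * y' j k s)) -
  \sum_k \sum_j ZZ u t k j * (y' j k u - y' j k s).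
  rewrite /rough_local.
  have e1 : \sum_j (Z t - Z u) j 0 * (y j u - y j s - \sum_k (Z u - Z s) k 0 * y' j k s) =
    \sum_j (Z t - Z u) j 0 * y j u + \sum_j (Z u - Z s) j 0 * y j s
      - \sum_j (Z t - Z s) j 0 * y j s
      - \sum_k \sum_j (Z u - Z s) k 0 * (Z t - Z u) j 0 * y' j k s.
    rewrite [X in _ = _ - X]exchange_big /= -!big_split -!sumrB; apply: eq_bigr => j _ /=.
    rewrite !mulrBr mulr_sumr; congr (_ - _).
      by rewrite !mxE; ring.
    by apply: eq_bigr => k _; ring.
  have e2 : \sum_k \sum_j ZZ u t k j * (y' j k u - y' j k s) =
    \sum_k \sum_j ZZ u t k j * y' j k u + \sum_k \sum_j ZZ s u k j * y' j k s +
    \sum_k \sum_j (Z u - Z s) k 0 * (Z t - Z u) j 0 * y' j k s -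
    \sum_k \sum_j ZZ s t k j * y' j k s.
    rewrite -!big_split -sumrB; apply: eq_bigr => k _ /=.
    rewrite -!big_split -sumrB; apply: eq_bigr => j _ /=.
    rewrite (chen s u t)// [(_ + _ *m _) k j]mxE [(_ *m _) k j]mxE big_ord1 [(ZZ _ _ + _) k j]mxE [_^T _ _]mxE.
    ring.
  by rewrite e1 e2; ring.
rewrite (le_trans (ler_normB _ _))// normrN mulrDl.
apply: lerD; rewrite -!mulrA; apply: (@norm_sum_le _ R^o) => j.
  rewrite normrM; apply: (@le_trans _ _ ((C1 * (t - u) `^ alpha) * (C3 * (u - s) `^ (2 * alpha)))).
    by rewrite ler_pM// ?HC3// (le_trans (entry_le_norm _ _ _))// HC1.
  rewrite (_ : _ * _ = C1 * C3 * ((t - u) `^ alpha * (u - s) `^ (2 * alpha))); last by ring.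
  by rewrite [leRHS]mulrA ler_wpM2l ?mulr_ge0// pw//; ring.
apply: (@norm_sum_le _ R^o) => i.
rewrite normrM; apply: (@le_trans _ _ ((C2 * (t - u) `^ (2 * alpha)) * (C4 * (u - s) `^ alpha))).
  by rewrite ler_pM// ?(HC4 (i, j))// (le_trans (entry_le_norm _ _ _))// HC2.
rewrite (_ : _ * _ = C2 * C4 * ((t - u) `^ (2 * alpha) * (u - s) `^ alpha)); last by ring.
by rewrite [leRHS]mulrA ler_wpM2l ?mulr_ge0// pw//; ring.
Qed.

End ControlledPaths.

(** * The drift integral *)

Section Drift.
Context (R : realType) (t0 t1 : R).
Hypothesis ht : t0 <= t1.
Local Notation mu := (@lebesgue_measure R).

(** The path is only controlled on [t0, t1]; freezing it outside, at its boundary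
    values, produces a continuous function on the line. *)
Lemma holder_path_integrable be (g : R -> R) : 0 < be ->
  holder_path t0 t1 be (g : R -> R^o) -> mu.-integrable `[t0, t1] (EFin \o g).
Proof.
move=> be0 /holder2_ge0[C C0 HC].
pose cl x : R := Num.max t0 (Num.min x t1).
have cl1 x : t0 <= cl x by rewrite le_max lexx.
have cl2 x : cl x <= t1 by rewrite ge_max ht ge_min lexx orbT.
have clm x y : x <= y -> cl x <= cl y /\ cl y - cl x <= y - x.
  move=> xy; rewrite /cl /Num.max /Num.min.
  by case: (ltP x t1); case: (ltP y t1); case: (ltP t0 x); case: (ltP t0 y); case: (ltP t0 t1); move: ht => *; split; lra.
have clid x : t0 <= x -> x <= t1 -> cl x = x.
  by move=> h1 h2; rewrite /cl min_l// max_r.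
have bnd x y : x <= y -> `|g (cl x) - g (cl y)| <= C * `|x - y| `^ be.
  move=> xy; have [h1 h2] := clm x y xy; rewrite distrC.
  apply: le_trans (HC _ _ (cl1 x) h1 (cl2 y)) _; rewrite ler_wpM2l//.
  by rewrite ge0_ler_powR ?nnegrE ?subr_ge0// ?(ltW be0)// distrC ger0_norm ?subr_ge0.
have cont : continuous (g \o cl : R -> R^o).
  move=> x; apply/cvgrPdist_lt => e e0.
  have C1 : 0 < C + 1 by rewrite ltr_wpDl.
  have d0 : 0 < (e / (C + 1)) `^ be^-1 by apply/powR_gt0/divr_gt0.
  have := nbhsx_ballx x _ d0; apply: filterS => y; rewrite /ball /= => xy.
  have : `|g (cl x) - g (cl y)| <= C * `|x - y| `^ be.
    have [?|/ltW ?] := leP x y; first exact: bnd.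
    by rewrite distrC [`|x - y|]distrC; exact: bnd.
  move=> /le_lt_trans; apply.
  apply: (@le_lt_trans _ _ ((C + 1) * `|x - y| `^ be)).
    by rewrite ler_wpM2r ?powR_ge0// lerDl.
  rewrite -ltr_pdivlMl// mulrC.
  have -> : e / (C + 1) = ((e / (C + 1)) `^ be^-1) `^ be.
    by rewrite -powRrM mulVf ?powRr1 ?gt_eqF// ltW// divr_gt0.
  by rewrite gt0_ltr_powR ?nnegrE// powR_ge0.
have : mu.-integrable `[t0, t1] (EFin \o (g \o cl)).
  apply: continuous_compact_integrable; first exact: segment_compact.
  exact: continuous_subspaceT.
apply: eq_integrable => // x; rewrite inE /= in_itv /= => /andP[h1 h2].
by rewrite clid.
Qed.

(** With be = alpha <= 1/2 the order 1 + be is at least 3 alpha, so drift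
    integrals are negligible beyond their first order term. *)
Lemma drift_bound be (g : R -> R) : 0 < be ->
  holder_path t0 t1 be (g : R -> R^o) ->
  holder2 t0 t1 (1 + be) (fun s t => \int[mu]_(r in `[s, t]) g r - g s * (t - s) : R^o).
Proof.
move=> be0 hg; have [C C0 HC] := holder2_ge0 hg; exists C => s t h1 h2 h3.
have ig : mu.-integrable `[s, t] (EFin \o g).
  apply: integrableS (holder_path_integrable be0 hg) => //.
  by apply: subset_itv; rewrite bnd_simp.
have lenst : fine (mu `[s, t]) = t - s.
  rewrite lebesgue_measure_itv/= lte_fin; case: ltP => //= ts.
  by apply/eqP; rewrite eq_sym subr_eq0 eq_le ts.
have finst : (mu `[s, t] < +oo)%E.
  by rewrite lebesgue_measure_itv/= lte_fin; case: ifP => // _; rewrite -EFinD ltry.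
have icst (c : R) : mu.-integrable `[s, t] (EFin \o cst c).
  by apply: continuous_compact_integrable; [exact: segment_compact|exact: continuous_subspaceT (@cst_continuous _ _ _)].
have -> : \int[mu]_(r in `[s, t]) g r - g s * (t - s) =
    \int[mu]_(r in `[s, t]) (g r - g s).
  by rewrite RintegralB//; [rewrite Rintegral_cst// lenst|exact: icst].
have igs : mu.-integrable `[s, t] (EFin \o (fun r => g r - g s)).
  exact: integrableB ig (icst (g s)).
apply: (le_trans (@le_normr_Rintegral _ _ _ mu _ _ _ igs)); first exact: measurable_itv.
apply: (@le_trans _ _ (\int[mu]_(r in `[s, t]) (C * (t - s) `^ be))).
  apply: le_Rintegral => //.
  - exact: integrable_norm igs.
  - exact: icst.
  move=> r; rewrite /= in_itv/= => /andP[r1 r2].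
  have rt : r <= t1 by exact: le_trans h3.
  apply: le_trans (HC s r h1 r1 rt) _; rewrite ler_wpM2l//.
  by rewrite ge0_ler_powR ?nnegrE ?subr_ge0// ?(ltW be0)// lerB.
rewrite Rintegral_cst// lenst -mulrA ler_wpM2l// [1 + be]addrC powRD.
  by rewrite powRr1// subr_ge0.
by rewrite implybE paddr_eq0// ?(ltW be0)// (gt_eqF be0).
Qed.

Lemma Rintegral_diff_left be (g : R -> R) s t : 0 < be ->
  holder_path t0 t1 be (g : R -> R^o) -> t0 <= s -> s <= t -> t <= t1 ->
  \int[mu]_(r in `[t0, t]) g r - \int[mu]_(r in `[t0, s]) g r =
  \int[mu]_(r in `[s, t]) g r.
Proof.
move=> be0 hg h1 h2 h3; rewrite Rintegral_itvB ?bnd_simp//.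
  rewrite Rintegral_itv_obnd_cbnd//.
  apply: integrableS (holder_path_integrable be0 hg) => //.
  by apply: subset_itv; rewrite bnd_simp// ltW.
apply: integrableS (holder_path_integrable be0 hg) => //.
by apply: subset_itv; rewrite bnd_simp.
Qed.

Lemma Rintegral_diff_right be (g : R -> R) s t : 0 < be ->
  holder_path t0 t1 be (g : R -> R^o) -> t0 <= s -> s <= t -> t <= t1 ->
  \int[mu]_(r in `[s, t1]) g r - \int[mu]_(r in `[t, t1]) g r =
  \int[mu]_(r in `[s, t]) g r.
Proof.
move=> be0 hg h1 h2 h3.
have i0 := holder_path_integrable be0 hg.
have is1 : mu.-integrable `[s, t1] (EFin \o g).
  by apply: integrableS i0 => //; apply: subset_itv; rewrite bnd_simp.
have it1 : mu.-integrable `]t, t1] (EFin \o g).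
  by apply: integrableS i0 => //; apply: subset_itv; rewrite bnd_simp// (le_trans h1).
rewrite -(Rintegral_itv_obnd_cbnd it1) -(Rintegral_itvB is1) ?bnd_simp//.
by rewrite opprB addrC subrK.
Qed.
End Drift.

(** * Differentials of the vector fields *)

Section Differentials.
Context (R : realType) (V : normedModType R).

Lemma differentiable_entries m n (g : V -> 'M[R]_(m, n)) x :
  (forall i j, differentiable (fun y => g y i j : R^o) x) -> differentiable g x.
Proof.
move=> dg.
have -> : g = \sum_(i < m) \sum_(j < n) (fun y => g y i j *: delta_mx i j).
  apply/funext => y; rewrite fct_sumE [LHS]matrix_sum_delta.
  by apply: eq_bigr => i _; rewrite fct_sumE.
apply: differentiable_sum => i; apply: differentiable_sum => j.
exact: differentiableZl.
Qed.

Lemma diff_entry m n (g : V -> 'M[R]_(m, n)) x v i j :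
  (forall i j, differentiable (fun y => g y i j : R^o) x) ->
  ('d g x v) i j = 'd (fun y => g y i j : R^o) x v.
Proof.
move=> dg; have dg' := differentiable_entries dg.
by rewrite -deriveE// derive_mx ?mxE ?deriveE//; exact: diff_derivable.
Qed.

End Differentials.

Section VectorMaps.
Context (R : realType) (n m : nat).
Implicit Types (g : 'cV[R]_n -> 'cV[R]_m).

Definition vsmooth g := forall l, smoothr (fun x => g x l 0).

Lemma jac_mul_entry g b v l : vsmooth g ->
  (jac g b *m v) l 0 = 'D_v (fun x => g x l 0 : R^o) b.
Proof.
move=> sg; rewrite derive_partial// mxE; apply: eq_bigr => i _.
by rewrite mxE mulrC.
Qed.

Lemma vsmooth_differentiable g x : vsmooth g -> differentiable g x.
Proof.
move=> sg; apply: differentiable_entries => i j.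
by rewrite ord1; exact: smooth_diff.
Qed.

Lemma diff_jac g x v : vsmooth g -> 'd g x v = jac g x *m v.
Proof.
move=> sg; apply/colP => l; rewrite jac_mul_entry// diff_entry ?deriveE//.
  exact: smooth_diff.
by move=> i j; rewrite ord1; exact: smooth_diff.
Qed.

End VectorMaps.

Section VectorFields.
Context (R : realType) (N K : nat).
Context (f : 'cV[R]_N -> 'cV[R]_N) (sigma : 'cV[R]_N -> 'M[R]_(N, K)).
Hypothesis sf : smooth_on setT f.
Hypothesis ssigma : smooth_on setT sigma.
Implicit Types (x p : 'cV[R]_N).

Local Notation sg := (sigma_col sigma).

Lemma smooth_sigma_col j l : smoothr (fun x => sg j x l 0).
Proof.
rewrite (_ : (fun x => _) = fun x => sigma x l j); first exact: smooth_entry.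
by apply/funext => x; rewrite mxE.
Qed.

Lemma vsmooth_sigma_col j : vsmooth (sg j).
Proof. by move=> l; exact: smooth_sigma_col. Qed.

(** The derivative of the matrix [jac (sg j)] in the direction of the k-th
    vector field; it is what the chain rule produces in the Gubinelli derivative
    of the adjoint integrand. *)
Definition jac_along (k j : 'I_K) x : 'M[R]_N :=
  \matrix_(l, i) \sum_m sg k x m 0 * partial (partial (fun y => sg j y l 0) i) m x.

(** The integrand of the adjoint equation is a sum of such terms, linear in the
    second component of the phase space point. *)
Lemma is_diff_adj_term (a : 'cV[R]_N -> R) l (x : 'cV[R]_N * 'cV[R]_N) (v : 'cV[R]_N * 'cV[R]_N) :
  smoothr a ->
  differentiable (fun x : 'cV[R]_N * 'cV[R]_N => a x.1 * x.2 l 0 : R^o) x /\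
  'd (fun x : 'cV[R]_N * 'cV[R]_N => a x.1 * x.2 l 0 : R^o) x v =
    (\sum_m v.1 m 0 * partial a m x.1) * x.2 l 0 + a x.1 * v.2 l 0.
Proof.
move=> sa.
have d1 : differentiable (fst : 'cV[R]_N * 'cV[R]_N -> 'cV[R]_N) x.
  by apply: linear_differentiable => y; exact: cvg_fst.
have d2 : differentiable (snd : 'cV[R]_N * 'cV[R]_N -> 'cV[R]_N) x.
  by apply: linear_differentiable => y; exact: cvg_snd.
have da := smooth_diff x.1 sa.
have d3 : differentiable (fun x : 'cV[R]_N * 'cV[R]_N => a x.1 : R^o) x.
  exact: (@differentiable_comp _ _ _ _ fst (a : _ -> R^o)).
have dc : differentiable (fun y : 'cV[R]_N => y l 0 : R^o) x.2 by exact: differentiable_coord.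
have d4 : differentiable (fun x : 'cV[R]_N * 'cV[R]_N => x.2 l 0 : R^o) x.
  exact: (@differentiable_comp _ _ _ _ snd (fun y : 'cV[R]_N => y l 0 : R^o)).
split; first exact: differentiableM.
rewrite (@diffM _ _ (fun x : 'cV[R]_N * 'cV[R]_N => a x.1 : R^o) (fun x : 'cV[R]_N * 'cV[R]_N => x.2 l 0 : R^o))//.
have e1 : 'd (fun x : 'cV[R]_N * 'cV[R]_N => a x.1 : R^o) x v = \sum_m v.1 m 0 * partial a m x.1.
  rewrite -derive_partial// deriveE//.
  rewrite (@diff_comp _ _ _ _ fst (a : _ -> R^o))//= diff_lin//.
  by move=> y; exact: cvg_fst.
have e2 : 'd (fun x : 'cV[R]_N * 'cV[R]_N => x.2 l 0 : R^o) x v = v.2 l 0.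
  rewrite (@diff_comp _ _ _ _ snd (fun y : 'cV[R]_N => y l 0 : R^o))//=.
  rewrite diff_lin; last by move=> y; exact: cvg_snd.
  have := @diff_entry _ _ _ _ (id : 'cV[R]_N -> 'cV[R]_N) x.2 v.2 l 0.
  rewrite diff_val => <- // i j; exact: differentiable_coord.
rewrite -[LHS]/(a x.1 * 'd (fun x : 'cV[R]_N * 'cV[R]_N => x.2 l 0 : R^o) x v +
  x.2 l 0 * 'd (fun x : 'cV[R]_N * 'cV[R]_N => a x.1 : R^o) x v).
by rewrite e1 e2; ring.
Qed.

Lemma diff_jac_adj j (x v : 'cV[R]_N * 'cV[R]_N) k : v.1 = sg k x.1 ->
  'd (jac_adj (sg j)) x v =
    (jac_along k j x.1)^T *m x.2 + (jac (sg j) x.1)^T *m v.2.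
Proof.
move=> vk.
have sp i l : smoothr (partial (fun y => sg j y l 0) i).
  by apply: smooth_partial; exact: smooth_sigma_col.
have E i : (fun y : 'cV[R]_N * 'cV[R]_N => jac_adj (sg j) y i 0 : R^o) =
    \sum_l (fun y : 'cV[R]_N * 'cV[R]_N => partial (fun y => sg j y l 0) i y.1 * y.2 l 0 : R^o).
  apply/funext => y; rewrite fct_sumE mxE; apply: eq_bigr => l _.
  by rewrite !mxE.
apply/colP => i; rewrite diff_entry; last first.
  move=> a b; rewrite ord1 E; apply: differentiable_sum => l.
  by have [] := is_diff_adj_term l x v (sp a l).
have dd l : differentiable (fun y : 'cV[R]_N * 'cV[R]_N => partial (fun y => sg j y l 0) i y.1 * y.2 l 0 : R^o) x.
  by have [] := is_diff_adj_term l x v (sp i l).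
rewrite E -deriveE; last exact: differentiable_sum.
rewrite derive_sum; last by move=> l; exact: diff_derivable.
rewrite [RHS]mxE [X in _ = X + _]mxE [X in _ = _ + X]mxE -big_split /=.
apply: eq_bigr => l _; rewrite deriveE//.
have [_ ->] := is_diff_adj_term l x v (sp i l).
by rewrite !mxE -vk.
Qed.


End VectorFields.

(** * Local expansions of the state and adjoint equations *)

Section Expansions.
Context (R : realType) (N K : nat) (alpha t0 t1 : R).
Context (Z : R -> 'cV[R]_K) (ZZ : R -> R -> 'M[R]_K).
Context (f : 'cV[R]_N -> 'cV[R]_N) (sigma : 'cV[R]_N -> 'M[R]_(N, K)).
Hypothesis halpha : 3^-1 < alpha <= 2^-1.
Hypothesis ht : t0 <= t1.
Hypothesis hZ : geometric_rough_path alpha t0 t1 Z ZZ.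
Hypothesis sf : smooth_on setT f.
Hypothesis ssigma : smooth_on setT sigma.
Implicit Types (x p : 'cV[R]_N).

Local Notation sg := (sigma_col sigma).
Local Notation mu := (@lebesgue_measure R).

(** One step of the second order Taylor (Davie) scheme; [jac (sg j) x *m sg k x]
    is the derivative of the j-th vector field along the k-th one. *)
Definition state_step s t x : 'cV[R]_N :=
  (t - s) *: f x + \sum_j (Z t - Z s) j 0 *: sg j x +
  \sum_k \sum_j ZZ s t k j *: (jac (sg j) x *m sg k x).

(** The Davie step of the momentum.  The Gubinelli derivative of
    (d sigma_j / dq)^* p has a part from differentiating the Jacobian along
    sigma_k and a part from the motion of p, with opposite signs. *)
Definition adjoint_step s t x p : 'cV[R]_N :=
  - ((t - s) *: ((jac f x)^T *m p) +
     \sum_j (Z t - Z s) j 0 *: ((jac (sg j) x)^T *m p) +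
     \sum_k \sum_j ZZ s t k j *:
       ((jac_along sigma k j x)^T *m p -
        (jac (sg j) x)^T *m ((jac (sg k) x)^T *m p))).

Let al0 : 0 < alpha. Proof. by case/andP: halpha; lra. Qed.
Let al3 : 1 < 3 * alpha. Proof. by case/andP: halpha; lra. Qed.
Let al30 : 0 <= 3 * alpha. Proof. by move: al3; lra. Qed.
Let al31 : 3 * alpha <= 1 + alpha. Proof. by case/andP: halpha; lra. Qed.

Lemma smooth_drift l : smoothr (fun x => f x l 0).
Proof. exact: smooth_entry. Qed.

Lemma state_expansion a q : forward_solution alpha t0 t1 Z ZZ f sigma a q ->
  holder2 t0 t1 (3 * alpha) (fun s t => q t - q s - state_step s t (q s)).
Proof.
move=> [_ cq sol]; apply: holder2_entries => l j0; rewrite ord1 {j0}.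
have hq := controlled_holder halpha ht hZ cq.
have cy j : rcontrolled alpha t0 t1 Z (fun t => sg j (q t) l 0)
    (fun k t => (jac (sg j) (q t) *m sg k (q t)) l 0).
  apply: rcontrolled_eq (rcontrolled_comp halpha ht hZ (smooth_sigma_col ssigma j l) cq) => // k.
  by apply/funext => t; rewrite mxE; apply: eq_bigr => i _; rewrite [X in _ = X * _]mxE mulrC.
have [C C0 HC] := rough_local_near_additive halpha hZ cy.
have hfq := holder_path_comp ht (ltW al0) (smooth_drift l) hq.
have [D HD] := holder2_le ht al30 al31 (drift_bound ht al0 hfq).
exists (D + C / (1 - halving (3 * alpha))) => s t h1 h2 h3.
have rl t' I : is_rough_integral Z ZZ t0 t' (fun j r => sg j (q r))
    (fun j => gubinelli_comp (sg j) q (fun k t => sg k (q t))) I ->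
    riemann_lim (rough_local Z ZZ (fun j t => sg j (q t) l 0)
      (fun j k t => (jac (sg j) (q t) *m sg k (q t)) l 0)) t0 t' (I l 0).
  move=> /(is_rough_integral_entry l).
  congr (riemann_lim (rough_local _ _ _ _) _ _ _).
  apply/funext => j; apply/funext => k; apply/funext => r.
  by rewrite /gubinelli_comp diff_jac//; exact: vsmooth_sigma_col.
have [I /rl limI qs] := sol s h1 (le_trans h2 h3).
have [J /rl limJ qt] := sol t (le_trans h1 h2) h3.
have H := sewing_left al3 C0 HC h1 h2 h3 limI limJ.
rewrite mulrDl; apply: le_trans (lerD (HD s t h1 h2 h3) H).
rewrite -(Rintegral_diff_left ht al0 hfq h1 h2 h3).
apply: le_trans (ler_normD _ _); rewrite le_eqVlt; apply/orP; left; apply/eqP; congr (`|_|).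
have -> : q t - q s - state_step s t (q s) =
   vec_integral t0 t (fun r => f (q r)) - vec_integral t0 s (fun r => f (q r)) + (J - I) - state_step s t (q s).
  by rewrite -(subrK (q t0) (q t)) qt -(subrK (q t0) (q s)) qs opprD addrACA subrr addr0 opprD addrACA.
rewrite mxE [(_ + (J - I)) l 0]mxE [(_ - vec_integral _ _ _) l 0]mxE [(- vec_integral _ _ _) l 0]mxE ![vec_integral _ _ _ l 0]mxE [(J - I) l 0]mxE [(- I) l 0]mxE [(- state_step _ _ _) l 0]mxE.
have -> : state_step s t (q s) l 0 = f (q s) l 0 * (t - s) +
   rough_local Z ZZ (fun j t => sg j (q t) l 0)
      (fun j k t => (jac (sg j) (q t) *m sg k (q t)) l 0) s t.
  rewrite /state_step /rough_local [LHS]mxE [X in X + _ = _]mxE [X in X + _ + _ = _]mxE !summxE [f (q s) l 0 * _]mulrC -addrA.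
  congr (_ + (_ + _)); apply: eq_bigr => j _; first by rewrite [LHS]mxE.
  by rewrite summxE; apply: eq_bigr => k _; rewrite [LHS]mxE.
by ring.
Qed.

Lemma adjoint_expansion a b (x : R -> 'cV[R]_N * 'cV[R]_N) : adjoint_solution alpha t0 t1 Z ZZ f sigma a b x ->
  holder2 t0 t1 (3 * alpha)
    (fun s t => (x t).2 - (x s).2 - adjoint_step s t (x s).1 (x s).2).
Proof.
move=> [[_ cq _] _ cp sol]; apply: holder2_entries => i j0; rewrite ord1 {j0}.
set q := fun t => (x t).1 in cq; set p := fun t => (x t).2 in cp.
have hq := controlled_holder halpha ht hZ cq.
have hp := controlled_holder halpha ht hZ cp.
pose y j t := jac_adj (sg j) (x t) i 0.
pose y' j k t := ((jac_along sigma k j (q t))^T *m p t -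
        (jac (sg j) (q t))^T *m ((jac (sg k) (q t))^T *m p t)) i 0.
have cy j : rcontrolled alpha t0 t1 Z (y j) (y' j).
  have sp l : smoothr (partial (fun y => sg j y l 0) i).
    by apply: smooth_partial; exact: smooth_sigma_col.
  have := rcontrolled_sum (index_enum 'I_N) (fun l =>
    rcontrolledM halpha ht hZ (rcontrolled_comp halpha ht hZ (sp l) cq)
    (controlled_entry l cp)).
  apply: rcontrolled_eq => [|k]; apply/funext => t.
    by rewrite /y /jac_adj mxE; apply: eq_bigr => l _; rewrite !mxE.
  rewrite /y' mxE [X in _ = X + _]mxE [X in _ = _ + X]mxE [X in _ = _ - X]mxE -sumrB; apply: eq_bigr => l _.
  rewrite [X in _ = X * _ - _]mxE [X in _ = X * _ - _]mxE.
  rewrite [X in _ = _ - X * _]mxE [X in _ = _ - X * _]mxE -mulrN; congr (_ + _ * _).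
  by rewrite mxE.
have [C C0 HC] := rough_local_near_additive halpha hZ cy.
have hfq : holder_path t0 t1 alpha (fun t => jac_adj f (x t) i 0 : R^o).
  have := @holder_path_sum _ t0 t1 R^o alpha _ (index_enum 'I_N) (fun l t => partial (fun y => f y l 0) i (q t) * p t l 0 : R^o).
  have -> : (fun t => \sum_(l <- index_enum 'I_N) (partial (fun y => f y l 0) i (q t) * p t l 0 : R^o)) = (fun t => jac_adj f (x t) i 0 : R^o).
    by apply/funext => t; rewrite /jac_adj mxE; apply: eq_bigr => l _; rewrite !mxE.
  apply=> l; apply: (holder_pathM ht (ltW al0)); last exact: holder_path_entry hp.
  have hh := holder_path_comp ht (ltW al0) (smooth_partial i (smooth_drift l)) hq.
  exact: hh.
have [D HD] := holder2_le ht al30 al31 (drift_bound ht al0 hfq).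
exists (D + C / (1 - halving (3 * alpha))) => s t h1 h2 h3.
have rl t' I : is_rough_integral Z ZZ t' t1 (fun j r => jac_adj (sg j) (x r))
    (fun j => gubinelli_comp (jac_adj (sg j)) x (fun k r => (sg k (q r), - jac_adj (sg k) (x r)))) I ->
    riemann_lim (rough_local Z ZZ y y') t' t1 (I i 0).
  move=> /(is_rough_integral_entry i).
  congr (riemann_lim (rough_local _ _ _ _) _ _ _).
  apply/funext => j; apply/funext => k; apply/funext => r; rewrite /gubinelli_comp (@diff_jac_adj _ _ _ _ ssigma _ _ _ k)//.
  by rewrite mulmxN.
have [I /rl limI ps] := sol s h1 (le_trans h2 h3).
have [J /rl limJ pt] := sol t (le_trans h1 h2) h3.
have H := sewing_right al3 C0 HC h1 h2 h3 limI limJ.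
rewrite mulrDl; apply: le_trans (lerD (HD s t h1 h2 h3) H).
rewrite -(Rintegral_diff_right ht al0 hfq h1 h2 h3).
apply: le_trans (ler_normD _ _); rewrite -normrN le_eqVlt; apply/orP; left; apply/eqP; congr (`|_|).
have -> : (x t).2 - (x s).2 - adjoint_step s t (x s).1 (x s).2 =
  - ((vec_integral s t1 (fun r => jac_adj f (x r)) - vec_integral t t1 (fun r => jac_adj f (x r))) + (I - J) + adjoint_step s t (x s).1 (x s).2).
  rewrite opprD; congr (_ - _).
  have -> : (x t).2 - (x s).2 = ((x t1).2 - (x s).2) - ((x t1).2 - (x t).2).
    by rewrite opprB [RHS]addrC subrKA.
  by rewrite ps pt !opprD !opprK addrACA.
rewrite [X in - X = _]mxE opprK [LHS]mxE [(_ + (I - J)) i 0]mxE [(_ - vec_integral _ _ _) i 0]mxE [(- vec_integral _ _ _) i 0]mxE ![vec_integral _ _ _ i 0]mxE [(I - J) i 0]mxE [(- J) i 0]mxE.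
have -> : adjoint_step s t (x s).1 (x s).2 i 0 = - (jac_adj f (x s) i 0 * (t - s) +
   rough_local Z ZZ y y' s t).
  rewrite /adjoint_step /rough_local mxE; congr (- _).
  rewrite [LHS]mxE [X in X + _ = _]mxE [X in X + _ + _ = _]mxE !summxE [jac_adj f _ _ _ * _]mulrC -addrA.
  congr (_ + (_ + _)); apply: eq_bigr => j _; first by rewrite [LHS]mxE.
  by rewrite summxE; apply: eq_bigr => k _; rewrite [LHS]mxE.
by ring.
Qed.

End Expansions.

(** * Domination by a weight *)

Section Domination.
Context (R : realType) (T : Type) (D : T -> Prop).

(** [u] is bounded by a constant multiple of [w] on [D], uniformly in all the
    points and times collected in an element of [T]. *)
Definition dominated (V : normedModType R) (u : T -> V) (w : T -> R) : Prop :=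
  exists2 C, 0 <= C & forall i, D i -> `|u i| <= C * w i.

Section OneSpace.
Context (V : normedModType R).
Implicit Types (u v : T -> V) (w : T -> R).

Lemma dominatedD u v w : dominated u w -> dominated v w ->
  dominated (fun i => u i + v i) w.
Proof.
move=> [C C0 HC] [E E0 HE]; exists (C + E) => [|i Di]; first exact: addr_ge0.
by rewrite mulrDl (le_trans (ler_normD _ _))// lerD ?HC ?HE.
Qed.

Lemma dominated_sum (I : finType) (u : I -> T -> V) w :
  (forall k, dominated (u k) w) -> dominated (fun i => \sum_k u k i) w.
Proof.
move=> Hu; elim: (index_enum I) => [|k r IH].
  by exists 0 => // i _; rewrite big_nil normr0 mul0r.
have [C C0 HC] := dominatedD (Hu k) IH.
by exists C => // i Di; rewrite big_cons HC.
Qed.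

Lemma dominated_trans u w w' : dominated u w ->
  dominated (fun i => w i : R^o) w' -> dominated u w'.
Proof.
move=> [C C0 HC] [E E0 HE]; exists (C * E) => [|i Di]; first exact: mulr_ge0.
apply: le_trans (HC i Di) _; rewrite -mulrA ler_wpM2l//.
exact: le_trans (ler_norm _) (HE i Di).
Qed.

Lemma dominated_eq u v w : (forall i, D i -> v i = u i) ->
  dominated u w -> dominated v w.
Proof. by move=> uv [C C0 HC]; exists C => // i Di; rewrite uv// HC. Qed.

Lemma dominated_normr u w : dominated u w -> dominated (fun i => `|u i| : R^o) w.
Proof. by move=> [C C0 HC]; exists C => // i Di; rewrite normr_id HC. Qed.

Lemma dominated_norm u : dominated u (fun i => `|u i|).
Proof. by exists 1 => // i _; rewrite mul1r. Qed.
End OneSpace.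

Lemma dominatedZ (V : normedModType R) (a : T -> R^o) (u : T -> V) w w' :
  dominated a w -> dominated u w' -> dominated (fun i => a i *: u i) (fun i => w i * w' i).
Proof.
move=> [C C0 HC] [E E0 HE]; exists (C * E) => [|i Di]; first exact: mulr_ge0.
by rewrite normrZ mulrACA ler_pM ?HC ?HE.
Qed.

Lemma dominatedM (a b w w' : T -> R) :
  dominated (a : T -> R^o) w -> dominated (b : T -> R^o) w' ->
  dominated (fun i => a i * b i : R^o) (fun i => w i * w' i).
Proof. exact: dominatedZ. Qed.

Lemma dominated_le (a w : T -> R) : (forall i, D i -> 0 <= a i <= w i) ->
  dominated (a : T -> R^o) w.
Proof. by move=> H; exists 1 => // i /H/andP[a0 aw]; rewrite mul1r ger0_norm. Qed.
End Domination.

(** * Mean value estimates for vector fields *)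

Section VectorSmooth.
Context (R : realType) (n m : nat).
Implicit Types (g : 'cV[R]_n -> 'cV[R]_m) (a b c d : 'cV[R]_n).

Lemma vsmooth_bounded g r : vsmooth g ->
  exists2 C, 0 <= C & forall x, `|x| <= r -> `|g x| <= C.
Proof.
move=> sg.
have [C C0 HC] : exists2 C, 0 <= C & forall l x, `|x| <= r -> `|g x l 0| <= C.
  apply: uniform_bound => [i C D CD H x xr|l]; first exact: le_trans (H x xr) CD.
  by have [C _ HC] := smooth_bounded r (sg l); exists C.
by exists C => // x xr; apply: norm_col_le => // l; exact: HC.
Qed.

Lemma vsmooth_lipschitz g r : vsmooth g -> exists2 C, 0 <= C &
  forall a b, `|a| <= r -> `|b| <= r -> `|g a - g b| <= C * `|a - b|.
Proof.
move=> sg.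
have [C C0 HC] : exists2 C, 0 <= C & forall l a b, `|a| <= r -> `|b| <= r ->
    `|g a l 0 - g b l 0| <= C * `|a - b|.
  apply: uniform_bound => [i C D CD H a b ar br|l].
    by apply: le_trans (H a b ar br) _; rewrite ler_wpM2r.
  by have [C _ HC] := smooth_lipschitz r (sg l); exists C.
exists C => // a b ar br; apply: norm_col_le => [|l]; first exact: mulr_ge0.
by rewrite !mxE; exact: HC.
Qed.

Lemma vsmooth_lipschitz2 g r : vsmooth g -> exists2 C, 0 <= C &
  forall a b c d, `|a| <= r -> `|b| <= r -> `|c| <= r -> `|d| <= r ->
  `|(g a - g b) - (g c - g d)| <=
    C * (`|(a - b) - (c - d)| + `|b - d| * `|a - b|).
Proof.
move=> sg.
have pos a b c d : 0 <= `|(a - b) - (c - d)| + `|b - d| * `|a - b|.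
  by rewrite addr_ge0// mulr_ge0.
have [C C0 HC] : exists2 C, 0 <= C & forall l a b c d, `|a| <= r -> `|b| <= r ->
    `|c| <= r -> `|d| <= r -> `|(g a l 0 - g b l 0) - (g c l 0 - g d l 0)| <=
    C * (`|(a - b) - (c - d)| + `|b - d| * `|a - b|).
  apply: uniform_bound => [i C D CD H a b c d ar br cr dr|l].
    by apply: le_trans (H a b c d ar br cr dr) _; rewrite ler_wpM2r.
  by have [C _ HC] := smooth_lipschitz2 r (sg l); exists C.
exists C => // a b c d ar br cr dr; apply: norm_col_le => [|l]; first exact: mulr_ge0.
by rewrite !mxE; exact: HC.
Qed.

Definition vtaylor g b a := g a - g b - jac g b *m (a - b).

Lemma vsmooth_taylor g r : vsmooth g -> exists2 C, 0 <= C &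
  forall a b c d, `|a| <= r -> `|b| <= r -> `|c| <= r -> `|d| <= r ->
  `|vtaylor g b a - vtaylor g d c| <=
    C * (`|b - d| * `|a - b| ^+ 2 + `|(a - b) - (c - d)| * (`|a - b| + `|c - d|)).
Proof.
move=> sg.
have pos a b c d : 0 <= `|b - d| * `|a - b| ^+ 2 + `|(a - b) - (c - d)| * (`|a - b| + `|c - d|).
  by rewrite addr_ge0// mulr_ge0// ?addr_ge0// exprn_ge0.
have [C C0 HC] : exists2 C, 0 <= C & forall l a b c d, `|a| <= r -> `|b| <= r ->
    `|c| <= r -> `|d| <= r ->
    `|taylor1 (fun x => g x l 0) b a - taylor1 (fun x => g x l 0) d c| <=
    C * (`|b - d| * `|a - b| ^+ 2 + `|(a - b) - (c - d)| * (`|a - b| + `|c - d|)).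
  apply: uniform_bound => [i C D CD H a b c d ar br cr dr|l].
    by apply: le_trans (H a b c d ar br cr dr) _; rewrite ler_wpM2r.
  by have [C _ HC] := smooth_taylor r (sg l); exists C.
exists C => // a b c d ar br cr dr; apply: norm_col_le => [|l]; first exact: mulr_ge0.
have E x y : vtaylor g x y l 0 = taylor1 (fun x => g x l 0) x y.
  by rewrite /vtaylor /taylor1 -jac_mul_entry// [LHS]mxE [X in X + _ = _]mxE [X in _ + X = _]mxE [X in _ + X + _ = _]mxE.
by rewrite [X in `|X|]mxE [X in _ + X]mxE !E; exact: HC.
Qed.
End VectorSmooth.

(** * The defect of one step against two *)

Lemma big_option (R : nmodType) (I : finType) (F : option I -> R) :
  \sum_i F i = F None + \sum_i F (Some i).
Proof.
rewrite (bigD1 None)//=; congr (_ + _).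
rewrite (reindex_omap Some id); last by case.
by apply: eq_bigl => i; rewrite eqxx.
Qed.

Lemma vsmooth_jac_mul (R : realType) n (g h : 'cV[R]_n -> 'cV[R]_n) :
  vsmooth g -> vsmooth h -> vsmooth (fun x => jac g x *m h x).
Proof.
move=> sg sh l; rewrite (_ : (fun x => _) =
  fun x => \sum_i partial (fun y => g y l 0) i x * h x i 0); last first.
  by apply/funext => x; rewrite mxE; apply: eq_bigr => i _; rewrite mxE.
by apply: smooth_sum => i; apply: smoothM; [exact/smooth_partial|exact: sh].
Qed.

Section Defect.
Context (R : realType) (N K : nat) (alpha t0 t1 : R).
Context (Z : R -> 'cV[R]_K) (ZZ : R -> R -> 'M[R]_K).
Context (f : 'cV[R]_N -> 'cV[R]_N) (sigma : 'cV[R]_N -> 'M[R]_(N, K)).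
Hypothesis halpha : 3^-1 < alpha <= 2^-1.
Hypothesis ht : t0 <= t1.
Hypothesis hZ : geometric_rough_path alpha t0 t1 Z ZZ.
Hypothesis sf : smooth_on setT f.
Hypothesis ssigma : smooth_on setT sigma.
Implicit Types (x y : 'cV[R]_N) (i : option ('I_K * 'I_K)).

Local Notation sg := (sigma_col sigma).
Local Notation step := (state_step Z ZZ f sigma).

Let al0 : 0 <= alpha. Proof. by case/andP: halpha; lra. Qed.
Let al20 : 0 <= 2 * alpha. Proof. by move: al0; lra. Qed.
Let al30 : 0 <= 3 * alpha. Proof. by move: al0; lra. Qed.
Let al2 : 2 * alpha <= 1. Proof. by case/andP: halpha; lra. Qed.

(** Time and the second level of the rough path have the same order 2 alpha and
    enter all estimates alike, so they are indexed by one finite type. *)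
Definition coef2 i s t : R :=
  if i is Some kj then ZZ s t kj.1 kj.2 else t - s.

Definition field2 i x : 'cV[R]_N :=
  if i is Some kj then jac (sg kj.2) x *m sg kj.1 x else f x.

Lemma state_stepE s t x : step s t x =
  \sum_j (Z t - Z s) j 0 *: sg j x + \sum_i coef2 i s t *: field2 i x.
Proof.
rewrite /state_step big_option /= -addrA addrCA; congr (_ + (_ + _)).
by rewrite pair_bigA.
Qed.

Lemma vsmooth_field2 i : vsmooth (field2 i).
Proof.
case: i => [[k j]|]; first by apply: vsmooth_jac_mul; exact: vsmooth_sigma_col.
by move=> l; exact: smooth_entry.
Qed.

Definition step_defect s u t x y := step s u x + step u t y - step s t x.

(** The exact form of the defect.  The point x + step s u x, where the scheme
    would arrive, separates the error made by the path itself (the first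
    difference, small because y is close to that point) from the Taylor
    remainder of the vector fields. *)
Lemma step_defectE s u t x y : t0 <= s -> s <= u -> u <= t -> t <= t1 ->
  step_defect s u t x y =
  \sum_j (Z t - Z u) j 0 *: ((sg j y - sg j (x + step s u x)) +
     vtaylor (sg j) x (x + step s u x) +
     \sum_i coef2 i s u *: (jac (sg j) x *m field2 i x)) +
  \sum_i coef2 i u t *: (field2 i y - field2 i x).
Proof.
move=> h1 h2 h3 h4; have [_ _ chen _] := hZ.
rewrite /step_defect.
set xh := x + step s u x.
have E1 j : (sg j y - sg j xh) + vtaylor (sg j) x xh +
     \sum_i coef2 i s u *: (jac (sg j) x *m field2 i x) =
    sg j y - sg j x - \sum_k (Z u - Z s) k 0 *: field2 (Some (k, j)) x.
  have Exh : xh - x = \sum_j (Z u - Z s) j 0 *: sg j x + \sum_i coef2 i s u *: field2 i x.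
    by rewrite /xh addrC addKr state_stepE.
  rewrite /vtaylor Exh mulmxDr !mulmx_sumr.
  under [X in _ - (X + _)]eq_bigr do rewrite -scalemxAr.
  under [X in _ - (_ + X)]eq_bigr do rewrite -scalemxAr.
  rewrite -[X in _ - (X + _)]/(\sum_k (Z u - Z s) k 0 *: field2 (Some (k, j)) x).
  move: (\sum_k _) (\sum_i _) => d e; move: (sg j y) (sg j x) (sg j xh) => a b c.
  by apply/matrixP => p q; rewrite !mxE; ring.
under [X in _ = X + _]eq_bigr do rewrite E1 !scalerBr.
under [X in _ = _ + X]eq_bigr do rewrite scalerBr.
rewrite !sumrB !state_stepE.
have -> : \sum_j (Z t - Z s) j 0 *: sg j x =
   \sum_j (Z u - Z s) j 0 *: sg j x + \sum_j (Z t - Z u) j 0 *: sg j x.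
  rewrite -big_split; apply: eq_bigr => j _ /=; rewrite -scalerDl; congr (_ *: _).
  by rewrite !mxE; ring.
have -> : \sum_i coef2 i s t *: field2 i x =
   \sum_i coef2 i s u *: field2 i x + \sum_i coef2 i u t *: field2 i x +
   \sum_j (Z t - Z u) j 0 *: (\sum_k (Z u - Z s) k 0 *: field2 (Some (k, j)) x).
  rewrite !big_option /=.
  have -> : \sum_j (Z t - Z u) j 0 *: (\sum_k (Z u - Z s) k 0 *: (jac (sg j) x *m sg k x)) =
      \sum_(kj : 'I_K * 'I_K) ((Z u - Z s) kj.1 0 * (Z t - Z u) kj.2 0) *: (jac (sg kj.2) x *m sg kj.1 x).
    rewrite -(pair_bigA _ (fun k j => ((Z u - Z s) k 0 * (Z t - Z u) j 0) *: (jac (sg j) x *m sg k x))) exchange_big /=.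
    apply: eq_bigr => j _; rewrite scaler_sumr; apply: eq_bigr => k _.
    by rewrite scalerA mulrC.
  rewrite [X in _ = X + _]addrACA -[RHS]addrA -scalerDl -!big_split /=.
  congr (_ *: _ + _); first by ring.
  apply: eq_bigr => -[k j] _ /=; rewrite -!scalerDl; congr (_ *: _).
  by rewrite (chen s u t)// !mxE big_ord1 !mxE; ring.
move: (\sum_j (Z u - Z s) j 0 *: sg j x) => a1.
move: (\sum_j (Z t - Z u) j 0 *: sg j x) => a2.
move: (\sum_j (Z t - Z u) j 0 *: sg j y) => a3.
move: (\sum_j (Z t - Z u) j 0 *: _) => a4.
move: (\sum_i _) (\sum_i _) (\sum_i _) => b1 b2 b3.
by apply/matrixP => p q; rewrite !mxE; ring.
Qed.
End Defect.

(** * Lipschitz dependence of the defect *)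

Section DefectBound.
Context (R : realType) (N K : nat) (alpha t0 t1 : R).
Context (Z : R -> 'cV[R]_K) (ZZ : R -> R -> 'M[R]_K).
Context (f : 'cV[R]_N -> 'cV[R]_N) (sigma : 'cV[R]_N -> 'M[R]_(N, K)).
Hypothesis halpha : 3^-1 < alpha <= 2^-1.
Hypothesis ht : t0 <= t1.
Hypothesis hZ : geometric_rough_path alpha t0 t1 Z ZZ.
Hypothesis sf : smooth_on setT f.
Hypothesis ssigma : smooth_on setT sigma.
Implicit Types (i : option ('I_K * 'I_K)).

Local Notation sg := (sigma_col sigma).
Local Notation step := (state_step Z ZZ f sigma).
Local Notation defect := (step_defect Z ZZ f sigma).

Let al0 : 0 <= alpha. Proof. by case/andP: halpha; lra. Qed.
Let al20 : 0 <= 2 * alpha. Proof. by move: al0; lra. Qed.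
Let al30 : 0 <= 3 * alpha. Proof. by move: al0; lra. Qed.
Let al2 : 2 * alpha <= 1. Proof. by case/andP: halpha; lra. Qed.

Lemma coef2_holder i : holder2 t0 t1 (2 * alpha) (fun s t => coef2 ZZ i s t : R^o).
Proof.
case: i => [[k j]|] /=; first exact: rough_second_holder hZ k j.
apply: (holder2_le ht al20 al2); exists 1 => s t h1 h2 h3.
by rewrite mul1r powRr1 ?subr_ge0// ger0_norm ?subr_ge0.
Qed.

Let point : Type := (R * R * 'cV[R]_N * 'cV[R]_N)%type.

Let in_ball r (c : point) :=
  let: (s, t, x, y) := c in [/\ t0 <= s, s <= t, t <= t1, `|x| <= r & `|y| <= r].

Let width (c : point) : R := let: (s, t, _, _) := c in t - s.

Let increment_dom r j : dominated (in_ball r)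
  (fun c : point => let: (s, t, _, _) := c in (Z t - Z s) j 0 : R^o)
  (fun c => width c `^ alpha).
Proof.
have [C C0 HC] := holder2_ge0 (rough_increment_holder hZ j).
by exists C => // -[[[s t] x] y] [h1 h2 h3 _ _]; exact: HC.
Qed.

Let coef2_dom r i : dominated (in_ball r)
  (fun c : point => let: (s, t, _, _) := c in coef2 ZZ i s t : R^o)
  (fun c => width c `^ alpha).
Proof.
have al12 : alpha <= 2 * alpha by move: al0; lra.
have [C C0 HC] := holder2_ge0 (holder2_le ht al0 al12 (coef2_holder i)).
by exists C => // -[[[s t] x] y] [h1 h2 h3 _ _]; exact: HC.
Qed.

Lemma step_bounded r : exists2 C, 0 <= C & forall s t x,
  t0 <= s -> s <= t -> t <= t1 -> `|x| <= r -> `|step s t x| <= C * (t - s) `^ alpha.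
Proof.
have vdom (g : 'cV[R]_N -> 'cV[R]_N) : vsmooth g ->
    dominated (in_ball r) (fun c : point => let: (_, _, x, _) := c in g x) (fun=> 1).
  move=> /(vsmooth_bounded r)[C C0 HC]; exists C => // -[[[s t] x] y] [_ _ _ xr _].
  by rewrite mulr1 HC.
have : dominated (in_ball r) (fun c : point => let: (s, t, x, _) := c in step s t x)
    (fun c => width c `^ alpha * 1).
  have := dominatedD
    (dominated_sum (fun j => dominatedZ (increment_dom r j) (vdom _ (vsmooth_sigma_col ssigma j))))
    (dominated_sum (fun i => dominatedZ (coef2_dom r i) (vdom _ (vsmooth_field2 sf ssigma i)))).
  by apply: dominated_eq => -[[[s t] x] y] _; rewrite state_stepE.
move=> [C C0 HC]; exists C => // s t x h1 h2 h3 xr.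
by have := HC (s, t, x, x) (And5 h1 h2 h3 xr xr); rewrite mulr1.
Qed.

Lemma step_lipschitz r : exists2 C, 0 <= C & forall s t x y,
  t0 <= s -> s <= t -> t <= t1 -> `|x| <= r -> `|y| <= r ->
  `|step s t x - step s t y| <= C * (`|x - y| * (t - s) `^ alpha).
Proof.
have vdom (g : 'cV[R]_N -> 'cV[R]_N) : vsmooth g ->
    dominated (in_ball r) (fun c : point => let: (_, _, x, y) := c in g x - g y)
     (fun c => let: (_, _, x, y) := c in `|x - y|).
  move=> /(vsmooth_lipschitz r)[C C0 HC]; exists C => // -[[[s t] x] y] [_ _ _ xr yr].
  by rewrite HC.
have : dominated (in_ball r) (fun c : point => let: (s, t, x, y) := c in step s t x - step s t y)
    (fun c => width c `^ alpha * let: (_, _, x, y) := c in `|x - y|).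
  have := dominatedD
    (dominated_sum (fun j => dominatedZ (increment_dom r j) (vdom _ (vsmooth_sigma_col ssigma j))))
    (dominated_sum (fun i => dominatedZ (coef2_dom r i) (vdom _ (vsmooth_field2 sf ssigma i)))).
  apply: dominated_eq => -[[[s t] x] y] _; rewrite !state_stepE opprD addrACA -!sumrB.
  by congr (_ + _); apply: eq_bigr => k _; rewrite scalerBr.
move=> [C C0 HC]; exists C => // s t x y h1 h2 h3 xr yr.
by have := HC (s, t, x, y) (And5 h1 h2 h3 xr yr); rewrite [_ * `|x - y|]mulrC.
Qed.

(** The data of two trajectories at times ts <= tu: (tx, ty) and (tx', ty') are
    the positions of the first and of the second one, and tt is a later time. *)
Record two_steps := TwoSteps {
  ts : R; tu : R; tt : R;
  tx : 'cV[R]_N; ty : 'cV[R]_N; tx' : 'cV[R]_N; ty' : 'cV[R]_N }.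

(** Only the first trajectory has a controlled remainder; about the second one
    nothing is assumed beyond staying in the ball. *)
Definition admissible r Cr (c : two_steps) : Prop :=
  [/\ [/\ t0 <= ts c, ts c <= tu c, tu c <= tt c & tt c <= t1],
      [/\ `|tx c| <= r, `|ty c| <= r, `|tx' c| <= r & `|ty' c| <= r] &
      `|ty c - (tx c + step (ts c) (tu c) (tx c))| <= Cr * (tu c - ts c) `^ (3 * alpha)].

Section Fixed.
Variables (r Cr : R).
Hypothesis Cr0 : 0 <= Cr.
Let D := admissible r Cr.
Let dom (V : normedModType R) u w := @dominated R two_steps D V u w.
Let w c := tt c - ts c.
Let e c := `|tx c - tx' c|.
Let hat c := tx c + step (ts c) (tu c) (tx c).
Let hat' c := tx' c + step (ts c) (tu c) (tx' c).
Let rho c := ty c - hat c.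
Let rho' c := ty' c - hat' c.

Let pow_dom be ga : 0 <= ga -> ga <= be ->
  dom (fun c => w c `^ be : R^o) (fun c => w c `^ ga).
Proof.
move=> ga0 gabe.
have : holder2 t0 t1 be (fun s t => (t - s) `^ be : R^o).
  by exists 1 => s t *; rewrite mul1r ger0_norm// powR_ge0.
move=> /(holder2_le ht ga0 gabe)/holder2_ge0[C C0 HC]; exists C => // c [[h1 h2 h3 h4] _ _].
by apply: HC => //; exact: le_trans h3.
Qed.

Let left_dom (V : normedModType R) be (X : R -> R -> V) : 0 <= be -> holder2 t0 t1 be X ->
  dom (fun c => X (ts c) (tu c)) (fun c => w c `^ be).
Proof.
move=> be0 /holder2_ge0[C C0 HC]; exists C => // c [[h1 h2 h3 h4] _ _].
apply: le_trans (HC _ _ h1 h2 (le_trans h3 h4)) _; rewrite ler_wpM2l// ge0_ler_powR// ?nnegrE.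
- by rewrite subr_ge0.
- by rewrite subr_ge0 (le_trans h2).
- by rewrite lerB.
Qed.

Let right_dom (V : normedModType R) be (X : R -> R -> V) : 0 <= be -> holder2 t0 t1 be X ->
  dom (fun c => X (tu c) (tt c)) (fun c => w c `^ be).
Proof.
move=> be0 /holder2_ge0[C C0 HC]; exists C => // c [[h1 h2 h3 h4] _ _].
apply: le_trans (HC _ _ (le_trans h1 h2) h3 h4) _; rewrite ler_wpM2l// ge0_ler_powR// ?nnegrE.
- by rewrite subr_ge0.
- by rewrite subr_ge0 (le_trans h2).
- by rewrite lerB.
Qed.

Let pow_dom1 be : 0 <= be -> dom (fun c => w c `^ be : R^o) (fun=> 1).
Proof.
move=> be0; apply: dominated_trans (pow_dom (lexx 0) be0) _.
by apply: dominated_le => c _; rewrite powRr0 ler01 lexx.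
Qed.

Let powM c be ga : 0 < be -> 0 <= ga -> w c `^ be * w c `^ ga = w c `^ (be + ga).
Proof. by move=> be0 ga0; rewrite powRD// gt_eqF// ltr_wpDr. Qed.

Let e_ge0 c : 0 <= e c. Proof. exact: normr_ge0. Qed.

Let e_dom : dom (fun c => tx c - tx' c) e. Proof. exact: dominated_norm. Qed.

Let step_dom : dom (fun c => step (ts c) (tu c) (tx c)) (fun c => w c `^ alpha).
Proof.
have [C C0 HC] := step_bounded r.
exists C => // c [[h1 h2 h3 h4] [xr _ _ _] _].
apply: le_trans (HC _ _ _ h1 h2 (le_trans h3 h4) xr) _; rewrite ler_wpM2l//.
rewrite ge0_ler_powR ?nnegrE ?subr_ge0 ?(le_trans h2)//.
exact: lerB.
Qed.

Let step_dom' : dom (fun c => step (ts c) (tu c) (tx' c)) (fun c => w c `^ alpha).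
Proof.
have [C C0 HC] := step_bounded r.
exists C => // c [[h1 h2 h3 h4] [_ _ xr _] _].
apply: le_trans (HC _ _ _ h1 h2 (le_trans h3 h4) xr) _; rewrite ler_wpM2l//.
rewrite ge0_ler_powR ?nnegrE ?subr_ge0 ?(le_trans h2)//.
exact: lerB.
Qed.

Let step_diff_dom : dom (fun c => step (ts c) (tu c) (tx c) - step (ts c) (tu c) (tx' c))
  (fun c => e c * w c `^ alpha).
Proof.
have [C C0 HC] := step_lipschitz r.
exists C => // c [[h1 h2 h3 h4] [xr _ xr' _] _].
apply: le_trans (HC _ _ _ _ h1 h2 (le_trans h3 h4) xr xr') _; rewrite ler_wpM2l// ler_wpM2l//.
rewrite ge0_ler_powR ?nnegrE ?subr_ge0 ?(le_trans h2)//.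
exact: lerB.
Qed.

Let rho_dom : dom rho (fun c => w c `^ (2 * alpha)).
Proof.
have al23 : 2 * alpha <= 3 * alpha by move: al0; lra.
apply: dominated_trans (pow_dom al20 al23).
exists Cr => // c [[h1 h2 h3 h4] _ H]; apply: le_trans H _; rewrite ler_wpM2l//.
rewrite ge0_ler_powR ?nnegrE ?subr_ge0 ?(le_trans h2)//.
exact: lerB.
Qed.

Let hat_diff_dom : dom (fun c => hat c - hat' c) e.
Proof.
have H : dom (fun c => e c * w c `^ alpha : R^o) e.
  have := dominatedM (dominated_normr e_dom) (pow_dom1 al0).
  move=> /dominated_trans; apply.
  by apply: dominated_le => c _; rewrite mulr1 normr_ge0 lexx.
apply: dominated_eq (dominatedD e_dom (dominated_trans step_diff_dom H)) => c _.
by rewrite /hat /hat' opprD addrACA.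
Qed.

Let W1 c := e c * w c `^ (2 * alpha) + `|rho c - rho' c|.

Let e_W1 : dom (fun c => e c * w c `^ (2 * alpha) : R^o) W1.
Proof.
by apply: dominated_le => c _; rewrite mulr_ge0 ?e_ge0 ?powR_ge0//= /W1 lerDl.
Qed.

Let rho_W1 : dom (fun c => `|rho c - rho' c| : R^o) W1.
Proof.
by apply: dominated_le => c _; rewrite normr_ge0/= /W1 lerDr mulr_ge0 ?e_ge0 ?powR_ge0.
Qed.

Let larger_ball : exists2 r', r <= r' & forall c, D c -> `|hat c| <= r' /\ `|hat' c| <= r'.
Proof.
have [C C0 HC] := step_dom; have [C' C0' HC'] := step_dom'.
have [B B0 HB] := pow_dom1 al0.
exists (r + (C + C') * B); first by rewrite lerDl mulr_ge0// addr_ge0.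
move=> c Dc; have := HC c Dc; have := HC' c Dc; have := HB c Dc.
rewrite ger0_norm ?powR_ge0// mulr1 => wB H' H.
have [_ [xr _ xr' _] _] := Dc.
have w0 := powR_ge0 (w c) alpha.
split; apply: le_trans (ler_normD _ _) _; apply: lerD => //.
  by apply: le_trans H _; nra.
by apply: le_trans H' _; nra.
Qed.

Let field_term j : dom (fun c => (sg j (ty c) - sg j (hat c)) - (sg j (ty' c) - sg j (hat' c))) W1.
Proof.
have [r' rr' Hr'] := larger_ball.
have [C C0 HC] := vsmooth_lipschitz2 r' (vsmooth_sigma_col ssigma j).
have H1 : dom (fun c => (sg j (ty c) - sg j (hat c)) - (sg j (ty' c) - sg j (hat' c)))
   (fun c => `|rho c - rho' c| + `|hat c - hat' c| * `|rho c|).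
  exists C => // c Dc; have [hr hr'] := Hr' c Dc; have [_ [_ yr _ yr'] _] := Dc.
  by apply: HC => //; exact: le_trans rr'.
apply: dominated_trans H1 _; apply: dominatedD rho_W1 _.
have := dominatedM (dominated_normr hat_diff_dom) (dominated_normr rho_dom).
by move=> /dominated_trans; apply.
Qed.

Let taylor_term j : dom (fun c => vtaylor (sg j) (tx c) (hat c) - vtaylor (sg j) (tx' c) (hat' c)) W1.
Proof.
have [r' rr' Hr'] := larger_ball.
have [C C0 HC] := vsmooth_taylor r' (vsmooth_sigma_col ssigma j).
pose st c := step (ts c) (tu c) (tx c); pose st' c := step (ts c) (tu c) (tx' c).
have H1 : dom (fun c => vtaylor (sg j) (tx c) (hat c) - vtaylor (sg j) (tx' c) (hat' c))
   (fun c => e c * (`|st c| * `|st c|) + `|st c - st' c| * (`|st c| + `|st' c|)).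
  exists C => // c Dc; have [hr hr'] := Hr' c Dc; have [_ [xr _ xr' _] _] := Dc.
  have E1 : hat c - tx c = st c by rewrite /hat addrC addKr.
  have E2 : hat' c - tx' c = st' c by rewrite /hat' addrC addKr.
  have := HC _ _ _ _ hr (le_trans xr rr') hr' (le_trans xr' rr').
  by rewrite E1 E2 expr2.
apply: dominated_trans H1 _; apply: dominated_trans e_W1.
have al1 : 0 < alpha by case/andP: halpha; lra.
have ww c : w c `^ alpha * w c `^ alpha = w c `^ (2 * alpha).
  by rewrite powM//; congr (_ `^ _); ring.
apply: dominatedD.
  have := dominatedM (dominated_normr e_dom) (dominatedM (dominated_normr step_dom) (dominated_normr step_dom)).
  move=> /dominated_trans; apply; apply: dominated_le => c _.
  by rewrite ww lexx mulr_ge0 ?e_ge0 ?powR_ge0//.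
have := dominatedM (dominated_normr step_diff_dom)
  (dominatedD (dominated_normr step_dom) (dominated_normr step_dom')).
move=> /dominated_trans; apply; apply: dominated_le => c _.
by rewrite -mulrA ww lexx mulr_ge0 ?e_ge0 ?powR_ge0//.
Qed.

Let second_term j : dom (fun c =>
  \sum_i coef2 ZZ i (ts c) (tu c) *: (jac (sg j) (tx c) *m field2 f sigma i (tx c)) -
  \sum_i coef2 ZZ i (ts c) (tu c) *: (jac (sg j) (tx' c) *m field2 f sigma i (tx' c))) W1.
Proof.
apply: dominated_trans e_W1.
pose L i x := jac (sg j) x *m field2 f sigma i x.
have HL i : dom (fun c => L i (tx c) - L i (tx' c)) e.
  have vL : vsmooth (L i).
    by apply: vsmooth_jac_mul; [exact: vsmooth_sigma_col|exact: vsmooth_field2].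
  have [C C0 HC] := vsmooth_lipschitz r vL.
  by exists C => // c [_ [xr _ xr' _] _]; exact: HC.
have := dominated_sum (fun i => dominatedZ (left_dom al20 (coef2_holder i)) (HL i)).
move=> H; apply: (@dominated_trans _ _ _ _ _ (fun c => w c `^ (2 * alpha) * e c)).
  by apply: dominated_eq H => c _; rewrite -sumrB; apply: eq_bigr => i _; rewrite scalerBr.
by apply: dominated_le => c _; rewrite mulrC lexx mulr_ge0 ?e_ge0 ?powR_ge0//.
Qed.

Let drift_term i : dom (fun c => (field2 f sigma i (ty c) - field2 f sigma i (tx c)) -
   (field2 f sigma i (ty' c) - field2 f sigma i (tx' c)))
   (fun c => e c * w c `^ alpha + `|rho c - rho' c|).
Proof.
have [C C0 HC] := vsmooth_lipschitz2 r (vsmooth_field2 sf ssigma i).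
pose st c := step (ts c) (tu c) (tx c); pose st' c := step (ts c) (tu c) (tx' c).
pose W2 c := e c * w c `^ alpha + `|rho c - rho' c|.
have E c : ty c - tx c = st c + rho c.
  rewrite /rho /hat /st; move: (step _ _ _) => z.
  by rewrite [RHS]addrC opprD addrA subrK.
have E' c : ty' c - tx' c = st' c + rho' c.
  rewrite /rho' /hat' /st'; move: (step _ _ _) => z.
  by rewrite [RHS]addrC opprD addrA subrK.
have e_W2 : dom (fun c => e c * w c `^ alpha : R^o) W2.
  by apply: dominated_le => c _; rewrite mulr_ge0 ?e_ge0 ?powR_ge0//= /W2 lerDl.
have rho_W2 : dom (fun c => rho c - rho' c) W2.
  exists 1 => // c _; rewrite mul1r /W2 lerDr mulr_ge0 ?e_ge0 ?powR_ge0//.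
have H1 : dom (fun c => (field2 f sigma i (ty c) - field2 f sigma i (tx c)) -
   (field2 f sigma i (ty' c) - field2 f sigma i (tx' c)))
   (fun c => `|(st c - st' c) + (rho c - rho' c)| + e c * `|st c + rho c|).
  exists C => // c [_ [xr yr xr' yr'] _].
  have E2 : (st c - st' c) + (rho c - rho' c) = (st c + rho c) - (st' c + rho' c).
    by move: (st c) (st' c) (rho c) (rho' c) => a b p q; rewrite opprD addrACA.
  by have := HC _ _ _ _ yr xr yr' xr'; rewrite E2 E E'.
apply: dominated_trans H1 _; apply: dominatedD.
  exact: dominated_normr (dominatedD (dominated_trans step_diff_dom e_W2) rho_W2).
apply: dominated_trans e_W2.
have al12 : alpha <= 2 * alpha by move: al0; lra.
have := dominatedM (dominated_normr e_dom)
  (dominated_normr (dominatedD step_dom (dominated_trans rho_dom (pow_dom al0 al12)))).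
move=> /dominated_trans; apply; apply: dominated_le => c _.
by rewrite lexx mulr_ge0 ?e_ge0 ?powR_ge0//.
Qed.

(** The bound is linear in the distance of the starting points and in the
    difference of the remainders, and the latter comes with an additional power
    of the width; on short intervals this makes it a contraction. *)
Lemma step_defect_difference : dom
  (fun c => defect (ts c) (tu c) (tt c) (tx c) (ty c) -
            defect (ts c) (tu c) (tt c) (tx' c) (ty' c))
  (fun c => e c * w c `^ (3 * alpha) + `|rho c - rho' c| * w c `^ alpha).
Proof.
have al1 : 0 < alpha by case/andP: halpha; lra.
have ww c : w c `^ alpha * w c `^ (2 * alpha) = w c `^ (3 * alpha).
  by rewrite powM//; congr (_ `^ _); ring.
have H1 := dominated_sum (fun j => dominatedZ (right_dom al0 (rough_increment_holder hZ j))
   (dominatedD (dominatedD (field_term j) (taylor_term j)) (second_term j))).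
have H2 := dominated_sum (fun i => dominatedZ (right_dom al20 (coef2_holder i)) (drift_term i)).
pose W c := e c * w c `^ (3 * alpha) + `|rho c - rho' c| * w c `^ alpha.
have {}H1 := dominated_trans H1 (_ : dominated D (fun c => w c `^ alpha * W1 c : R^o) W).
have {}H2 := dominated_trans H2 (_ : dominated D (fun c => w c `^ (2 * alpha) * (e c * w c `^ alpha + `|rho c - rho' c|) : R^o) W).
have W0 c : 0 <= W c by rewrite addr_ge0// mulr_ge0 ?e_ge0 ?powR_ge0//.
apply: dominated_eq (dominatedD (H1 _) (H2 _)).
- move=> c [[h1 h2 h3 h4] _ _]; rewrite !(step_defectE _ _ hZ)//.
  rewrite opprD addrACA -!sumrB; congr (_ + _); apply: eq_bigr => j _; rewrite -scalerBr; last by [].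
  by congr (_ *: _); rewrite opprD addrACA; congr (_ + _); rewrite opprD addrACA.
- apply: dominated_le => c _; rewrite mulr_ge0 ?powR_ge0 ?addr_ge0 ?mulr_ge0 ?e_ge0 ?powR_ge0//=.
  by rewrite /W1 mulrDr mulrCA ww /W lerD2l mulrC.
- have al12 : alpha <= 2 * alpha by move: al0; lra.
  have HH : dom (fun c => e c * w c `^ (3 * alpha) : R^o) W.
    by apply: dominated_le => c _; rewrite mulr_ge0 ?e_ge0 ?powR_ge0//= /W lerDl mulr_ge0 ?e_ge0 ?powR_ge0//.
  have HR : dom (fun c => `|rho c - rho' c| * w c `^ (2 * alpha) : R^o) W.
    have := dominatedM (dominated_normr (@dominated_norm _ _ D _ (fun c => rho c - rho' c))) (pow_dom al0 al12).
    move=> /dominated_trans; apply.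
    by apply: dominated_le => c _; rewrite mulr_ge0 ?e_ge0 ?powR_ge0//= /W lerDr mulr_ge0 ?e_ge0 ?powR_ge0//.
  apply: dominated_eq (dominatedD HH HR) => c _.
  by rewrite mulrDr mulrCA [w c `^ (2 * alpha) * w c `^ alpha]mulrC ww [`|_| * _]mulrC.
Qed.
End Fixed.
End DefectBound.

(** * Stability of solutions *)

Lemma powR_small (R : realType) (be eps : R) : 0 < be -> 0 < eps ->
  exists2 h, 0 < h & forall z, 0 <= z -> z <= h -> z `^ be <= eps.
Proof.
move=> be0 eps0; exists (eps `^ be^-1); first exact: powR_gt0.
move=> z z0 zh; have -> : eps = (eps `^ be^-1) `^ be.
  by rewrite -powRrM mulVf ?powRr1 ?gt_eqF// ltW.
by rewrite ge0_ler_powR ?nnegrE ?powR_ge0// ltW.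
Qed.

Section Stability.
Context (R : realType) (N K : nat) (alpha t0 t1 : R).
Context (Z : R -> 'cV[R]_K) (ZZ : R -> R -> 'M[R]_K).
Context (f : 'cV[R]_N -> 'cV[R]_N) (sigma : 'cV[R]_N -> 'M[R]_(N, K)).
Hypothesis halpha : 3^-1 < alpha <= 2^-1.
Hypothesis ht : t0 <= t1.
Hypothesis hZ : geometric_rough_path alpha t0 t1 Z ZZ.
Hypothesis sf : smooth_on setT f.
Hypothesis ssigma : smooth_on setT sigma.
Implicit Types (x y : R -> 'cV[R]_N).

Local Notation step := (state_step Z ZZ f sigma).
Local Notation defect := (step_defect Z ZZ f sigma).

Let al0 : 0 < alpha. Proof. by case/andP: halpha; lra. Qed.
Let al3 : 1 < 3 * alpha. Proof. by case/andP: halpha; lra. Qed.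
Let al30 : 0 < 3 * alpha. Proof. by move: al3; lra. Qed.

Definition remainder x s t := x t - x s - step s t (x s).

Lemma remainderE x s t : remainder x s t = x t - (x s + step s t (x s)).
Proof. by rewrite /remainder; move: (step _ _ _) => c; rewrite opprD addrA. Qed.

Lemma remainder_split x s u t : remainder x s t =
  remainder x s u + remainder x u t + defect s u t (x s) (x u).
Proof.
rewrite /remainder /step_defect.
move: (step s t _) (step s u _) (step u t _) => a b c; move: (x s) (x u) (x t) => d e g.
by apply/matrixP => i j; rewrite !mxE; ring.
Qed.

(** Let P W say that x and y stay within W and that their remainders differ by at
    most ka * W * width^theta.  On an interval of length h, P W implies
    P (de + eta * W) with eta < 1: the remainder bound improves by cutting
    intervals in two halves, and the distance bound by summing one step from the
    left end.  The weight ka is large so that the distance contributes little to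
    the remainder bound, and h is small afterwards.  The constants do not depend
    on the constant Cy of the second path, which only starts the iteration. *)
Lemma local_stability r Cx : 0 <= Cx -> exists2 h, 0 < h & exists2 L, 1 <= L &
  forall a b x y, t0 <= a -> a <= b -> b <= t1 -> b - a <= h ->
  (forall s, a <= s -> s <= b -> `|x s| <= r /\ `|y s| <= r) ->
  (forall s t, a <= s -> s <= t -> t <= b ->
     `|remainder x s t| <= Cx * (t - s) `^ (3 * alpha)) ->
  (exists Cy, forall s t, a <= s -> s <= t -> t <= b ->
     `|remainder y s t| <= Cy * (t - s) `^ (3 * alpha)) ->
  forall s t, a <= s -> s <= t -> t <= b ->
    `|x s - y s| <= L * `|x a - y a| /\
    `|remainder x s t - remainder y s t| <= L * `|x a - y a| * (t - s) `^ (3 * alpha).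
Proof.
move=> Cx0.
have [C1 C10 HC1] := step_lipschitz halpha ht hZ sf ssigma r.
have [C2 C20 HC2] := @step_defect_difference _ _ _ _ _ _ _ _ _ _ halpha ht hZ sf ssigma r Cx Cx0.
pose C := C1 + C2 + 1; have C0 : 0 < C by rewrite /C; lra.
have C1C : C1 <= C by rewrite /C; lra.
have C2C : C2 <= C by rewrite /C; lra.
pose ro := halving (3 * alpha).
have ro0 : 0 <= ro by exact: halving_ge0.
have ro1 : ro < 1 by exact: halving_lt1.
(* A quarter of the gap to 1: two error terms of size eps leave the contraction
   factor eta = ro + 2 * eps. *)
pose eps := (1 - ro) / 4; have eps0 : 0 < eps by rewrite /eps; lra.
pose ka := C / eps; have ka0 : 0 < ka by rewrite divr_gt0.
have kaC : ka * eps = C by rewrite /ka divfK// gt_eqF.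
have [h1 h10 Hh1] := powR_small al0 (divr_gt0 eps0 C0).
have [h2 h20 Hh2] := powR_small al30 (divr_gt0 eps0 ka0).
exists (Num.min h1 h2); first by rewrite lt_min h10.
pose eta := (1 + ro) / 2; have eta01 : 0 <= eta < 1 by rewrite /eta; lra.
have eta1 : 0 < 1 - eta by case/andP: eta01; lra.
pose L := (1 + ka) / (1 - eta).
exists (1 + L); first by rewrite lerDl divr_ge0// ltW// addr_gt0.
move=> a b x y ta ab bt; rewrite le_min => /andP[abh1 abh2] ball remx [Cy remy].
set de := `|x a - y a|; have de0 : 0 <= de by exact: normr_ge0.
have wal s t : a <= s -> s <= t -> t <= b -> C * (t - s) `^ alpha <= eps.
  move=> as_ st tb; rewrite mulrC -ler_pdivlMr// Hh1 ?subr_ge0//; lra.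
have wth s t : a <= s -> s <= t -> t <= b -> ka * (t - s) `^ (3 * alpha) <= eps.
  move=> as_ st tb; rewrite mulrC -ler_pdivlMr// Hh2 ?subr_ge0//; lra.
pose P W := forall s t, a <= s -> s <= t -> t <= b -> `|x s - y s| <= W /\
    `|remainder x s t - remainder y s t| <= ka * W * (t - s) `^ (3 * alpha).
have Pup W W' : W <= W' -> P W -> P W'.
  move=> WW' PW s t as_ st tb; have [p1 p2] := PW s t as_ st tb; split.
    exact: le_trans WW'.
  by apply: le_trans p2 _; rewrite ler_wpM2r ?powR_ge0// ler_wpM2l// ltW.
have Pit W : 0 <= W -> P W -> P (de + eta * W).
  move=> W0 PW s t as_ st tb.
  have sb : s <= b by exact: le_trans tb.
  have at_ : a <= t by exact: le_trans st.
  have [dxa _] := PW a a (lexx _) (lexx _) ab.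
  split.
    have [_ p2] := PW a s (lexx _) as_ sb.
    have [xa ya] := ball a (lexx _) ab.
    have p1 := HC1 a s (x a) (y a) ta as_ (le_trans sb bt) xa ya.
    have -> : x s - y s = (x a - y a) + (step a s (x a) - step a s (y a)) +
        (remainder x a s - remainder y a s).
      rewrite /remainder; move: (step _ _ (x a)) (step _ _ (y a)) => c1 c2; move: (x s) (x a) (y s) (y a) => c3 c4 c5 c6.
      by apply/matrixP => i j; rewrite !mxE; ring.
    rewrite (le_trans (ler_normD _ _))// (le_trans (lerD (ler_normD _ _) (lexx _)))//.
    rewrite -addrA lerD2l (le_trans (lerD p1 p2))//.
    have q1 := wal a s (lexx _) as_ sb; have q2 := wth a s (lexx _) as_ sb.
    apply: (@le_trans _ _ (C * (s - a) `^ alpha * W + ka * (s - a) `^ (3 * alpha) * W)).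
      apply: lerD; last by rewrite le_eqVlt; apply/orP; left; apply/eqP; ring.
      have pp := powR_ge0 (s - a) alpha.
      apply: (@le_trans _ _ (C1 * (W * (s - a) `^ alpha))).
        by rewrite ler_wpM2l// ler_wpM2r.
      by rewrite [W * _]mulrC mulrA ler_wpM2r// ler_wpM2r.
    rewrite -mulrDl ler_wpM2r//; move: q1 q2; rewrite /eta /eps; lra.
  pose m := (s + t) / 2.
  have sm : s <= m by rewrite /m; lra.
  have mt : m <= t by rewrite /m; lra.
  have am : a <= m by exact: le_trans sm.
  have mb : m <= b by exact: le_trans tb.
  have [dxs p1] := PW s m as_ sm mb; have [_ p2] := PW m t am mt tb.
  have [xs ys] := ball s as_ sb; have [xm ym] := ball m am mb.
  have adm : @admissible R N K alpha t0 t1 Z ZZ f sigma r Cx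
      (TwoSteps s m t (x s) (x m) (y s) (y m)).
    split=> /=; [split=> // | by split |].
    - exact: le_trans as_.
    - exact: le_trans bt.
    by rewrite -remainderE; exact: remx.
  have := HC2 _ adm => /= p3.
  rewrite (remainder_split x s m t) (remainder_split y s m t).
  rewrite [X in `|X|](_ : _ = (remainder x s m - remainder y s m) +
    (remainder x m t - remainder y m t) +
    (defect s m t (x s) (x m) - defect s m t (y s) (y m))); last first.
    move: (remainder x s m) (remainder y s m) (remainder x m t) (remainder y m t) (defect _ _ _ _ _) (defect _ _ _ _ _) => c1 c2 c3 c4 c5 c6.
    by apply/matrixP => i j; rewrite !mxE; ring.
  rewrite (le_trans (ler_normD _ _))// (le_trans (lerD (ler_normD _ _) (lexx _)))//.
  have E : x m - (x s + step s m (x s)) - (y m - (y s + step s m (y s))) =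
     remainder x s m - remainder y s m.
    by rewrite -!remainderE.
  rewrite E in p3.
  set w := (t - s) `^ (3 * alpha).
  have w0 : 0 <= w by exact: powR_ge0.
  have mid : (m - s) `^ (3 * alpha) + (t - m) `^ (3 * alpha) = ro * w by exact: midpoint_powR.
  have msw : (m - s) `^ (3 * alpha) <= w.
    by rewrite ge0_ler_powR ?nnegrE ?subr_ge0// ?(ltW al30)// lerB.
  have q1 := wal s t as_ st tb.
  have p4 : `|remainder x s m - remainder y s m| <= ka * W * w.
    by apply: le_trans p1 _; rewrite ler_wpM2l// mulr_ge0// ltW.
  have pw0 := powR_ge0 (t - s) alpha.
  have p5 : C2 * (`|x s - y s| * w + `|remainder x s m - remainder y s m| * (t - s) `^ alpha) <=
      ka * (2 * eps) * W * w.
    apply: (@le_trans _ _ (C * (W * w) + (C * (t - s) `^ alpha) * (ka * W * w))).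
      rewrite mulrDr; apply: lerD.
        by apply: ler_pM => //; [exact: mulr_ge0|exact: ler_wpM2r].
      rewrite [C2 * _]mulrCA [leRHS]mulrC; apply: ler_pM => //; first exact: mulr_ge0.
      exact: ler_wpM2r.
    have q2 : C * (t - s) `^ alpha * (ka * W * w) <= eps * (ka * W * w).
      by apply: ler_wpM2r => //; rewrite mulr_ge0// mulr_ge0// ltW.
    apply: le_trans (lerD (lexx _) q2) _; rewrite -kaC.
    by rewrite le_eqVlt; apply/orP; left; apply/eqP; ring.
  apply: le_trans (lerD (lerD p1 p2) (le_trans p3 p5)) _.
  rewrite -mulrDr mid; apply: (@le_trans _ _ (ka * (eta * W) * w)).
    by rewrite le_eqVlt; apply/orP; left; apply/eqP; rewrite /eta /eps; field.
  rewrite ler_wpM2r// ler_wpM2l ?(ltW ka0)// lerDr; exact: normr_ge0.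
(* The starting bound: both paths lie in the ball of radius r, and each has its
   own remainder constant. *)
pose W0 := 2 * r + (Cx + `|Cy|) / ka.
have r0 : 0 <= r by have [+ _] := ball a (lexx _) ab; apply: le_trans.
have W00 : 0 <= W0 by rewrite addr_ge0 ?mulr_ge0// ?addr_ge0// ?invr_ge0 ltW.
have PW0 : P W0.
  move=> s t as_ st tb; split.
    have [xs ys] := ball s as_ (le_trans st tb).
    apply: (@le_trans _ _ (2 * r)); last by rewrite lerDl mulr_ge0 ?addr_ge0// invr_ge0 ltW.
    by rewrite (le_trans (ler_normB _ _))// mulr2n mulrDl mul1r lerD.
  rewrite (le_trans (ler_normB _ _))// (le_trans (lerD (remx s t as_ st tb) (remy s t as_ st tb)))//.
  rewrite -mulrDl ler_wpM2r ?powR_ge0//.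
  have -> : ka * W0 = ka * (2 * r) + (Cx + `|Cy|) by rewrite /W0; field; rewrite gt_eqF.
  apply: (@le_trans _ _ (Cx + `|Cy|)); first by rewrite lerD2l ler_norm.
  by rewrite lerDr mulr_ge0 ?(ltW ka0)// mulr_ge0.
have fin := affine_iteration eta01 (normr_ge0 (x a - y a) : 0 <= de) Pup Pit W00 PW0.
move=> s t as_ st tb; have w0 := powR_ge0 (t - s) (3 * alpha); split.
  apply: (@le_trans _ _ (de / (1 - eta))).
    by apply/ler_addgt0Pr => e e0; have [] := fin e e0 s t as_ st tb.
  rewrite mulrC ler_wpM2r// /L mulrDl div1r.
  have h3 : 0 <= ka / (1 - eta) by rewrite divr_ge0// ltW.
  lra.
apply: (@le_trans _ _ (ka * (de / (1 - eta)) * (t - s) `^ (3 * alpha))).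
  apply/ler_addgt0Pr => e e0.
  have e'0 : 0 < e / (ka * (t - s) `^ (3 * alpha) + 1) by rewrite divr_gt0// ltr_wpDl// mulr_ge0// ltW.
  have [_ H] := fin _ e'0 s t as_ st tb; apply: le_trans H _.
  rewrite mulrDr mulrDl lerD2l.
  set D := ka * _ + 1 in e'0 *.
  have D0 : 0 < D by rewrite ltr_wpDl// mulr_ge0// ltW.
  have -> : ka * (e / D) * (t - s) `^ (3 * alpha) = e * (ka * (t - s) `^ (3 * alpha) / D) by ring.
  by rewrite ler_piMr ?(ltW e0)// ler_pdivrMr// mul1r lerDl.
rewrite ler_wpM2r// mulrA [ka * de]mulrC -mulrA [leRHS]mulrC ler_wpM2l// /L mulrDl div1r.
have h3 : 0 <= (1 - eta)^-1 by rewrite invr_ge0 ltW.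
lra.
Qed.

End Stability.

Section GlobalStability.
Context (R : realType) (N K : nat) (alpha t0 t1 : R).
Context (Z : R -> 'cV[R]_K) (ZZ : R -> R -> 'M[R]_K).
Context (f : 'cV[R]_N -> 'cV[R]_N) (sigma : 'cV[R]_N -> 'M[R]_(N, K)).
Hypothesis halpha : 3^-1 < alpha <= 2^-1.
Hypothesis ht : t0 <= t1.
Hypothesis hZ : geometric_rough_path alpha t0 t1 Z ZZ.
Hypothesis sf : smooth_on setT f.
Hypothesis ssigma : smooth_on setT sigma.
Implicit Types (x y : R -> 'cV[R]_N).

Local Notation rem := (remainder Z ZZ f sigma).

Let al0 : 0 < alpha. Proof. by case/andP: halpha; lra. Qed.

(** Iteration of the local result over boundedly many intervals of length h. *)
Lemma global_stability r Cx : 0 <= Cx -> exists2 h, 0 < h & exists2 L, 1 <= L &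
  forall T x y, t0 <= T -> T <= t1 ->
  (forall s, t0 <= s -> s <= T -> `|x s| <= r /\ `|y s| <= r) ->
  (forall s t, t0 <= s -> s <= t -> t <= T ->
     `|rem x s t| <= Cx * (t - s) `^ (3 * alpha)) ->
  (exists Cy, forall s t, t0 <= s -> s <= t -> t <= T ->
     `|rem y s t| <= Cy * (t - s) `^ (3 * alpha)) ->
  (forall s, t0 <= s -> s <= T -> `|x s - y s| <= L * `|x t0 - y t0|) /\
  (forall s t, t0 <= s -> s <= t -> t <= T -> t - s <= h ->
    `|rem x s t - rem y s t| <= L * `|x t0 - y t0| * (t - s) `^ (3 * alpha)).
Proof.
move=> Cx0.
have [h h0 [L L1 loc]] := local_stability halpha ht hZ sf ssigma r Cx0.
have L0 : 0 <= L by lra.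
have [n Hn] : exists n, t1 <= t0 + n%:R * h.
  exists (Num.bound ((t1 - t0) / h)); rewrite -lerBlDl -ler_pdivrMr//.
  by apply/ltW/archi_boundP; rewrite divr_ge0 ?subr_ge0// ltW.
exists h => //; exists (L ^+ n.+1); first exact: exprn_ege1.
move=> T x y tT Tt ball remx [Cy remy].
set de := `|x t0 - y t0|; have de0 : 0 <= de by exact: normr_ge0.
have locT a b : t0 <= a -> a <= b -> b <= T -> b - a <= h ->
  forall s t, a <= s -> s <= t -> t <= b -> `|x s - y s| <= L * `|x a - y a| /\
    `|rem x s t - rem y s t| <= L * `|x a - y a| * (t - s) `^ (3 * alpha).
  move=> ta ab bT bah; apply: loc => //; first exact: le_trans Tt.
  - by move=> s as_ sb; apply: ball; [exact: le_trans as_|exact: le_trans bT].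
  - by move=> s t as_ st tb; apply: remx => //; [exact: le_trans as_|exact: le_trans bT].
  by exists Cy => s t as_ st tb; apply: remy => //; [exact: le_trans as_|exact: le_trans bT].
have main m s : t0 <= s -> s <= T -> s <= t0 + m%:R * h -> `|x s - y s| <= L ^+ m * de.
  elim: m s => [|m IH] s ts sT.
    by rewrite mul0r addr0 => st; have -> : s = t0 by [apply/le_anti; rewrite st]; rewrite expr0 mul1r.
  have mh0 : 0 <= m%:R * h by rewrite mulr_ge0// ltW.
  have [sm _|ms smh] := leP s (t0 + m%:R * h).
    apply: le_trans (IH s ts sT sm) _; rewrite ler_wpM2r// exprS ler_peMl//.
    exact: exprn_ge0.
  have sh : s - (t0 + m%:R * h) <= h.
    by rewrite lerBlDl; apply: le_trans smh _; rewrite -natr1 mulrDl mul1r addrA.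
  have ta : t0 <= t0 + m%:R * h by rewrite lerDl.
  have [p1 _] := locT _ _ ta (ltW ms) sT sh s s (ltW ms) (lexx _) (lexx _).
  apply: le_trans p1 _; rewrite exprS -mulrA ler_wpM2l//.
  by apply: IH => //; exact: le_trans (ltW ms) sT.
have mainn s : t0 <= s -> s <= T -> `|x s - y s| <= L ^+ n * de.
  by move=> ts sT; apply: main => //; apply: le_trans Hn; exact: le_trans Tt.
split=> [s ts sT|s t ts st tT' tsh].
  by apply: le_trans (mainn s ts sT) _; rewrite ler_wpM2r// exprS ler_peMl// exprn_ge0.
have [_ p2] := locT s t ts st tT' tsh s t (lexx _) st (lexx _).
apply: le_trans p2 _; rewrite ler_wpM2r ?powR_ge0// exprS -mulrA ler_wpM2l//.
by apply: mainn => //; exact: le_trans st tT'.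
Qed.

(** A solution starting close to x cannot leave the unit neighbourhood of x: as
    long as it has stayed there, stability keeps it within 1/2, and by continuity
    it needs a definite time eta to move by another 1/2. *)
Lemma solution_stability x :
  holder_path t0 t1 alpha x -> holder2 t0 t1 (3 * alpha) (rem x) ->
  exists2 h, 0 < h & exists2 d, 0 < d & exists2 L, 1 <= L & forall y,
  holder_path t0 t1 alpha y -> holder2 t0 t1 (3 * alpha) (rem y) ->
  `|x t0 - y t0| <= d ->
  (forall s, t0 <= s -> s <= t1 -> `|x s - y s| <= L * `|x t0 - y t0|) /\
  (forall s t, t0 <= s -> s <= t -> t <= t1 -> t - s <= h ->
    `|rem x s t - rem y s t| <= L * `|x t0 - y t0| * (t - s) `^ (3 * alpha)).
Proof.
move=> hx /holder2_ge0[Cx Cx0 HCx].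
have /bounded_pathP[r r0 xr] := holder_path_bounded ht (ltW al0) hx.
have [h h0 [L L1 glob]] := global_stability (r + 1) Cx0.
have L0 : 0 < L by lra.
exists h => //; exists (L^-1 / 2); first by rewrite divr_gt0// invr_gt0.
exists L => // y hy [Cy HCy] de.
have [C C0 HC] := holder2_ge0 (holder2B hx hy).
have C10 : 0 < C + 1 by lra.
(* eta is a time during which the distance of x and y moves by at most 1/2. *)
have [eta eta0 Heta] := powR_small al0 (divr_gt0 (ltr0Sn R 0) (mulr_gt0 (ltr0Sn R 1) C10)).
have Lde : L * `|x t0 - y t0| <= 2^-1.
  by apply: le_trans (_ : L * (L^-1 / 2) <= _); rewrite ?ler_wpM2l ?(ltW L0)// mulrA divff ?gt_eqF// mul1r.
have ballT T : T <= t1 -> (forall s, t0 <= s -> s <= T -> `|x s - y s| <= 1) ->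
    forall s, t0 <= s -> s <= T -> `|x s| <= r + 1 /\ `|y s| <= r + 1.
  move=> Tt H s ts sT; have xs := xr s ts (le_trans sT Tt); split; first by lra.
  have -> : y s = x s - (x s - y s) by rewrite opprB addrC subrK.
  by rewrite (le_trans (ler_normB _ _))// lerD// H.
have stab T : t0 <= T -> T <= t1 -> (forall s, t0 <= s -> s <= T -> `|x s - y s| <= 1) ->
  (forall s, t0 <= s -> s <= T -> `|x s - y s| <= L * `|x t0 - y t0|) /\
  (forall s t, t0 <= s -> s <= t -> t <= T -> t - s <= h ->
    `|rem x s t - rem y s t| <= L * `|x t0 - y t0| * (t - s) `^ (3 * alpha)).
  move=> tT Tt H; apply: glob => //; first exact: ballT.
    by move=> s t ts st tT'; apply: HCx => //; exact: le_trans Tt.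
  by exists Cy => s t ts st tT'; apply: HCy => //; exact: le_trans Tt.
have close m s : t0 <= s -> s <= t1 -> s <= t0 + m%:R * eta -> `|x s - y s| <= 1.
  elim: m s => [|m IH] s ts st.
    rewrite mul0r addr0 => st0; have -> : s = t0 by apply/le_anti; rewrite st0.
    have : `|x t0 - y t0| <= L * `|x t0 - y t0| by rewrite ler_peMl.
    lra.
  have [sm _|ms smh] := leP s (t0 + m%:R * eta); first exact: IH.
  set a := t0 + m%:R * eta in ms *.
  have ta : t0 <= a by rewrite lerDl mulr_ge0// ltW.
  have at1 : a <= t1 by exact: le_trans (ltW ms) st.
  have [p1 _] := stab a ta at1 (fun s' ts' s'a => IH s' ts' (le_trans s'a at1) s'a).
  have {}p1 := le_trans (p1 a ta (lexx _)) Lde.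
  have sa : s - a <= eta.
    by rewrite lerBlDl; apply: le_trans smh _; rewrite -natr1 mulrDl mul1r addrA.
  have p2 : C * (s - a) `^ alpha <= 2^-1.
    have sa0 : 0 <= s - a by rewrite subr_ge0 ltW.
    have H := Heta _ sa0 sa.
    apply: (@le_trans _ _ ((C + 1) * (1 / (2 * (C + 1))))).
      by rewrite ler_pM ?powR_ge0// lerDl.
    by rewrite le_eqVlt; apply/orP; left; apply/eqP; field; rewrite gt_eqF.
  have p3 := le_trans (HC a s ta (ltW ms) st) p2.
  have -> : x s - y s = (x s - x a - (y s - y a)) + (x a - y a).
    by apply/matrixP => i j; rewrite !mxE; ring.
  by rewrite (le_trans (ler_normD _ _))//; lra.
apply: stab => // s ts st.
apply: (close (Num.bound ((t1 - t0) / eta))) => //; apply: le_trans st _.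
rewrite -lerBlDl -ler_pdivrMr//.
by apply/ltW/archi_boundP; rewrite divr_ge0 ?subr_ge0// ltW.
Qed.

End GlobalStability.

(** * Jacobians and the product rule *)

Section JacobianCalculus.
Context (R : realType) (n : nat).
Implicit Types (g h : 'cV[R]_n -> 'cV[R]_n) (x v : 'cV[R]_n).

Lemma vsmooth_sum (I : finType) (g : I -> 'cV[R]_n -> 'cV[R]_n) :
  (forall i, vsmooth (g i)) -> vsmooth (fun x => \sum_i g i x).
Proof.
move=> sg l; rewrite (_ : (fun x => _) = fun x => \sum_i g i x l 0).
  by apply: smooth_sum => i; exact: sg.
by apply/funext => x; rewrite summxE.
Qed.

Lemma vsmoothD g h : vsmooth g -> vsmooth h -> vsmooth (fun x => g x + h x).
Proof.
move=> sg sh l; rewrite (_ : (fun x => _) = fun x => g x l 0 + h x l 0).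
  by apply: smoothD; [exact: sg|exact: sh].
by apply/funext => x; rewrite mxE.
Qed.

Lemma vsmoothZ (c : R) g : vsmooth g -> vsmooth (fun x => c *: g x).
Proof.
move=> sg l; rewrite (_ : (fun x => _) = fun x => c * g x l 0).
  by apply: smoothM; [exact: smooth_cst|exact: sg].
by apply/funext => x; rewrite mxE.
Qed.

Lemma jac_eq_diff g x (A : 'M[R]_n) : vsmooth g -> (forall v, 'd g x v = A *m v) -> jac g x = A.
Proof.
move=> sg H; apply/matrixP => l i.
have := H (delta_mx i 0); rewrite diff_jac// => /matrixP/(_ l 0).
by rewrite -!colE !mxE.
Qed.

Lemma jacD g h x : vsmooth g -> vsmooth h ->
  jac (fun x => g x + h x) x = jac g x + jac h x.
Proof.
move=> sg sh; apply: jac_eq_diff => [|v]; first exact: vsmoothD.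
rewrite (@diffD _ _ _ g h) ?mulmxDl -?diff_jac//; exact: vsmooth_differentiable.
Qed.

Lemma jacZ (c : R) g x : vsmooth g -> jac (fun x => c *: g x) x = c *: jac g x.
Proof.
move=> sg; apply: jac_eq_diff => [|v]; first exact: vsmoothZ.
rewrite (@diffZ _ _ _ g c) -?scalemxAl -?diff_jac//; exact: vsmooth_differentiable.
Qed.

Lemma partialD (a b : 'cV[R]_n -> R) i x : smoothr a -> smoothr b ->
  partial (fun y => a y + b y) i x = partial a i x + partial b i x.
Proof. by move=> sa sb; rewrite /partial -deriveD//; apply/diff_derivable/smooth_diff. Qed.

Lemma partialM (a b : 'cV[R]_n -> R) i x : smoothr a -> smoothr b ->
  partial (fun y => a y * b y) i x = a x * partial b i x + b x * partial a i x.
Proof. by move=> sa sb; rewrite /partial -deriveM//; apply/diff_derivable/smooth_diff. Qed.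

Lemma partial_sum (I : Type) (r : seq I) (a : I -> 'cV[R]_n -> R) i x :
  (forall k, smoothr (a k)) ->
  partial (fun y => \sum_(k <- r) a k y) i x = \sum_(k <- r) partial (a k) i x.
Proof.
move=> sa; elim: r => [|k r IH].
  rewrite big_nil (_ : (fun y => _) = cst 0); first exact: derive_cst.
  by apply/funext => y; rewrite big_nil.
rewrite big_cons -IH -partialD//; last exact: smooth_sum.
by congr (partial _ _ _); apply/funext => y; rewrite big_cons.
Qed.

Lemma jac_sum (I : finType) (g : I -> 'cV[R]_n -> 'cV[R]_n) x :
  (forall i, vsmooth (g i)) -> jac (fun x => \sum_i g i x) x = \sum_i jac (g i) x.
Proof.
move=> sg; apply/matrixP => l i; rewrite summxE mxE.
have -> : (fun y => (\sum_k g k y) l 0 : R^o) = fun y => \sum_k g k y l 0.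
  by apply/funext => y; rewrite summxE.
rewrite -[LHS]/(partial _ _ _) partial_sum; last by move=> k; exact: sg.
by apply: eq_bigr => k _; rewrite mxE.
Qed.

(** Differentiating the first factor produces second derivatives in the order
    opposite to that of [jac_along]; they are exchanged by
    [smooth_derive_sym]. *)
Lemma jac_jac_mul g h x : vsmooth g -> vsmooth h ->
  jac (fun y => jac g y *m h y) x =
  \matrix_(l, i) (\sum_m h x m 0 * partial (partial (fun y => g y l 0) i) m x) +
  jac g x *m jac h x.
Proof.
move=> sg sh; apply/matrixP => l i; rewrite [LHS]mxE [RHS]mxE [X in _ = X + _]mxE [X in _ = _ + X]mxE.
have -> : (fun y => (jac g y *m h y) l 0 : R^o) =
    fun y => \sum_m partial (fun z => g z l 0) m y * h y m 0.
  by apply/funext => y; rewrite mxE; apply: eq_bigr => m _; rewrite mxE.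
have sp m : smoothr (partial (fun z => g z l 0) m) by exact/smooth_partial.
rewrite -[LHS]/(partial _ _ _) partial_sum; last first.
  by move=> m; apply: smoothM => //; exact: sh.
rewrite -big_split /=; apply: eq_bigr => m _.
have HS : partial (partial (fun y => g y l 0) m) i x = partial (partial (fun y => g y l 0) i) m x.
  exact: (smooth_derive_sym (delta_mx i 0) (delta_mx m 0) x (sg l)).
by rewrite (partialM _ _ (sp m) (sh m)) HS addrC [jac g x l m]mxE [jac h x m i]mxE.
Qed.

End JacobianCalculus.

(** * Two-parameter bounds on short intervals *)

(** Boundedness takes care of the long intervals. *)
Lemma holder2_local (R : realType) (t0 t1 : R) (V : normedModType R) be h (X : R -> R -> V) C :
  0 <= be -> 0 < h -> holder2 t0 t1 0 X ->
  (forall s t, t0 <= s -> s <= t -> t <= t1 -> t - s <= h -> `|X s t| <= C * (t - s) `^ be) ->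
  holder2 t0 t1 be X.
Proof.
move=> be0 h0 /holder2_ge0[B B0 HB] HC; exists (`|C| + B / h `^ be) => s t h1 h2 h3.
have hb : 0 < h `^ be by exact: powR_gt0.
have w0 := powR_ge0 (t - s) be.
have [tsh|tsh] := leP (t - s) h.
  apply: le_trans (HC s t h1 h2 h3 tsh) _; rewrite ler_wpM2r//.
  by rewrite (le_trans (ler_norm _))// lerDl divr_ge0// ltW.
apply: (@le_trans _ _ (B / h `^ be * (t - s) `^ be)); last by rewrite ler_wpM2r// lerDr.
have := HB s t h1 h2 h3; rewrite powRr0 mulr1 => /le_trans; apply.
rewrite -mulrA ler_peMr// mulrC ler_pdivlMr// mul1r.
by rewrite ge0_ler_powR ?nnegrE// ?subr_ge0 ?(ltW h0)// ltW.
Qed.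

(** Cutting an interval into halves improves the constant of a bound of order
    greater than 1, hence that constant is 0. *)
Lemma holder_path_const (R : realType) (t0 t1 : R) (V : normedModType R) be (g : R -> V) :
  t0 <= t1 -> 1 < be -> holder_path t0 t1 be g -> g t0 = g t1.
Proof.
move=> t01 be1 /holder2_ge0[C C0 HC].
pose P M := forall s t, t0 <= s -> s <= t -> t <= t1 -> `|g t - g s| <= M * (t - s) `^ be.
have Pup M M' : M <= M' -> P M -> P M'.
  by move=> MM H s t h1 h2 h3; apply: le_trans (H s t h1 h2 h3) _; rewrite ler_wpM2r// powR_ge0.
have Pit M : 0 <= M -> P M -> P (0 + halving be * M).
  move=> M0 H s t h1 h2 h3; rewrite add0r.
  pose m := (s + t) / 2.
  have sm : s <= m by rewrite /m; lra.
  have mt : m <= t by rewrite /m; lra.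
  have -> : g t - g s = (g t - g m) + (g m - g s) by rewrite subrKA.
  rewrite (le_trans (ler_normD _ _))//.
  have p1 := H s m h1 sm (le_trans mt h3); have p2 := H m t (le_trans h1 sm) mt h3.
  rewrite (le_trans (lerD p2 p1))// -mulrDr addrC midpoint_powR//.
  by rewrite mulrCA mulrA.
have r01 : 0 <= halving be < 1 by rewrite halving_ge0 halving_lt1.
have := affine_iteration r01 (lexx 0) Pup Pit C0 HC; rewrite mul0r => H.
apply/eqP; rewrite -subr_eq0 -normr_le0 distrC; apply/ler_addgt0Pr => e e0.
have w0 := powR_ge0 (t1 - t0) be.
have e'0 : 0 < e / ((t1 - t0) `^ be + 1) by rewrite divr_gt0// ltr_wpDl.
have := H _ e'0 t0 t1 (lexx _) t01 (lexx _); rewrite !add0r => /le_trans; apply.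
have D0 : 0 < (t1 - t0) `^ be + 1 by rewrite ltr_wpDl.
by rewrite -mulrA ler_piMr ?(ltW e0)// mulrC ler_pdivrMr// mul1r lerDl.
Qed.

(** * The variational equation and its pairing with the adjoint *)

Section Linearisation.
Context (R : realType) (N K : nat) (alpha t0 t1 : R).
Context (Z : R -> 'cV[R]_K) (ZZ : R -> R -> 'M[R]_K).
Context (f : 'cV[R]_N -> 'cV[R]_N) (sigma : 'cV[R]_N -> 'M[R]_(N, K)).
Hypothesis halpha : 3^-1 < alpha <= 2^-1.
Hypothesis ht : t0 <= t1.
Hypothesis hZ : geometric_rough_path alpha t0 t1 Z ZZ.
Hypothesis sf : smooth_on setT f.
Hypothesis ssigma : smooth_on setT sigma.

Local Notation sg := (sigma_col sigma).
Local Notation step := (state_step Z ZZ f sigma).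
Local Notation rem := (remainder Z ZZ f sigma).

Let al0 : 0 <= alpha. Proof. by case/andP: halpha; lra. Qed.
Let al20 : 0 <= 2 * alpha. Proof. by move: al0; lra. Qed.
Let al30 : 0 <= 3 * alpha. Proof. by move: al0; lra. Qed.
Let al31 : 1 < 3 * alpha. Proof. by case/andP: halpha; lra. Qed.

Definition first_order s t x : 'M[R]_N := \sum_j (Z t - Z s) j 0 *: jac (sg j) x.

Definition second_order s t x : 'M[R]_N :=
  (t - s) *: jac f x + \sum_k \sum_j ZZ s t k j *: jac_along sigma k j x.

(** The two orders of multiplication: the first occurs in the variational
    equation, the second in the transpose of the adjoint equation. *)
Definition iterated s t x : 'M[R]_N :=
  \sum_k \sum_j ZZ s t k j *: (jac (sg j) x *m jac (sg k) x).

Definition iterated_rev s t x : 'M[R]_N :=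
  \sum_k \sum_j ZZ s t k j *: (jac (sg k) x *m jac (sg j) x).

Definition variation s t x := first_order s t x + (second_order s t x + iterated s t x).

Lemma vsmooth_step s t : vsmooth (step s t).
Proof.
rewrite /state_step; apply: vsmoothD; first apply: vsmoothD.
- by apply: vsmoothZ => l; exact: smooth_entry.
- by apply: vsmooth_sum => j; apply: vsmoothZ; exact: vsmooth_sigma_col.
apply: vsmooth_sum => k; apply: vsmooth_sum => j; apply: vsmoothZ.
by apply: vsmooth_jac_mul; exact: vsmooth_sigma_col.
Qed.

Lemma jac_step s t x : jac (step s t) x = variation s t x.
Proof.
have vf : vsmooth f by move=> l; exact: smooth_entry.
have vs j : vsmooth (sg j) by exact: vsmooth_sigma_col.
have vss k j : vsmooth (fun x => jac (sg j) x *m sg k x) by exact: vsmooth_jac_mul.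
have v1 : vsmooth (fun x => (t - s) *: f x) by exact: vsmoothZ.
have v2 : vsmooth (fun x => \sum_j (Z t - Z s) j 0 *: sg j x).
  by apply: vsmooth_sum => j; exact: vsmoothZ.
have v3 k : vsmooth (fun x => \sum_j ZZ s t k j *: (jac (sg j) x *m sg k x)).
  by apply: vsmooth_sum => j; exact: vsmoothZ.
rewrite /state_step (jacD _ (vsmoothD v1 v2) (vsmooth_sum v3)) (jacD _ v1 v2).
have -> : jac (fun x => \sum_j (Z t - Z s) j 0 *: sg j x) x = first_order s t x.
  rewrite (@jac_sum _ _ _ (fun j x => (Z t - Z s) j 0 *: sg j x)); last by move=> j; exact: vsmoothZ.
  by apply: eq_bigr => j _; rewrite jacZ.
have -> : jac (fun x => \sum_k \sum_j ZZ s t k j *: (jac (sg j) x *m sg k x)) x =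
    \sum_k \sum_j ZZ s t k j *: jac_along sigma k j x + iterated s t x.
  rewrite (@jac_sum _ _ _ (fun k x => \sum_j ZZ s t k j *: (jac (sg j) x *m sg k x)))// -big_split; apply: eq_bigr => k _ /=.
  rewrite (@jac_sum _ _ _ (fun j x => ZZ s t k j *: (jac (sg j) x *m sg k x))); last by move=> j; exact: vsmoothZ.
  rewrite -big_split; apply: eq_bigr => j _ /=.
  by rewrite jacZ// (jac_jac_mul _ (vs j) (vs k)) -scalerDr.
rewrite jacZ// /variation /second_order.
move: (first_order s t x) (\sum_k _) (iterated s t x) (_ *: _) => a b c d.
by apply/matrixP => i j; rewrite !mxE; ring.
Qed.

Lemma adjoint_stepE s t x p : adjoint_step Z ZZ f sigma s t x p =
  - ((first_order s t x + (second_order s t x - iterated_rev s t x))^T *m p).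
Proof.
have trsum (I : finType) (F : I -> 'M[R]_N) : (\sum_i F i)^T = \sum_i (F i)^T.
  by rewrite raddf_sum.
rewrite /adjoint_step; congr (- _).
rewrite linearD /= linearB /= linearD /= linearZ /= !trsum !mulmxDl mulNmx !mulmx_suml -scalemxAl.
have -> : \sum_k \sum_j ZZ s t k j *: ((jac_along sigma k j x)^T *m p -
        (jac (sg j) x)^T *m ((jac (sg k) x)^T *m p)) =
   \sum_k (\sum_j ZZ s t k j *: jac_along sigma k j x)^T *m p -
   \sum_k (\sum_j ZZ s t k j *: (jac (sg k) x *m jac (sg j) x))^T *m p.
  rewrite -sumrB; apply: eq_bigr => k _; rewrite !trsum !mulmx_suml -sumrB.
  apply: eq_bigr => j _.
  by rewrite linearZ /= linearZ /= trmx_mul -!scalemxAl scalerBr mulmxA.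
have -> : \sum_j (Z t - Z s) j 0 *: ((jac (sg j) x)^T *m p) =
    \sum_j ((Z t - Z s) j 0 *: jac (sg j) x)^T *m p.
  by apply: eq_bigr => j _; rewrite linearZ /= -scalemxAl.
move: (\sum_j _) (\sum_k _) (\sum_k _) (_ *: _) => a b c d.
by apply/matrixP => i j; rewrite !mxE; ring.
Qed.

(** This is where geometricity enters: the symmetric part of ZZ is half the square
    of the increment of Z, so the sum over both orders is a square. *)
Lemma iterated_sym s t x : t0 <= s -> s <= t -> t <= t1 ->
  iterated s t x + iterated_rev s t x = first_order s t x *m first_order s t x.
Proof.
move=> h1 h2 h3; have [_ _ _ geo] := hZ.
rewrite /iterated_rev exchange_big /= /iterated -big_split /= /first_order mulmx_sumr.
apply: eq_bigr => k _; rewrite -big_split /= mulmx_suml; apply: eq_bigr => j _.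
rewrite -scalerDl -scalemxAl -scalemxAr scalerA; congr (_ *: _).
have := geo s t h1 h2 h3 => /matrixP/(_ k j); rewrite mxE [X in _ + X]mxE => ->.
by rewrite mxE big_ord1 [X in _ * X]mxE mulrC.
Qed.

Section AlongPath.
Variable q : R -> 'cV[R]_N.
Hypothesis hq : holder_path t0 t1 alpha q.

Let bq : bounded_path t0 t1 q. Proof. exact: holder_path_bounded hq. Qed.

Lemma jac_bounded (g : 'cV[R]_N -> 'cV[R]_N) : vsmooth g -> bounded_path t0 t1 (fun s => jac g (q s)).
Proof.
move=> vg; apply: holder2_entries => l i.
have := bounded_path_comp (smooth_partial i (vg l)) bq.
by apply: holder2_eq => s t _ _ _; rewrite mxE.
Qed.

Lemma jac_along_bounded k j : bounded_path t0 t1 (fun s => jac_along sigma k j (q s)).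
Proof.
apply: holder2_entries => l i.
have sm : smoothr (fun x => \sum_m sg k x m 0 * partial (partial (fun y => sg j y l 0) i) m x).
  apply: smooth_sum => m; apply: smoothM; first exact: smooth_sigma_col.
  by do 2 apply: smooth_partial; exact: smooth_sigma_col.
have := bounded_path_comp sm bq.
by apply: holder2_eq => s t _ _ _; rewrite mxE.
Qed.

Let a0b (be : R) : 0 <= be -> 0 <= be <= be + 0. Proof. by move=> be0; rewrite addr0 be0 lexx. Qed.

Lemma first_order_holder : holder2 t0 t1 alpha (fun s t => first_order s t (q s)).
Proof.
apply: holder2_sum => j.
have vj : vsmooth (sg j) by exact: vsmooth_sigma_col.
exact: (holder2Z ht al0 (lexx 0) (a0b al0) (rough_increment_holder hZ j) (jac_bounded vj)).
Qed.

Lemma second_order_holder : holder2 t0 t1 (2 * alpha) (fun s t => second_order s t (q s)).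
Proof.
have vf : vsmooth f by move=> l; exact: smooth_entry.
apply: holder2D.
  exact: (holder2Z ht al20 (lexx 0) (a0b al20) (coef2_holder halpha ht hZ None) (jac_bounded vf)).
apply: holder2_sum => k; apply: holder2_sum => j.
exact: (holder2Z ht al20 (lexx 0) (a0b al20) (rough_second_holder hZ k j) (jac_along_bounded k j)).
Qed.

Lemma iterated_holder (D : 'I_K -> 'I_K -> R -> 'M[R]_N) :
  (forall k j, bounded_path t0 t1 (D k j)) ->
  holder2 t0 t1 (2 * alpha) (fun s t => \sum_k \sum_j ZZ s t k j *: D k j s).
Proof.
move=> HD; apply: holder2_sum => k; apply: holder2_sum => j.
exact: (holder2Z ht al20 (lexx 0) (a0b al20) (rough_second_holder hZ k j) (HD k j)).
Qed.

Let jac_prod_bounded j k : bounded_path t0 t1 (fun s => jac (sg j) (q s) *m jac (sg k) (q s)).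
Proof.
have vs i : vsmooth (sg i) by exact: vsmooth_sigma_col.
exact: (holder2_mulmx ht (lexx 0) (lexx 0) (a0b (lexx 0)) (jac_bounded (vs j)) (jac_bounded (vs k))).
Qed.

Lemma variation_holder : holder2 t0 t1 alpha (fun s t => variation s t (q s)).
Proof.
have al12 : alpha <= 2 * alpha by move: al0; lra.
apply: holder2D first_order_holder _; apply: (holder2_le ht al0 al12).
apply: holder2D second_order_holder _.
exact: (iterated_holder (fun k j => jac_prod_bounded j k)).
Qed.

(** Up to O(|t - s|^(3 alpha)) the row p^T is multiplied on the right by 1 - J' and
    the column Q on the left by 1 + J.  In (1 - J') (1 + J) = 1 + (J - J' - J' J)
    the bracket has no terms of order below 3 alpha, by [iterated_sym]. *)
Lemma pairing_const (p Q : R -> 'cV[R]_N) : bounded_path t0 t1 p -> bounded_path t0 t1 Q ->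
  holder2 t0 t1 (3 * alpha) (fun s t => Q t - Q s - variation s t (q s) *m Q s) ->
  holder2 t0 t1 (3 * alpha) (fun s t => p t - p s - adjoint_step Z ZZ f sigma s t (q s) (p s)) ->
  (p t0)^T *m Q t0 = (p t1)^T *m Q t1.
Proof.
move=> bp bQ hQ hp.
have tr_holder m n be (X : R -> R -> 'M[R]_(m, n)) : holder2 t0 t1 be X -> holder2 t0 t1 be (fun s t => (X s t)^T).
  move=> HX; apply: holder2_entries => i j; have := holder2_entry j i HX.
  by apply: holder2_eq => s t _ _ _; rewrite mxE.
apply: (@holder_path_const _ t0 t1 'M[R]_1 _ (fun t => (p t)^T *m Q t) ht al31).
set rQ := (X in holder2 _ _ _ X) in hQ; set rp := (X in holder2 _ _ _ X) in hp.
pose M s t := first_order s t (q s).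
pose F s t := second_order s t (q s).
pose X s t := iterated s t (q s); pose Y s t := iterated_rev s t (q s).
have hM : holder2 t0 t1 alpha M by exact: first_order_holder.
have hF : holder2 t0 t1 (2 * alpha) F by exact: second_order_holder.
have hX : holder2 t0 t1 (2 * alpha) X.
  exact: (iterated_holder (fun k j => jac_prod_bounded j k)).
have hY : holder2 t0 t1 (2 * alpha) Y.
  exact: (iterated_holder (fun k j => jac_prod_bounded k j)).
pose W s t := M s t *m (F s t + X s t) + (F s t - Y s t) *m variation s t (q s).
have e1 : 0 <= 3 * alpha <= alpha + 2 * alpha by move: al30; lra.
have e2 : 0 <= 3 * alpha <= 2 * alpha + alpha by move: al30; lra.
have e3 : 0 <= 3 * alpha <= 0 + 3 * alpha by rewrite add0r al30 lexx.
have e4 : 0 <= 3 * alpha <= 3 * alpha + 0 by rewrite addr0 al30 lexx.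
have e5 : 0 <= 3 * alpha <= 3 * alpha + 3 * alpha by move: al30; lra.
have hW : holder2 t0 t1 (3 * alpha) W.
  apply: holder2D; first exact: (holder2_mulmx ht al0 al20 e1 hM (holder2D hF hX)).
  exact: (holder2_mulmx ht al20 al0 e2 (holder2B hF hY) variation_holder).
have bend m (x : R -> 'cV[R]_m) : bounded_path t0 t1 x -> holder2 t0 t1 0 (fun _ t => x t).
  move=> /bounded_pathP[C _ HC]; exists C => s t h1 h2 h3.
  by rewrite powRr0 mulr1 HC// (le_trans h1).
have H1 := holder2_mulmx ht (lexx 0) al30 e3 (tr_holder _ _ _ _ bp)
  (holder2_mulmx ht al30 (lexx 0) e4 hW bQ).
have H2 := holder2_mulmx ht al30 (lexx 0) e4 (tr_holder _ _ _ _ hp) (bend _ _ bQ).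
have H3 := holder2_mulmx ht (lexx 0) al30 e3 (tr_holder _ _ _ _ (bend _ _ bp)) hQ.
have H4 := holder2_mulmx ht al30 al30 e5 (tr_holder _ _ _ _ hp) hQ.
have := holder2D (holder2B (holder2D H2 H3) H4) (holder2N H1).
apply: holder2_eq => s t h1 h2 h3.
have Eq : Q t = Q s + variation s t (q s) *m Q s + rQ s t.
  rewrite /rQ; move: (variation s t (q s) *m Q s) => a; move: (Q s) (Q t) => b c.
  by apply/matrixP => i j; rewrite !mxE; ring.
have Ep : (p t)^T = (p s)^T - (p s)^T *m (M s t + (F s t - Y s t)) + (rp s t)^T.
  have -> : p t = p s + adjoint_step Z ZZ f sigma s t (q s) (p s) + rp s t.
    rewrite /rp; move: (adjoint_step _ _ _ _ _ _ _ _) => a; move: (p s) (p t) => b c.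
    by apply/matrixP => i j; rewrite !mxE; ring.
  have trD (a b : 'cV[R]_N) : (a + b)^T = a^T + b^T by exact: linearD.
  have trN (a : 'cV[R]_N) : (- a)^T = - a^T by exact: linearN.
  by rewrite !trD adjoint_stepE trN trmx_mul trmxK.
have key : ((p s)^T - (p s)^T *m (M s t + (F s t - Y s t))) *m (Q s + variation s t (q s) *m Q s) =
   (p s)^T *m Q s - (p s)^T *m (W s t *m Q s).
  set u := (p s)^T; set v := Q s; set J := variation s t (q s); set J' := M s t + _.
  have JJ : J - J' - J' *m J = - W s t.
    have symm : X s t + Y s t = M s t *m M s t by exact: iterated_sym.
    have JE : J = M s t + (F s t + X s t) by [].
    rewrite /W -/J /J' mulmxDl {2}JE mulmxDr -symm {1}JE.
    move: (M s t) (F s t) (X s t) (Y s t) ((_ - _) *m _) (_ *m _) => m1 m2 m3 m4 m5 m6.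
    by apply/matrixP => i j; rewrite !mxE; ring.
  have -> : u *m (W s t *m v) = - (u *m ((J - J' - J' *m J) *m v)).
    by rewrite JJ mulNmx mulmxN opprK.
  rewrite opprK !mulmxBl !mulmxBr mulmxDr mulmxDr.
  rewrite !mulmxA.
  move: (u *m v) (u *m J *m v) (u *m J' *m v) (_ *m _) => a b c d.
  by apply/matrixP => i j; rewrite !mxE; ring.
have {}key : (p t)^T *m Q t - (p t)^T *m rQ s t - ((rp s t)^T *m Q t - (rp s t)^T *m rQ s t) =
    (p s)^T *m Q s - (p s)^T *m (W s t *m Q s).
  rewrite -key -!mulmxBr -mulmxBl Ep Eq !addrK.
  by [].
move: key; move: ((p t)^T *m Q t) ((p s)^T *m Q s) ((p t)^T *m _) ((rp s t)^T *m rQ s t) (_ *m Q t) ((p s)^T *m _) => a b c d e g key.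
apply/matrixP => i j; move/matrixP: key => /(_ i j); rewrite !mxE; lra.
Qed.
End AlongPath.
End Linearisation.

(** * Differentiation in the initial datum *)

Lemma derive_increment (R : realType) (V : normedModType R) n (a b : V -> 'cV[R]_n)
    (g : 'cV[R]_n -> 'cV[R]_n) (c v : V) :
  differentiable a c -> differentiable b c -> vsmooth g ->
  derivable (fun c => a c - b c - g (b c)) c v /\
  'D_v (fun c => a c - b c - g (b c)) c =
    'd a c v - 'd b c v - jac g (b c) *m 'd b c v.
Proof.
move=> da db vg.
have dg := vsmooth_differentiable (b c) vg.
have dgb : differentiable (g \o b) c by exact: differentiable_comp.
have dab : differentiable (a - b) c by exact: differentiableB.
have dd : differentiable (a - b - (g \o b)) c by exact: differentiableB.
have Dab : derivable (a - b) c v by exact: diff_derivable.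
have Dgb : derivable (g \o b) c v by exact: diff_derivable.
have e1 : 'D_v (a - b - (g \o b)) c = 'D_v (a - b) c - 'D_v (g \o b) c by exact: deriveB.
have e2 : 'D_v (a - b) c = 'D_v a c - 'D_v b c by apply: deriveB; exact: diff_derivable.
have e3 : 'D_v (g \o b) c = jac g (b c) *m 'd b c v.
  have h1 : 'D_v (g \o b) c = 'd (g \o b) c v by exact: deriveE dgb.
  have h2 : 'd (g \o b) c v = 'd g (b c) ('d b c v).
    exact: (congr1 (fun F : V -> 'cV[R]_n => F v) (diff_comp db dg)).
  exact: etrans h1 (etrans h2 (diff_jac _ _ vg)).
split; first exact: diff_derivable dd.
transitivity ('D_v (a - b) c - 'D_v (g \o b) c); first exact: e1.
by rewrite e2 e3 (deriveE _ da) (deriveE _ db).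
Qed.

Section Dependence.
Context (R : realType) (N K : nat) (alpha t0 t1 : R).
Context (Z : R -> 'cV[R]_K) (ZZ : R -> R -> 'M[R]_K).
Context (f : 'cV[R]_N -> 'cV[R]_N) (sigma : 'cV[R]_N -> 'M[R]_(N, K)).
Hypothesis halpha : 3^-1 < alpha <= 2^-1.
Hypothesis ht : t0 <= t1.
Hypothesis hZ : geometric_rough_path alpha t0 t1 Z ZZ.
Hypothesis sf : smooth_on setT f.
Hypothesis ssigma : smooth_on setT sigma.

Local Notation rem := (remainder Z ZZ f sigma).
Local Notation vari := (variation Z ZZ f sigma).

Let al0 : 0 <= alpha. Proof. by case/andP: halpha; lra. Qed.
Let al30 : 0 <= 3 * alpha. Proof. by move: al0; lra. Qed.

(** The remainder of the state expansion at fixed s and t is differentiable in the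
    parameter because each q_t is; stability bounds its difference quotients by
    the width to the power 3 alpha, and this passes to the derivative. *)
Lemma linearised_expansion (V : normedModType R) (xi : V -> R -> 'cV[R]_N) (c v : V) (B e : R) :
  0 < e ->
  (forall t, t0 <= t -> t <= t1 -> differentiable (fun c' => xi c' t) c) ->
  (forall h, 0 <= h < e -> holder_path t0 t1 alpha (xi (c + h *: v)) /\
     holder2 t0 t1 (3 * alpha) (rem (xi (c + h *: v)))) ->
  (forall h, 0 <= h < e -> `|xi c t0 - xi (c + h *: v) t0| <= B * h) ->
  let Q t := 'd (fun c' => xi c' t) c v in
  bounded_path t0 t1 Q /\
  holder2 t0 t1 (3 * alpha) (fun s t => Q t - Q s - vari s t (xi c s) *m Q s).
Proof.
move=> e0 dxi sol init Q.
have h0e : 0 <= (0 : R) < e by rewrite lexx.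
have [hx hr] : holder_path t0 t1 alpha (xi c) /\ holder2 t0 t1 (3 * alpha) (rem (xi c)).
  by have := sol 0 h0e; rewrite scale0r addr0.
have [h h0 [d d0 [L L1 stab]]] := solution_stability halpha ht hZ sf ssigma hx hr.
have L0 : 0 <= L by lra.
pose e' := Num.min e (d / (`|B| + 1)).
have B1 : 0 < `|B| + 1 by rewrite ltr_wpDl.
have e'0 : 0 < e' by rewrite lt_min e0 divr_gt0.
have stabh k : 0 < k < e' ->
  (forall s, t0 <= s -> s <= t1 -> `|xi c s - xi (c + k *: v) s| <= L * `|B| * k) /\
  (forall s t, t0 <= s -> s <= t -> t <= t1 -> t - s <= h ->
    `|rem (xi c) s t - rem (xi (c + k *: v)) s t| <= L * `|B| * (t - s) `^ (3 * alpha) * k).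
  move=> /andP[k0]; rewrite lt_min => /andP[ke kd].
  have k0e : 0 <= k < e by rewrite ltW.
  have [hy hry] := sol k k0e.
  have p1 : `|xi c t0 - xi (c + k *: v) t0| <= `|B| * k.
    by apply: le_trans (init k k0e) _; rewrite ler_wpM2r ?ler_norm// ltW.
  have p2 : `|B| * k <= d.
    move: kd; rewrite ltr_pdivlMr// => /ltW; apply: le_trans.
    by rewrite mulrC ler_wpM2l ?(ltW k0)// lerDl.
  have [q1 q2] := stab _ hy hry (le_trans p1 p2); split=> [s ts st|s t ts st tt tsh].
    by apply: le_trans (q1 s ts st) _; rewrite -mulrA ler_wpM2l.
  apply: le_trans (q2 s t ts st tt tsh) _.
  by rewrite [leRHS]mulrAC ler_wpM2r ?powR_ge0// -mulrA ler_wpM2l.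
have bQ : bounded_path t0 t1 Q.
  apply: (@bounded_pathI _ _ _ _ _ (L * `|B|)) => s ts st.
  rewrite /Q -deriveE; last exact: dxi.
  apply: (@derive_le _ _ _ (fun c' => xi c' s) c v _ e') => // [|k ke].
    exact/diff_derivable/dxi.
  by rewrite distrC; have [q1 _] := stabh k ke; exact: q1.
split=> //.
apply: (@holder2_local _ _ _ _ _ h _ (L * `|B|)) => //.
  have vh := variation_holder halpha ht hZ sf ssigma hx.
  have e00 : 0 <= (0 : R) <= 0 + 0 by rewrite addr0 lexx.
  have bvQ := holder2_mulmx ht (lexx 0) (lexx 0) e00 (holder2_le ht (lexx 0) al0 vh) bQ.
  have endQ : holder2 t0 t1 0 (fun _ t => Q t).
    have [C _ HC] := bounded_pathP bQ; exists C => s t h1 h2 h3.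
    by rewrite powRr0 mulr1 HC// (le_trans h1).
  exact: holder2B (holder2B endQ bQ) bvQ.
move=> s t ts st tt tsh.
have ts1 : t0 <= t by exact: le_trans st.
have s1 : s <= t1 by exact: le_trans tt.
have vs := vsmooth_step Z ZZ sf ssigma s t.
have [dPsi DPsi] := derive_increment v (dxi t ts1 tt) (dxi s ts s1) vs.
rewrite -jac_step// -DPsi.
apply: (@derive_le _ _ _ _ c v _ e') => // k ke.
by rewrite distrC; have [_ q2] := stabh k ke; exact: q2.
Qed.

End Dependence.

(** * Conservation of the Liouville form *)

Unset Implicit Arguments.
Set Strict Implicit.

Theorem proposition2p6 (R : realType) (N K : nat) (alpha t0 t1 : R)
    (Z : R -> 'cV[R]_K) (ZZ : R -> R -> 'M[R]_K)
    (f : 'cV[R]_N -> 'cV[R]_N) (sigma : 'cV[R]_N -> 'M[R]_(N, K))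
    (A : set 'cV[R]_N)
    (q p : 'cV[R]_N * 'cV[R]_N -> R -> 'cV[R]_N)
    (halpha : 3^-1 < alpha <= 2^-1)
    (ht : t0 < t1)
    (hZ : geometric_rough_path alpha t0 t1 Z ZZ)
    (hf : smooth_on setT f)
    (hsigma : smooth_on setT sigma)
    (hA : open A)
    (hforward : forall a, A a -> exists x : R -> 'cV[R]_N,
       unique_on t0 t1 (forward_solution alpha t0 t1 Z ZZ f sigma a) x)
    (hadjoint : forall a b, A a ->
       unique_on t0 t1 (adjoint_solution alpha t0 t1 Z ZZ f sigma a b)
         (fun t => (q (a, b) t, p (a, b) t)))
    (hsmooth : forall t, t0 <= t -> t <= t1 ->
       smooth_on [set ab | A ab.1] (fun ab => q ab t) /\
       smooth_on [set ab | A ab.1] (fun ab => p ab t)) :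
  forall ab : 'cV[R]_N * 'cV[R]_N, A ab.1 ->
    pdq (fun ab => p ab t0) (fun ab => q ab t0) ab =
    pdq (fun ab => p ab t1) (fun ab => q ab t1) ab.
Proof.
move=> ab Aab; apply/funext => v.
have ht' := ltW ht.
have al0 : 0 <= alpha by case/andP: halpha; lra.
have sol c : A c.1 -> [/\ q c t0 = c.1, holder_path t0 t1 alpha (q c),
    holder_path t0 t1 alpha (p c),
    holder2 t0 t1 (3 * alpha) (remainder Z ZZ f sigma (q c)) &
    holder2 t0 t1 (3 * alpha) (fun s t => p c t - p c s - adjoint_step Z ZZ f sigma s t (q c s) (p c s))].
  move: c => [a b] /= Aa; have [adj _] := hadjoint a b Aa.
  have [fwd _ cp _] := adj; have [qa cq _] := fwd; split=> //.
  - exact: (controlled_holder halpha ht' hZ cq).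
  - exact: (controlled_holder halpha ht' hZ cp).
  - exact: (state_expansion halpha ht' hZ hf hsigma fwd).
  - exact: (adjoint_expansion halpha ht' hZ hf hsigma adj).
have [e e0 He] : exists2 e, 0 < e & forall h, 0 <= h < e -> A (ab + h *: v).1.
  have := hA _ Aab => /nbhs_ballP[e /= e0 eA].
  exists (e / (`|v.1| + 1)); first by rewrite divr_gt0// ltr_wpDl.
  move=> h /andP[h0 he]; apply: eA; rewrite -ball_normE /ball_ /=.
  rewrite opprD addrA subrr sub0r normrN normrZ ger0_norm//.
  move: he; rewrite ltr_pdivlMr ?ltr_wpDl//; apply: le_lt_trans.
  by rewrite ler_wpM2l// lerDl.
have dq t : t0 <= t -> t <= t1 -> differentiable (fun c => q c t) ab.
  by move=> h1 h2; have [/(_ 1%N)[+ _] _] := hsmooth t h1 h2; apply.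
have [qab hq hp rq rp] := sol ab Aab.
have solh h : 0 <= h < e -> holder_path t0 t1 alpha (q (ab + h *: v)) /\
    holder2 t0 t1 (3 * alpha) (remainder Z ZZ f sigma (q (ab + h *: v))).
  by move=> he; have [] := sol _ (He h he).
have init h : 0 <= h < e -> `|q ab t0 - q (ab + h *: v) t0| <= `|v.1| * h.
  move=> he; have [-> _ _ _ _] := sol _ (He h he); rewrite qab /=.
  rewrite opprD addrA subrr sub0r normrN normrZ mulrC ger0_norm//.
  by case/andP: he.
have [bQ hQ] := linearised_expansion halpha ht' hZ hf hsigma e0 dq solh init.
have pair := pairing_const halpha ht' hZ hf hsigma hq (holder_path_bounded ht' al0 hp) bQ hQ rp.
have pdqE t : t0 <= t -> t <= t1 -> pdq (fun ab => p ab t) (fun ab => q ab t) ab v =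
    ((p ab t)^T *m 'd (fun c => q c t) ab v) 0 0.
  move=> h1 h2; rewrite /pdq mxE; apply: eq_bigr => i _; rewrite mxE; congr (_ * _).
  have dk k l : differentiable (fun c => q c t k l : R^o) ab.
    apply: (@differentiable_comp _ _ _ _ (fun c => q c t) (fun y : 'cV[R]_N => y k l : R^o)); first exact: dq.
    exact: differentiable_coord.
  exact: (esym (@diff_entry _ _ _ _ (fun c => q c t) ab v i 0 dk)).
have pair00 := congr1 (fun M : 'M[R]_1 => M 0 0) pair.
exact: etrans (pdqE t0 (lexx t0) ht') (etrans pair00 (esym (pdqE t1 ht' (lexx t1)))).
Qed.
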